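(* Let $r_0$ be a real number with $-1<r_0<0$, and suppose $\sigma$ and $r_1$ satisfy one of the following two assumptions: (1) $\sigma=1$ and $r_1>0$; (2) $\max\{\tfrac23,\,2-4r_1,\,-r_0+r_1\}<\sigma<1$ and $\tfrac14<r_1<-r_0$. Then there is a constant $C>0$ (depending only on $r_0,r_1,\sigma$) such that for any functions $f,g\in L^2(\mathbb R^2)$, $$\big\|\,|\nabla|^{r_0}(fg)\big\|_{L^2}\le C\,\big\|\,|\nabla|^{\sigma}f\big\|_{\dot H^{-r_1}\cap\dot H^{r_1}}\,\|g\|_{\dot H^{r_0}} .$$
   Context: On $\mathbb R^2$, for $s\in\mathbb R$, $|\nabla|^sf=\mathscr F^{-1}(|\xi|^s\mathscr Ff)$ with $\mathscr F$ the Fourier transform, and $\|f\|_{\dot H^s}=\||\nabla|^sf\|_{L^2}$. The norm of an intersection is $\|\cdot\|_{X\cap Y}=\|\cdot\|_X+\|\cdot\|_Y$. The inequality is understood as trivially true if the right-hand side is infinite. *)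

(* Defs.v *)
From HB Require Import structures.
From mathcomp Require Import all_boot all_order all_algebra.
From mathcomp Require Import complex.
From mathcomp Require Import all_classical all_reals all_analysis.

Set Implicit Arguments.
Unset Strict Implicit.
Unset Printing Implicit Defensive.

Import Order.TTheory GRing.Theory Num.Theory.
Import numFieldNormedType.Exports.

Local Open Scope classical_set_scope.
Local Open Scope ring_scope.
Local Open Scope complex_scope.

Section PlaneFourier.
Variable R : realType.

Local Notation C := R[i].
Local Notation plane := (R * R)%type.

Local Notation mplane := (measurableTypeR R * measurableTypeR R)%type.
Local Notation mu2 := (@lebesgue_measure R \x @lebesgue_measure R)%E.

Definition dotp (x y : plane) : R := x.1 * y.1 + x.2 * y.2.

(* The Euclidean norm; the library's norm on a product is the max norm. *)
Definition enorm (x : plane) : R := Num.sqrt (dotp x x).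

Definition expi (t : R) : C := cos t +i* sin t.

Definition cmeasurable (f : plane -> C) : Prop :=
  measurable_fun [set: mplane] (fun x => complex.Re (f x)) /\
  measurable_fun [set: mplane] (fun x => complex.Im (f x)).

Definition cintegrable (f : plane -> C) : Prop :=
  mu2.-integrable [set: mplane] (fun x => (complex.Re (f x))%:E) /\
  mu2.-integrable [set: mplane] (fun x => (complex.Im (f x))%:E).

Definition cint (f : plane -> C) : C :=
  Rintegral mu2 [set: mplane] (fun x => complex.Re (f x)) +i*
  Rintegral mu2 [set: mplane] (fun x => complex.Im (f x)).

Definition L2norm (f : plane -> C) : \bar R :=
  Lnorm mu2 2%:E (fun x : mplane => (Normc.normc (f x))%:E).

Definition L2fun (f : plane -> C) : Prop :=
  cmeasurable f /\ (L2norm f < +oo)%E.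

Definition fourier (f : plane -> C) (xi : plane) : C :=
  cint (fun x => f x * expi (- dotp x xi)).

Definition ifourier (f : plane -> C) (x : plane) : C :=
  ((2 * pi) ^- 2)%:C * cint (fun xi => f xi * expi (dotp x xi)).

(* [pderiv w f] is the iterated partial derivative of f along the word w,
   where true and false stand for the first and second coordinate. *)
Definition pderiv (w : seq bool) (f : plane -> R) : plane -> R :=
  foldr (fun (b : bool) (h : plane -> R) =>
           'D_(if b then (1, 0) else (0, 1) : plane) h) f w.

Definition rschwartz (f : plane -> R) : Prop :=
  (forall w x, differentiable (pderiv w f) x) /\
  (forall w (k : nat), exists M : R,
     forall x, enorm x ^+ k * `|pderiv w f x| <= M).

Definition schwartz (phi : plane -> C) : Prop :=
  rschwartz (fun x => complex.Re (phi x)) /\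
  rschwartz (fun x => complex.Im (phi x)).

(* Tempered distributions are represented by functionals of which only the
   values at Schwartz functions matter.  Linearity and continuity are not
   recorded: every functional used below is, up to Fourier transform,
   integration against some w with [tempered_fun w], and is hence linear and,
   by the closed graph theorem, continuous on the Schwartz space. *)
Definition distr := (plane -> C) -> C.

Definition tempered_fun (w : plane -> C) : Prop :=
  forall phi, schwartz phi -> cintegrable (fun x => w x * phi x).

Definition distr_of (w : plane -> C) : distr :=
  fun phi => cint (fun x => w x * phi x).

Definition represents (w : plane -> C) (T : distr) : Prop :=
  tempered_fun w /\ forall phi, schwartz phi -> T phi = distr_of w phi.

Definition fourierD (T : distr) : distr := fun phi => T (fourier phi).

Definition ifourierD (T : distr) : distr := fun phi => T (ifourier phi).

Definition riesz_mul (s : R) (w : plane -> C) (xi : plane) : C :=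
  (enorm xi `^ s)%:C * w xi.

(* |nabla|^s T = F^-1 (|xi|^s F T).  This is a partial operation, given as the
   set of its values: it is defined when F T is a function v such that |xi|^s v
   is again a tempered distribution, and its value is then unique on Schwartz
   functions since v is unique almost everywhere; otherwise the set is empty. *)
Definition fracD (s : R) (T : distr) : set distr :=
  [set U | exists v, [/\ represents v (fourierD T),
                         tempered_fun (riesz_mul s v) &
                         U = ifourierD (distr_of (riesz_mul s v))]].

(* The infimum of the empty set is +oo: a distribution which is not a function
   has infinite L^2 norm, and one whose |nabla|^s is undefined has infinite
   homogeneous Sobolev norm. *)
Definition L2normD (T : distr) : \bar R :=
  ereal_inf [set L2norm u | u in [set u | represents u T]].

Definition norm_fracD (N : distr -> \bar R) (s : R) (T : distr) : \bar R :=
  ereal_inf [set N U | U in fracD s T].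

Definition Hnorm (s : R) (T : distr) : \bar R := norm_fracD L2normD s T.

Definition capnorm (N1 N2 : distr -> \bar R) (T : distr) : \bar R :=
  (N1 T + N2 T)%E.

End PlaneFourier.

(* Main.v *)
Require Import Defs.
From HB Require Import structures.
From mathcomp Require Import all_boot all_order all_algebra.
From mathcomp Require Import complex.
From mathcomp Require Import all_classical all_reals all_analysis.
From mathcomp Require Import measurable_realfun.
From mathcomp Require Import ring lra.

(** Let F and G be the Fourier transforms of f and g, and let s = - r0, which
    lies in ]0, 1[.  Up to the factor (2 pi)^-2 the transform of f g is the
    convolution of F and G, so the claim is a weighted estimate for the
    convolution of the nonnegative functions |F| and |G|: with
    alpha = sigma - r1 and beta = sigma + r1, the square integral of
    |xi|^-s (|F| * |G|) is at most a constant times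
    (|| |z|^alpha F ||^2 + || |z|^beta F ||^2) || |eta|^-s G ||^2.
    Each of the two assumptions on sigma and r1 implies alpha < 1 < beta
    ([exponents]), and this is what makes the estimate hold.  From
    |eta| <= |xi| + |xi - eta| one gets ([ker_split])

      |xi|^-s <= 2 |eta|^-s (1 + k(xi, xi - eta)),

    where k(xi, z) is |xi|^-s |z|^s for |xi| <= |z| and 0 otherwise.  For the
    summand 1, the Cauchy-Schwarz inequality in eta leaves a convolution of
    integrable functions, because 1 / (|z|^(2 alpha) + |z|^(2 beta)) is
    integrable on the plane when alpha < 1 < beta.  For the summand k, the
    Cauchy-Schwarz inequality leaves the square integral of k(xi, z) in xi,
    which is at most C |z|^2 since s < 1, and |z|^2 is at most
    |z|^(2 alpha) + |z|^(2 beta).  This is [weighted_convolution_le].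

    The remainder supplies the Fourier analysis.  The transform of a square
    integrable function ([L2_fourier]) is a limit of transforms of functions
    that are both integrable and square integrable; it exists and is bounded by
    the Plancherel inequality [plancherel_le].  All uniqueness statements rest on
    [gauss_null]: an integrable function whose integrals against all real
    Gaussians vanish is null.  Since the transforms of Gaussians are explicit,
    this yields Fourier inversion ([L2_fourier_inversion]), hence the product
    formula [fourier_mul], and it determines the functions that represent a
    given tempered distribution.

    The norms of the theorem are infima over such representing functions.  On
    the right-hand side these functions are determined almost everywhere, so
    that the infima are bounded below by weighted norms of F and G
    ([Hnorm_ge], [norm_capH_ge]); on the left-hand side it is enough to
    exhibit one representing function ([norm_fracD_le]).  If a weighted norm
    of F or G is infinite, then so is the infimum that it bounds, and the
    extended real arithmetic of the final computation covers this case. *)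

Set Implicit Arguments.
Unset Strict Implicit.
Unset Printing Implicit Defensive.

Import Order.TTheory GRing.Theory Num.Theory.
Import numFieldNormedType.Exports.

Local Open Scope classical_set_scope.
Local Open Scope ring_scope.

(** * Complex numbers and integrals of complex functions *)

Notation nrm := Normc.normc.

Section ComplexArith.
Variable R : realType.

Lemma normr_sqr (x : R) : `|x| ^+ 2 = x ^+ 2.
Proof. by rewrite real_normK// num_real. Qed.

Implicit Types z w : R[i].

Lemma cReD z w : complex.Re (z + w) = complex.Re z + complex.Re w.
Proof. by case: z; case: w. Qed.
Lemma cImD z w : complex.Im (z + w) = complex.Im z + complex.Im w.
Proof. by case: z; case: w. Qed.
Lemma cReN z : complex.Re (- z) = - complex.Re z.
Proof. by case: z. Qed.
Lemma cImN z : complex.Im (- z) = - complex.Im z.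
Proof. by case: z. Qed.
Lemma cReM z w : complex.Re (z * w) =
  complex.Re z * complex.Re w - complex.Im z * complex.Im w.
Proof. by case: z; case: w. Qed.
Lemma cImM z w : complex.Im (z * w) =
  complex.Re z * complex.Im w + complex.Im z * complex.Re w.
Proof. by case: z => a b; case: w => c e. Qed.
Lemma cReJ z : complex.Re (conjc z) = complex.Re z.
Proof. by case: z. Qed.
Lemma cImJ z : complex.Im (conjc z) = - complex.Im z.
Proof. by case: z. Qed.

Definition ReImE := (cReD, cImD, cReN, cImN, cReM, cImM, cReJ, cImJ).

Lemma rcM (x y : R) :
  real_complex R (x * y) = real_complex R x * real_complex R y.
Proof. exact: rmorphM. Qed.

Lemma conjM z w : conjc (z * w) = conjc z * conjc w.
Proof. exact: rmorphM. Qed.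

Lemma complex_ext z w : complex.Re z = complex.Re w ->
  complex.Im z = complex.Im w -> z = w.
Proof. by case: z => a b; case: w => c e /= -> ->. Qed.

Lemma nrmE z : nrm z = Num.sqrt (complex.Re z ^+ 2 + complex.Im z ^+ 2).
Proof. by case: z. Qed.

Lemma nrm_sqr z : nrm z ^+ 2 = complex.Re z ^+ 2 + complex.Im z ^+ 2.
Proof. by rewrite nrmE sqr_sqrtr// addr_ge0// sqr_ge0. Qed.

Lemma nrm_ge0 z : 0 <= nrm z.
Proof. by rewrite nrmE sqrtr_ge0. Qed.

Lemma Re_le_nrm z : `|complex.Re z| <= nrm z.
Proof.
by rewrite -ler_sqr ?nnegrE ?nrm_ge0// nrm_sqr normr_sqr lerDl sqr_ge0.
Qed.

Lemma Im_le_nrm z : `|complex.Im z| <= nrm z.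
Proof.
by rewrite -ler_sqr ?nnegrE ?nrm_ge0// nrm_sqr normr_sqr lerDr sqr_ge0.
Qed.

Lemma nrm_le_ReIm z : nrm z <= `|complex.Re z| + `|complex.Im z|.
Proof.
rewrite -ler_sqr ?nnegrE ?nrm_ge0 ?addr_ge0// nrm_sqr sqrrD !normr_sqr.
by rewrite lerD2r lerDl mulrn_wge0// mulr_ge0.
Qed.

Lemma nrmM z w : nrm (z * w) = nrm z * nrm w.
Proof. exact: Normc.normcM. Qed.

Lemma nrmD z w : nrm (z + w) <= nrm z + nrm w.
Proof. exact: le_normcD. Qed.

Lemma nrmN z : nrm (- z) = nrm z.
Proof. exact: normcN. Qed.

Lemma nrmJ z : nrm (conjc z) = nrm z.
Proof. by rewrite !nrmE cReJ cImJ sqrrN. Qed.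

Lemma nrm_real (x : R) : nrm (real_complex R x) = `|x|.
Proof. by rewrite nrmE /= expr0n addr0 sqrtr_sqr. Qed.

Lemma nrm0 : nrm (0 : R[i]) = 0.
Proof. by rewrite (_ : 0 = real_complex R 0)// nrm_real normr0. Qed.

Lemma nrm_eq0 z : nrm z = 0 -> z = 0.
Proof. exact: Normc.eq0_normc. Qed.

Lemma mulJ_nrm z : conjc z * z = real_complex R (nrm z ^+ 2).
Proof. by apply: complex_ext; rewrite /= !ReImE ?nrm_sqr; ring. Qed.

Lemma nrm_sqrD z w : nrm (z + w) ^+ 2 <= 2 * nrm z ^+ 2 + 2 * nrm w ^+ 2.
Proof.
rewrite !nrm_sqr !ReImE; set a := complex.Re z; set b := complex.Im z.
set c := complex.Re w; set e := complex.Im w.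
by have := sqr_ge0 (a - c); have := sqr_ge0 (b - e); nra.
Qed.

Lemma nrm_expi (t : R) : nrm (expi t) = 1.
Proof. by rewrite nrmE /expi /= cos2Dsin2 sqrtr1. Qed.

Lemma expiD (s t : R) : expi (s + t) = expi s * expi t.
Proof. by apply: complex_ext; rewrite /= ?cosD ?sinD//; ring. Qed.

Lemma expiN (t : R) : expi (- t) = conjc (expi t).
Proof. by apply: complex_ext; rewrite /= ?cosN ?sinN. Qed.

Lemma expi0 : expi (0 : R) = 1.
Proof. by apply: complex_ext; rewrite /= ?cos0 ?sin0. Qed.

End ComplexArith.

Section ComplexMeasurable.
Context d (T : measurableType d) (R : realType).
Implicit Types f g : T -> R[i].

Definition cmeas f :=
  measurable_fun setT (fun x => complex.Re (f x)) /\
  measurable_fun setT (fun x => complex.Im (f x)).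

Lemma cmeas_cst z : cmeas (fun=> z).
Proof. by split; exact: measurable_cst. Qed.

Lemma cmeasD f g : cmeas f -> cmeas g -> cmeas (fun x => f x + g x).
Proof.
move=> [fr fi] [gr gi]; split.
  by under eq_fun do rewrite cReD; exact: measurable_funD.
by under eq_fun do rewrite cImD; exact: measurable_funD.
Qed.

Lemma cmeasN f : cmeas f -> cmeas (fun x => - f x).
Proof.
move=> [fr fi]; split.
  by under eq_fun do rewrite cReN; exact: measurableT_comp.
by under eq_fun do rewrite cImN; exact: measurableT_comp.
Qed.

Lemma cmeasB f g : cmeas f -> cmeas g -> cmeas (fun x => f x - g x).
Proof. by move=> mf mg; apply: cmeasD => //; exact: cmeasN. Qed.

Lemma cmeasM f g : cmeas f -> cmeas g -> cmeas (fun x => f x * g x).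
Proof.
move=> [fr fi] [gr gi]; split.
  by under eq_fun do rewrite cReM; apply: measurable_funB; exact: measurable_funM.
by under eq_fun do rewrite cImM; apply: measurable_funD; exact: measurable_funM.
Qed.

Lemma cmeasJ f : cmeas f -> cmeas (fun x => conjc (f x)).
Proof.
move=> [fr fi]; split.
  by under eq_fun do rewrite cReJ.
by under eq_fun do rewrite cImJ; exact: measurableT_comp.
Qed.

Lemma cmeas_real (u : T -> R) : measurable_fun setT u ->
  cmeas (fun x => real_complex R (u x)).
Proof. by move=> mu; split => //=; exact: measurable_cst. Qed.

Lemma cmeas_expi (u : T -> R) : measurable_fun setT u ->
  cmeas (fun x => expi (u x)).
Proof.
move=> mu; split => /=.
  by apply: measurableT_comp => //; apply: continuous_measurable_fun;
     exact: continuous_cos.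
by apply: measurableT_comp => //; apply: continuous_measurable_fun;
   exact: continuous_sin.
Qed.

Lemma measurable_nrm f : cmeas f -> measurable_fun setT (fun x => nrm (f x)).
Proof.
move=> [fr fi]; under eq_fun do rewrite nrmE.
apply: (measurableT_comp (f := @Num.sqrt R)).
  by apply: continuous_measurable_fun; exact: sqrt_continuous.
by apply: measurable_funD; exact: measurable_funX.
Qed.

Lemma measurable_nrm2 f : cmeas f ->
  measurable_fun setT (fun x => nrm (f x) ^+ 2).
Proof. by move=> mf; apply: measurable_funX; exact: measurable_nrm. Qed.

End ComplexMeasurable.

Lemma cmeas_comp d1 d2 (T1 : measurableType d1) (T2 : measurableType d2)
  (R : realType) (f : T2 -> R[i]) (h : T1 -> T2) :
  cmeas f -> measurable_fun setT h -> cmeas (fun x => f (h x)).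
Proof.
move=> [fr fi] mh; split.
  exact: (measurableT_comp fr mh).
exact: (measurableT_comp fi mh).
Qed.

Section ComplexIntegral.
Context d (T : measurableType d) (R : realType)
  (mu : {measure set T -> \bar R}).
Implicit Types f g : T -> R[i].

Definition cintable f :=
  mu.-integrable setT (fun x => (complex.Re (f x))%:E) /\
  mu.-integrable setT (fun x => (complex.Im (f x))%:E).

Definition cintg f : R[i] := Complex
  (Rintegral mu setT (fun x => complex.Re (f x)))
  (Rintegral mu setT (fun x => complex.Im (f x))).

Lemma cintable_meas f : cintable f -> cmeas f.
Proof.
by move=> [/integrableP[fr _] /integrableP[fi _]]; split; exact/measurable_EFinP.
Qed.

Lemma cintableP f : cmeas f ->
  (\int[mu]_x (nrm (f x))%:E < +oo)%E -> cintable f.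
Proof.
move=> mf fo; have mn := measurable_nrm mf; have [fr fi] := mf; split.
  apply/integrableP; split; first exact/measurable_EFinP.
  apply: le_lt_trans fo; apply: ge0_le_integral => //=.
  - by do 2 apply: measurableT_comp => //.
  - exact/measurable_EFinP.
  - by move=> x _; rewrite lee_fin Re_le_nrm.
apply/integrableP; split; first exact/measurable_EFinP.
apply: le_lt_trans fo; apply: ge0_le_integral => //=.
- by do 2 apply: measurableT_comp => //.
- exact/measurable_EFinP.
- by move=> x _; rewrite lee_fin Im_le_nrm.
Qed.

Lemma cintable_nrm f : cintable f ->
  mu.-integrable setT (fun x => (nrm (f x))%:E).
Proof.
move=> If; have mf := cintable_meas If; have [fr fi] := If.
have Is : mu.-integrable setT (fun x => `|(complex.Re (f x))%:E| +
    `|(complex.Im (f x))%:E|)%E.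
  by apply: integrableD => //; exact: integrable_abse.
apply: (le_integrable measurableT _ _ Is).
  by apply/measurable_EFinP; exact: measurable_nrm.
move=> x _ /=; rewrite lee_fin ger0_norm ?nrm_ge0//.
by rewrite ger0_norm ?addr_ge0// nrm_le_ReIm.
Qed.

Lemma cintable_lty f : cintable f -> (\int[mu]_x (nrm (f x))%:E < +oo)%E.
Proof.
move=> /cintable_nrm /integrableP[_].
by under eq_integral do rewrite gee0_abs ?lee_fin ?nrm_ge0//.
Qed.

Lemma cintable_le f (g : T -> R) : cmeas f ->
  (forall x, nrm (f x) <= g x) -> mu.-integrable setT (fun x => (g x)%:E) ->
  cintable f.
Proof.
move=> mf fg Ig; apply: cintableP => //.
have /integrableP[mg] := Ig; apply: le_lt_trans.
apply: ge0_le_integral => //=.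
- by move=> x _; rewrite lee_fin nrm_ge0.
- by apply/measurable_EFinP; exact: measurable_nrm.
- apply/measurable_EFinP; apply: measurableT_comp => //; exact/measurable_EFinP.
- by move=> x _; rewrite lee_fin (le_trans (fg x))// ler_norm.
Qed.

Lemma cintableD f g : cintable f -> cintable g -> cintable (fun x => f x + g x).
Proof.
move=> [fr fi] [gr gi]; split.
  under eq_fun do rewrite cReD EFinD; exact: integrableD.
under eq_fun do rewrite cImD EFinD; exact: integrableD.
Qed.

Lemma cintgD f g : cintable f -> cintable g ->
  cintg (fun x => f x + g x) = cintg f + cintg g.
Proof.
move=> [fr fi] [gr gi]; apply: complex_ext; rewrite /= -RintegralD//.
  by apply: eq_Rintegral => x _; rewrite cReD.
by apply: eq_Rintegral => x _; rewrite cImD.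
Qed.

Lemma cintableZ f (z : R[i]) : cintable f -> cintable (fun x => z * f x).
Proof.
move=> [fr fi]; split.
  under eq_fun do rewrite cReM EFinB !EFinM.
  by apply: integrableB => //; exact: integrableZl.
under eq_fun do rewrite cImM EFinD !EFinM.
by apply: integrableD => //; exact: integrableZl.
Qed.

Lemma cintgZ f (z : R[i]) : cintable f ->
  cintg (fun x => z * f x) = z * cintg f.
Proof.
move=> [fr fi].
have IZ (a : R) (h : T -> R) : mu.-integrable setT (EFin \o h) ->
    mu.-integrable setT (EFin \o (fun x => a * h x)).
  move=> Ih; rewrite (_ : _ \o _ = fun x => (a%:E * (h x)%:E)%E)//.
  exact: integrableZl.
apply: complex_ext; rewrite !ReImE /= -!RintegralZl//.
  rewrite -RintegralB//; [|exact: IZ|exact: IZ].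
  by apply: eq_Rintegral => x _; rewrite cReM.
rewrite -RintegralD//; [|exact: IZ|exact: IZ].
by apply: eq_Rintegral => x _; rewrite cImM.
Qed.

Lemma cintableN f : cintable f -> cintable (fun x => - f x).
Proof.
by move=> If; under eq_fun do rewrite -mulN1r; exact: cintableZ.
Qed.

Lemma cintgN f : cintable f -> cintg (fun x => - f x) = - cintg f.
Proof.
move=> If; rewrite -[RHS]mulN1r -cintgZ//; congr cintg.
by apply/funext => x; rewrite mulN1r.
Qed.

Lemma cintableB f g : cintable f -> cintable g -> cintable (fun x => f x - g x).
Proof. by move=> If Ig; apply: cintableD => //; exact: cintableN. Qed.

Lemma cintgB f g : cintable f -> cintable g ->
  cintg (fun x => f x - g x) = cintg f - cintg g.
Proof.
by move=> If Ig; rewrite cintgD ?cintgN//; exact: cintableN.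
Qed.

Lemma cintableJ f : cintable f -> cintable (fun x => conjc (f x)).
Proof.
move=> [fr fi]; split.
  by under eq_fun do rewrite cReJ.
by under eq_fun do rewrite cImJ EFinN; exact: integrableN.
Qed.

Lemma cintgJ f : cintable f -> cintg (fun x => conjc (f x)) = conjc (cintg f).
Proof.
move=> [fr fi]; apply: complex_ext; rewrite !ReImE /=.
  by apply: eq_Rintegral => x _; rewrite cReJ.
rewrite -mulN1r -RintegralZl//.
by apply: eq_Rintegral => x _; rewrite cImJ mulN1r.
Qed.

Lemma cintg_real (u : T -> R) :
  cintg (fun x => real_complex R (u x)) = real_complex R (Rintegral mu setT u).
Proof. by apply: complex_ext => //=; rewrite Rintegral_cst// mul0r. Qed.

Lemma eq_cintg f g : f =1 g -> cintg f = cintg g.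
Proof. by move=> fg; congr cintg; exact/funext. Qed.

(** Multiplication by the conjugate of the value of the integral makes the
    integral real, and there the real part of the integrand bounds it. *)
Lemma nrm_cintg_le f : cintable f ->
  ((nrm (cintg f))%:E <= \int[mu]_x (nrm (f x))%:E)%E.
Proof.
move=> If; set z := cintg f.
have [->|z0] := eqVneq (nrm z) 0.
  by apply: integral_ge0 => x _; rewrite lee_fin nrm_ge0.
have zp : 0 < nrm z by rewrite lt_neqAle eq_sym z0 nrm_ge0.
have In := cintable_nrm If.
have /integrable_fin_num-/(_ measurableT) fn := In.
rewrite -(fineK fn) lee_fin -(ler_pM2l zp) -expr2.
have E : conjc z * cintg f = real_complex R (nrm z ^+ 2) := mulJ_nrm z.
rewrite -cintgZ// in E; clearbody z; move/(congr1 (@complex.Re R)) : E => /= <-.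
rewrite -[X in _ <= _ * X]/(Rintegral mu setT (fun x => nrm (f x))) -RintegralZl//.
have Iz := cintableZ (conjc z) If.
apply: le_Rintegral => //.
- by have [] := Iz.
- by rewrite /comp; under eq_fun do rewrite EFinM; exact: integrableZl.
move=> x _; apply: le_trans (ler_norm _) _.
by apply: le_trans (Re_le_nrm _) _; rewrite nrmM nrmJ.
Qed.

Lemma ae_eq_cintg f g : cmeas f -> cmeas g ->
  {ae mu, forall x, f x = g x} -> cintg f = cintg g.
Proof.
move=> [fr fi] [gr gi] fg; apply: complex_ext; rewrite /= /Rintegral; congr fine.
  apply: ae_eq_integral => //; try exact/measurable_EFinP.
  by apply: filterS fg => x /= -> .
apply: ae_eq_integral => //; try exact/measurable_EFinP.
by apply: filterS fg => x /= -> .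
Qed.

(** Dominated convergence, for the real and the imaginary part separately. *)
Lemma cintg_cvg (f_ : (T -> R[i])^nat) f (g : T -> R) :
  (forall n, cmeas (f_ n)) -> cmeas f ->
  {ae mu, forall x, (fun n => nrm (f_ n x - f x)) @ \oo --> (0 : R)} ->
  mu.-integrable setT (fun x => (g x)%:E) ->
  (forall n x, nrm (f_ n x) <= g x) ->
  (fun n => nrm (cintg (f_ n) - cintg f)) @ \oo --> (0 : R).
Proof.
move=> mf_ mf f_f Ig f_g.
have If_ n : cintable (f_ n) by exact: cintable_le (f_g n) Ig.
have Ere (p : R[i] -> R) : (forall z, `|p z| <= nrm z) ->
    (forall z w, p (z - w) = p z - p w) ->
    {ae mu, forall x, (fun n => (p (f_ n x))%:E) @ \oo --> (p (f x))%:E}.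
  move=> pn pB; apply: filterS f_f => x fx.
  apply: cvg_EFin; first by apply: nearW.
  apply/cvgrPdist_le => e e0; near=> n.
  rewrite /= distrC -pB; apply: le_trans (pn _) _; rewrite -[leLHS]ger0_norm ?nrm_ge0//.
  rewrite -[X in `|X|]subr0 distrC; near: n.
  by move/cvgrPdist_le: fx; apply.
have D (p : R[i] -> R) : (forall z, `|p z| <= nrm z) ->
    (forall z w, p (z - w) = p z - p w) ->
    (forall n, measurable_fun setT (fun x => p (f_ n x))) ->
    measurable_fun setT (fun x => p (f x)) ->
    mu.-integrable setT (fun x => (p (f x))%:E) /\
    (fun n => Rintegral mu setT (fun x => p (f_ n x))) @ \oo -->
      Rintegral mu setT (fun x => p (f x)).
  move=> pn pB mpn mp.
  have [] := @dominated_convergence _ _ _ mu _ measurableT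
    (fun n x => (p (f_ n x))%:E) (fun x => (p (f x))%:E) (fun x => (g x)%:E).
  - by move=> n; exact/measurable_EFinP.
  - exact/measurable_EFinP.
  - by have := Ere p pn pB; apply: filterS => x + _.
  - exact: Ig.
  - by apply: aeW => x n _ /=; rewrite lee_fin (le_trans (pn _)).
  - move=> I1 _ C1; split => //.
    by apply: fine_cvg; rewrite fineK//; exact: integrable_fin_num.
have [I1 C1] : mu.-integrable setT (fun x => (complex.Re (f x))%:E) /\
    (fun n => Rintegral mu setT (fun x => complex.Re (f_ n x))) @ \oo -->
      Rintegral mu setT (fun x => complex.Re (f x)).
  apply: (D (@complex.Re R)); last by have [] := mf.
  - exact: Re_le_nrm.
  - by move=> z w; rewrite cReD cReN.
  - by move=> n; have [] := mf_ n.
have [I2 C2] : mu.-integrable setT (fun x => (complex.Im (f x))%:E) /\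
    (fun n => Rintegral mu setT (fun x => complex.Im (f_ n x))) @ \oo -->
      Rintegral mu setT (fun x => complex.Im (f x)).
  apply: (D (@complex.Im R)); last by have [] := mf.
  - exact: Im_le_nrm.
  - by move=> z w; rewrite cImD cImN.
  - by move=> n; have [] := mf_ n.
have C3 : (fun n => `|Rintegral mu setT (fun x => complex.Re (f_ n x)) -
      Rintegral mu setT (fun x => complex.Re (f x))| +
    `|Rintegral mu setT (fun x => complex.Im (f_ n x)) -
      Rintegral mu setT (fun x => complex.Im (f x))|) @ \oo --> (0 : R).
  have N0 (a : R^nat) (l : R) : a @ \oo --> l ->
      (fun n => `|a n - l|) @ \oo --> (0 : R).
    by move=> al; rewrite -(@normr0 _ R); apply: cvg_norm; exact/subr_cvg0.
  rewrite -[X in _ --> X](addr0 0).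
  by apply: cvgD; [exact: N0 C1|exact: N0 C2].
apply: (@squeeze_cvgr _ _ _ _ (fun=> 0)); last exact: C3; last exact: cvg_cst.
apply: nearW => n; apply/andP; split; first exact: nrm_ge0.
by apply: le_trans (nrm_le_ReIm _) _; rewrite !ReImE.
Unshelve. all: by end_near. Qed.

End ComplexIntegral.

Section FatouBound.
Context d (T : measurableType d) (R : realType) (mu : {measure set T -> \bar R}).
Local Open Scope ereal_scope.

(** Fatou's lemma as a bound on an almost everywhere limit, the form in which
    the estimates below pass from approximations to their limits. *)
Lemma fatou_bound (h : nat -> T -> \bar R) (l : T -> \bar R) (C : \bar R) :
  (forall n, measurable_fun setT (h n)) -> (forall n x, 0 <= h n x) ->
  measurable_fun setT l -> (forall x, 0 <= l x) ->
  {ae mu, forall x, h ^~ x @ \oo --> l x} ->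
  (forall n, \int[mu]_x h n x <= C) -> \int[mu]_x l x <= C.
Proof.
move=> mh h0 ml l0 hl hC.
have F := @fatou _ _ _ mu setT measurableT h mh (fun n y _ => h0 n y).
apply: (@le_trans _ _ (\int[mu]_y limn_einf (h ^~ y))).
  rewrite le_eqVlt; apply/orP; left; apply/eqP; apply: ae_eq_integral => //.
    rewrite [X in measurable_fun _ X](_ : _ = fun y => - limn_esup (fun n => - h n y)).
      apply: measurableT_comp => //; apply: measurable_fun_limn_esup => n.
      exact: measurableT_comp.
    by apply/funext => y; rewrite -limn_einfN; congr limn_einf; apply/funext => n /=; rewrite oppeK.
  apply: filterS hl => y hy _; apply/esym.
  by rewrite (is_cvg_limn_einfE (cvgP _ hy)); exact/cvg_lim.
apply: le_trans F _; rewrite limn_einf_lim; apply: lime_le; first exact: is_cvg_einfs.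
apply: nearW => n; apply: le_trans (hC n); apply: ereal_inf_lbound.
by exists n => //=.
Qed.

End FatouBound.

(** * Iterated integrals, the Cauchy-Schwarz inequality, changes of variables in the plane *)

Section PartialIntegral.
Context d1 d2 (T1 : measurableType d1) (T2 : measurableType d2) (R : realType).
Variable m1 : {sigma_finite_measure set T1 -> \bar R}.
Variable m2 : {sigma_finite_measure set T2 -> \bar R}.

(** Splitting into positive and negative part reduces a function of any sign to
    the nonnegative functions of Tonelli's theorem. *)
Lemma measurable_partial_integral (h : T1 * T2 -> \bar R) :
  measurable_fun setT h ->
  measurable_fun setT (fun x => \int[m2]_y h (x, y))%E.
Proof.
move=> mh; rewrite [X in measurable_fun _ X](_ : _ =
    (fun x => \int[m2]_y (h^\+ (x, y)) - \int[m2]_y (h^\- (x, y)))%E).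
  apply: emeasurable_funB.
    apply: (measurable_fun_fubini_tonelli_F (h^\+)%E) => //.
    exact: measurable_funepos.
  apply: (measurable_fun_fubini_tonelli_F (h^\-)%E) => //.
  exact: measurable_funeneg.
apply/funext => x; rewrite [LHS]integralE.
under eq_integral do rewrite (funepos_comp h (fun y => (x, y)))/=.
by under [X in (_ - X = _)%E]eq_integral do
  rewrite (funeneg_comp h (fun y => (x, y)))/=.
Qed.

Lemma cmeas_partial_cintg (f : T1 * T2 -> R[i]) : cmeas f ->
  cmeas (fun x => cintg m2 (fun y => f (x, y))).
Proof.
move=> [fr fi]; split => /=.
  apply: (measurableT_comp (f := fine)) => //.
  apply: (measurable_partial_integral (h := fun z => (complex.Re (f z))%:E)).
  exact/measurable_EFinP.
apply: (measurableT_comp (f := fine)) => //.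
apply: (measurable_partial_integral (h := fun z => (complex.Im (f z))%:E)).
exact/measurable_EFinP.
Qed.

Let Rfubini (u : T1 * T2 -> R) :
  (m1 \x m2)%E.-integrable setT (fun z => (u z)%:E) ->
  Rintegral m1 setT (fun x => Rintegral m2 setT (fun y => u (x, y))) =
  Rintegral (m1 \x m2)%E setT u.
Proof.
move=> Iu; rewrite /Rintegral -(integral12_prod_meas1 Iu); congr fine.
have mF := measurable_fubini_F Iu.
apply: ae_eq_integral => //.
- apply/measurable_EFinP; apply: (measurableT_comp (f := fine)) => //.
have := ae_integrable1 Iu; apply: filterS => x /= Ix _.
by rewrite fineK//; exact: integrable_fin_num.
Qed.

Let Rfubini2 (u : T1 * T2 -> R) :
  (m1 \x m2)%E.-integrable setT (fun z => (u z)%:E) ->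
  Rintegral m2 setT (fun y => Rintegral m1 setT (fun x => u (x, y))) =
  Rintegral (m1 \x m2)%E setT u.
Proof.
move=> Iu; rewrite /Rintegral -(integral21_prod_meas1 Iu); congr fine.
have mF := measurable_fubini_G Iu.
apply: ae_eq_integral => //.
- apply/measurable_EFinP; apply: (measurableT_comp (f := fine)) => //.
have := ae_integrable2 Iu; apply: filterS => x /= Ix _.
by rewrite fineK//; exact: integrable_fin_num.
Qed.

Lemma cfubini1 (f : T1 * T2 -> R[i]) : cintable (m1 \x m2)%E f ->
  cintg m1 (fun x => cintg m2 (fun y => f (x, y))) = cintg (m1 \x m2)%E f.
Proof.
by move=> [fr fi]; apply: complex_ext => /=;
  [rewrite -(Rfubini fr)|rewrite -(Rfubini fi)].
Qed.

Lemma cfubini2 (f : T1 * T2 -> R[i]) : cintable (m1 \x m2)%E f ->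
  cintg m2 (fun y => cintg m1 (fun x => f (x, y))) = cintg (m1 \x m2)%E f.
Proof.
by move=> [fr fi]; apply: complex_ext => /=;
  [rewrite -(Rfubini2 fr)|rewrite -(Rfubini2 fi)].
Qed.

Lemma cfubini (f : T1 * T2 -> R[i]) : cintable (m1 \x m2)%E f ->
  cintg m1 (fun x => cintg m2 (fun y => f (x, y))) =
  cintg m2 (fun y => cintg m1 (fun x => f (x, y))).
Proof. by move=> If; rewrite cfubini1// cfubini2. Qed.

Lemma cintable_partial (f : T1 * T2 -> R[i]) : cintable (m1 \x m2)%E f ->
  cintable m1 (fun x => cintg m2 (fun y => f (x, y))).
Proof.
have H (u : T1 * T2 -> R) : (m1 \x m2)%E.-integrable setT (fun z => (u z)%:E) ->
    m1.-integrable setT (fun x => (Rintegral m2 setT (fun y => u (x, y)))%:E).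
  move=> Iu; have IF := integrable_fubini_F Iu.
  have mF := measurable_int _ IF.
  apply: (le_integrable measurableT _ _ IF).
    by apply/measurable_EFinP; apply: (measurableT_comp (f := fine)).
  move=> x _; rewrite /fubini_F /Rintegral.
  by case: (\int[m2]_y _)%E => //=; rewrite ?normr0 ?leey.
by move=> [Ir Ii]; split; [exact: H Ir|exact: H Ii].
Qed.

Lemma cintable_prod (f : T1 * T2 -> R[i]) : cmeas f ->
  (\int[m1]_x \int[m2]_y (nrm (f (x, y)))%:E < +oo)%E ->
  cintable (m1 \x m2)%E f.
Proof.
move=> mf fo; apply: cintableP => //.
rewrite (fubini_tonelli1 (fun z => (nrm (f z))%:E))//.
  by apply/measurable_EFinP; exact: measurable_nrm.
by move=> z; rewrite lee_fin nrm_ge0.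
Qed.

(** The integrability test behind the uses of Fubini's theorem below: there the
    integrand is the product of a function of each variable and a factor of
    modulus at most 1 that mixes the variables. *)
Lemma cintable_prodM (f : T1 * T2 -> R[i]) (u : T1 -> R) (v : T2 -> R) :
  cmeas f -> (forall x y, nrm (f (x, y)) <= u x * v y) ->
  (forall x, 0 <= u x) -> (forall y, 0 <= v y) ->
  m1.-integrable setT (fun x => (u x)%:E) ->
  m2.-integrable setT (fun y => (v y)%:E) ->
  cintable (m1 \x m2)%E f.
Proof.
move=> mf fuv u0 v0 Iu Iv; apply: cintable_prod => //.
have mu := measurable_int _ Iu; have mv := measurable_int _ Iv.
have vfin : (\int[m2]_y (v y)%:E)%E \is a fin_num by exact: integrable_fin_num.
apply: (@le_lt_trans _ _ (\int[m1]_x \int[m2]_y ((u x)%:E * (v y)%:E))%E).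
  apply: ge0_le_integral => //.
  - by move=> x _; apply: integral_ge0 => y _; rewrite lee_fin nrm_ge0.
  - apply: (measurable_partial_integral (h := fun z => (nrm (f z))%:E)).
    by apply/measurable_EFinP; exact: measurable_nrm.
  - apply: (measurable_partial_integral (h := fun z => ((u z.1)%:E * (v z.2)%:E)%E)).
    apply: emeasurable_funM.
      exact: (measurableT_comp mu measurable_fst).
    exact: (measurableT_comp mv measurable_snd).
  - move=> x _; apply: ge0_le_integral => //.
    + by move=> y _; rewrite lee_fin nrm_ge0.
    + apply/measurable_EFinP.
      exact: (measurableT_comp (measurable_nrm mf) (measurable_pair1 x)).
    + exact: emeasurable_funM.
    + by move=> y _; rewrite -EFinM lee_fin.
under eq_integral => x _.
  rewrite ge0_integralZl ?lee_fin//; last by move=> y _; rewrite lee_fin.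
  over.
rewrite ge0_integralZr//; last 2 first.
- by move=> x _; rewrite lee_fin.
- by apply: integral_ge0 => y _; rewrite lee_fin.
rewrite -(fineK vfin) -(@fineK _ (\int[m1]_x (u x)%:E)%E) -?EFinM ?ltry//.
exact: integrable_fin_num.
Qed.

End PartialIntegral.

Section CauchySchwarz.
Context d (T : measurableType d) (R : realType) (mu : {measure set T -> \bar R}).
Implicit Types u v : T -> R.
Local Open Scope ereal_scope.

(** Hoelder's inequality with exponents 2 and 2, squared so that no square root
    of an extended real appears. *)
Lemma cauchy_schwarz u v :
  measurable_fun setT u -> measurable_fun setT v ->
  (forall x, 0 <= u x)%R -> (forall x, 0 <= v x)%R ->
  (\int[mu]_x (u x * v x)%:E) * (\int[mu]_x (u x * v x)%:E) <=
  (\int[mu]_x (u x ^+ 2)%:E) * (\int[mu]_x (v x ^+ 2)%:E).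
Proof.
move=> mu_ mv u0 v0.
have S (x : \bar R) : 0 <= x -> x `^ 2^-1 * x `^ 2^-1 = x.
  move=> x0; rewrite -poweRM// -[x * x]/(x ^+ 2).
  case: x x0 => [x|_|//]; last by rewrite expe2 mulyy poweRyr// invr_neq0.
  rewrite lee_fin => x0; rewrite -EFin_expe poweR_EFin -powR_mulrn// -powRrM.
  by rewrite mulfV// powRr1.
have N2 w : (forall x, 0 <= w x)%R -> Lnorm mu 2%:E (EFin \o w) =
    (\int[mu]_x (w x ^+ 2)%:E) `^ 2^-1.
  move=> w0; rewrite unlock; congr (_ `^ _); apply: eq_integral => x _ /=.
  by rewrite ger0_norm// powR_mulrn.
have two0 : (0 < 2 :> R)%R by [].
have H := @hoelder _ _ _ mu u v 2 2 mu_ mv two0 two0.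
have {H} : \int[mu]_x (u x * v x)%:E <= (\int[mu]_x (u x ^+ 2)%:E) `^ 2^-1 *
    (\int[mu]_x (v x ^+ 2)%:E) `^ 2^-1.
  rewrite -!N2//; apply: le_trans (H _); last by field.
  rewrite Lnorm1; apply: ge0_le_integral => //=.
  - by move=> x _; rewrite lee_fin mulr_ge0.
  - by apply/measurable_EFinP; exact: measurable_funM.
  - by do 2 apply: measurableT_comp => //; exact: measurable_funM.
  - by move=> x _; rewrite lee_fin ler_norm.
move=> H; have I0 : 0 <= \int[mu]_x (u x * v x)%:E.
  by apply: integral_ge0 => x _; rewrite lee_fin mulr_ge0.
apply: le_trans (lee_pmul I0 I0 H H) _.
rewrite muleACA !S//; by apply: integral_ge0 => x _; rewrite lee_fin sqr_ge0.
Qed.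

End CauchySchwarz.

Section AffineChange.
Context (R : realType).
Notation leb := (@lebesgue_measure R).

(** The image of Lebesgue measure under an affine map, multiplied by the slope,
    has the lengths of intervals as its values, hence is Lebesgue measure. *)
Lemma ge0_integral_scale_pos (c e : R) (f : R -> \bar R) : 0 < c ->
  measurable_fun setT f -> (forall x, 0 <= f x)%E ->
  (c%:E * \int[leb]_x f (c * x + e)%R = \int[leb]_x f x)%E.
Proof.
move=> c0 mf f0.
pose h : measurableTypeR R -> measurableTypeR R := fun x => c * x + e.
have mh : measurable_fun setT h.
  by apply: measurable_funD => //; exact: mulrl_measurable.
pose p : {measure set (measurableTypeR R) -> \bar R} :=
  measure_function_pushforward__canonical__measure_function_Measure leb mh.
pose m : {measure set (measurableTypeR R) -> \bar R} := mscale (NngNum (ltW c0)) p.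
have E A : measurable A -> leb A = m A.
  move=> mA; apply: lebesgue_measure_unique => //= _ [[a b]] _ <-.
  rewrite /m /= /mscale /= /pushforward.
  rewrite (_ : h @^-1` _ = `](a - e) / c, (b - e) / c]%classic).
    rewrite !lebesgue_measure_itv/= !lte_fin.
    rewrite ltr_pM2r ?invr_gt0// ltrD2r.
    case: ifPn => ab; last by rewrite mule0.
    rewrite -!EFinD -EFinM; congr EFin; field.
    by rewrite gt_eqF.
  apply/seteqP; split => x /=; rewrite !in_itv/= /h.
    by rewrite ltr_pdivrMr// ler_pdivlMr// ltrBlDr lerBrDr [x * c]mulrC.
  by rewrite ltr_pdivrMr// ler_pdivlMr// ltrBlDr lerBrDr [x * c]mulrC.
have -> : (\int[leb]_x f x = \int[m]_x f x)%E.
  by apply: eq_measure_integral => A mA _; exact: E.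
rewrite /m ge0_integral_mscale//.
by rewrite /p ge0_integral_pushforward.
Qed.

Lemma ge0_integral_opp (f : R -> \bar R) :
  measurable_fun setT f -> (forall x, 0 <= f x)%E ->
  (\int[leb]_x f (- x)%R = \int[leb]_x f x)%E.
Proof.
move=> mf f0.
have -> : (\int[leb]_x f x =
    \int[pushforward leb (-%R : _ -> measurableTypeR R)]_x f x)%E.
  by apply: eq_measure_integral => A mA _; exact/esym/lebesgue_measureN.
by rewrite ge0_integral_pushforward//; exact: oppr_measurable.
Qed.

Lemma ge0_integral_shift (e : R) (f : R -> \bar R) :
  measurable_fun setT f -> (forall x, 0 <= f x)%E ->
  (\int[leb]_x f (x + e)%R = \int[leb]_x f x)%E.
Proof.
move=> mf f0; rewrite -[RHS](ge0_integral_scale_pos e ltr01 mf f0) mul1e.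
by apply: eq_integral => x _; rewrite mul1r.
Qed.

Lemma ge0_integral_reflect (e : R) (f : R -> \bar R) :
  measurable_fun setT f -> (forall x, 0 <= f x)%E ->
  (\int[leb]_x f (e - x)%R = \int[leb]_x f x)%E.
Proof.
move=> mf f0; rewrite -(ge0_integral_shift e mf f0).
rewrite -(ge0_integral_opp (f := fun x => f (x + e)))//; last first.
  by apply: measurableT_comp => //; exact: measurable_funD.
by apply: eq_integral => x _; rewrite addrC.
Qed.

End AffineChange.

Section Plane.
Context (R : realType).
Notation mR := (measurableTypeR R).
Notation mplane := (mR * mR)%type.
Notation leb := (@lebesgue_measure R).

(** The product measure under a name of its own, to carry the sigma-finite
    structure that Fubini's theorem on pairs of points of the plane needs. *)
Definition plane_mu : set mplane -> \bar R := (leb \x leb)%E.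

HB.instance Definition _ := Measure.copy plane_mu (leb \x leb)%E.

Let plane_sigma_finite : sigma_finite [set: mplane] plane_mu.
Proof.
have /sigma_finiteP[F [TF ndF Foo]] := sigma_finiteT leb.
exists (fun n => F n `*` F n).
 rewrite -setXTT TF predeqE => -[x y]; split.
    move=> [/= [n _ Fnx] [k _ Gky]]; exists (maxn n k) => //; split.
    - by move: x Fnx; exact/subsetPset/ndF/leq_maxl.
    - by move: y Gky; exact/subsetPset/ndF/leq_maxr.
  by move=> [n _ []/= ? ?]; split; exists n.
move=> k; have [? ?] := Foo k.
split; first exact: measurableX.
by rewrite /plane_mu product_measure1E// lte_mul_pinfty// ge0_fin_numE.
Qed.

HB.instance Definition _ := Measure_isSigmaFinite.Build _ _ _ plane_mu
  plane_sigma_finite.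

Notation mu2 := plane_mu.

Lemma cintE (f : R * R -> R[i]) : cint f = cintg mu2 f.
Proof. by []. Qed.

Lemma cintegrableE (f : R * R -> R[i]) : cintegrable f = cintable mu2 f.
Proof. by []. Qed.

Lemma ge0_integral_plane (f : mplane -> \bar R) :
  measurable_fun setT f -> (forall x, 0 <= f x)%E ->
  (\int[mu2]_z f z = \int[leb]_x \int[leb]_y f (x, y))%E.
Proof. by move=> mf f0; exact: (fubini_tonelli1 f). Qed.

(** A change of variables that acts on each coordinate separately reduces to the
    line by Tonelli's theorem. *)
Lemma ge0_integral_plane_change (k l : R) (h1 h2 : mR -> mR) (f : mplane -> \bar R) :
  0 <= k -> 0 <= l ->
  measurable_fun setT h1 -> measurable_fun setT h2 ->
  (forall u : mR -> \bar R, measurable_fun setT u -> (forall x, 0 <= u x)%E ->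
    (k%:E * \int[leb]_x u (h1 x) = \int[leb]_x u x)%E) ->
  (forall u : mR -> \bar R, measurable_fun setT u -> (forall x, 0 <= u x)%E ->
    (l%:E * \int[leb]_x u (h2 x) = \int[leb]_x u x)%E) ->
  measurable_fun setT f -> (forall x, 0 <= f x)%E ->
  ((k * l)%:E * \int[mu2]_z f (h1 z.1, h2 z.2) = \int[mu2]_z f z)%E.
Proof.
move=> k0 l0 mh1 mh2 H1 H2 mf f0.
have mh : measurable_fun setT (fun z : mplane => f (h1 z.1, h2 z.2)).
  apply: (measurableT_comp mf); apply: measurable_fun_pair.
    exact: (measurableT_comp mh1 measurable_fst).
  exact: (measurableT_comp mh2 measurable_snd).
have mfx x : measurable_fun setT (fun y => f (x, y)).
  exact: (measurableT_comp mf (measurable_pair1 x)).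
rewrite (ge0_integral_plane mf f0) (ge0_integral_plane mh); last by [].
have mF : measurable_fun setT (fun x => \int[leb]_y f (x, y))%E.
  exact: measurable_partial_integral.
have F0 x : (0 <= \int[leb]_y f (x, y))%E by exact: integral_ge0.
have mG : measurable_fun setT (fun x => \int[leb]_y f (h1 x, h2 y))%E.
  have := @measurable_partial_integral _ _ _ _ R leb (fun z : mplane => f (h1 z.1, h2 z.2)) mh.
  by [].
have G0 x : (0 <= \int[leb]_y f (h1 x, h2 y))%E by exact: integral_ge0.
rewrite -(H1 _ mF F0) EFinM -muleA; congr (_ * _)%E.
rewrite -(ge0_integralZl _ _ mG)//.
by apply: eq_integral => x _; rewrite (H2 (fun y => f (h1 x, y))).
Qed.

Lemma ge0_integral_plane_shift (e : R * R) (f : mplane -> \bar R) :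
  measurable_fun setT f -> (forall x, 0 <= f x)%E ->
  (\int[mu2]_z f (z.1 + e.1, z.2 + e.2)%R = \int[mu2]_z f z)%E.
Proof.
move=> mf f0.
rewrite -(@ge0_integral_plane_change 1 1 (fun x => x + e.1) (fun x => x + e.2) f)//.
- by rewrite mulr1 mul1e.
- exact: measurable_funD.
- exact: measurable_funD.
- by move=> u mu u0; rewrite mul1e; exact: ge0_integral_shift.
- by move=> u mu u0; rewrite mul1e; exact: ge0_integral_shift.
Qed.

Lemma ge0_integral_plane_reflect (e : R * R) (f : mplane -> \bar R) :
  measurable_fun setT f -> (forall x, 0 <= f x)%E ->
  (\int[mu2]_z f (e.1 - z.1, e.2 - z.2)%R = \int[mu2]_z f z)%E.
Proof.
move=> mf f0.
rewrite -(@ge0_integral_plane_change 1 1 (fun x => e.1 - x) (fun x => e.2 - x) f)//.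
- by rewrite mulr1 mul1e.
- exact: measurable_funB.
- exact: measurable_funB.
- by move=> u mu u0; rewrite mul1e; exact: ge0_integral_reflect.
- by move=> u mu u0; rewrite mul1e; exact: ge0_integral_reflect.
Qed.

Lemma ge0_integral_plane_rescale (e : R * R) (c : R) (f : mplane -> \bar R) :
  0 < c -> measurable_fun setT f -> (forall x, 0 <= f x)%E ->
  ((c * c)%:E * \int[mu2]_z f (e.1 - c * z.1, e.2 - c * z.2)%R = \int[mu2]_z f z)%E.
Proof.
move=> c0 mf f0.
have H r (u : mR -> \bar R) : measurable_fun setT u -> (forall x, 0 <= u x)%E ->
    (c%:E * \int[leb]_x u (r - c * x)%R = \int[leb]_x u x)%E.
  move=> mu u0; rewrite -(ge0_integral_reflect r mu u0).
  rewrite -(@ge0_integral_scale_pos R c 0 (fun x => u (r - x)))//.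
    by congr (_ * _)%E; apply: eq_integral => x _; rewrite addr0.
  by apply: (measurableT_comp mu); exact: measurable_funB.
rewrite -(@ge0_integral_plane_change c c (fun x => e.1 - c * x) (fun x => e.2 - c * x) f)//.
- exact: ltW.
- exact: ltW.
- by apply: measurable_funB => //; exact: measurable_funM.
- by apply: measurable_funB => //; exact: measurable_funM.
- exact: H.
- exact: H.
Qed.

Lemma ge0_integral_planeM (u v : R -> R) :
  measurable_fun setT u -> measurable_fun setT v ->
  (forall x, 0 <= u x) -> (forall x, 0 <= v x) ->
  (\int[mu2]_z (u z.1 * v z.2)%:E =
   (\int[leb]_x (u x)%:E) * (\int[leb]_y (v y)%:E))%E.
Proof.
move=> mu_ mv u0 v0; rewrite ge0_integral_plane; last 2 first.
- apply/measurable_EFinP; apply: measurable_funM.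
    exact: (measurableT_comp mu_ measurable_fst).
  exact: (measurableT_comp mv measurable_snd).
- by move=> z; rewrite lee_fin mulr_ge0.
transitivity (\int[leb]_x ((u x)%:E * \int[leb]_y (v y)%:E))%E.
  apply: eq_integral => x _ /=; rewrite -ge0_integralZl ?lee_fin//.
  - exact/measurable_EFinP.
  - by move=> y _; rewrite lee_fin.
rewrite ge0_integralZr//.
- exact/measurable_EFinP.
- by move=> x _; rewrite lee_fin.
- by apply: integral_ge0 => y _; rewrite lee_fin.
Qed.

Lemma ae_off_cross (c : R * R) : {ae mu2, forall z : mplane, z.1 != c.1 /\ z.2 != c.2}.
Proof.
have h1 : {ae mu2, forall z : mplane, z.1 <> c.1}.
  exists ([set c.1] `*` setT); split.
  - exact: measurableX.
  - by rewrite [LHS]product_measure1E//= lebesgue_measure_set1 mul0e.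
  - by move=> z /= /contrapT ->.
have h2 : {ae mu2, forall z : mplane, z.2 <> c.2}.
  exists (setT `*` [set c.2]); split.
  - exact: measurableX.
  - by rewrite [LHS]product_measure1E//= lebesgue_measure_set1 mule0.
  - by move=> z /= /contrapT ->.
by apply: filterS2 h1 h2 => z /eqP ? /eqP ?.
Qed.

Lemma ae_plane_neq (c : R * R) : {ae mu2, forall z : mplane, z <> c}.
Proof. by apply: filterS (ae_off_cross c) => z [/eqP h _] zc; apply: h; rewrite zc. Qed.

(** An open set is the union of the rational squares that it contains, and there
    are countably many of them. *)
Lemma open_measurable_plane (A : set (R * R)) : open A ->
  measurable (A : set mplane).
Proof.
move=> oA.
pose box (q : rat * rat * rat) : set mplane :=
  `]ratr q.1.1 - ratr q.2, ratr q.1.1 + ratr q.2[%classic `*`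
  `]ratr q.1.2 - ratr q.2, ratr q.1.2 + ratr q.2[%classic.
have -> : A = \bigcup_(q in [set q | box q `<=` A]) box q.
  apply/seteqP; split => [x Ax|x [q qA]]; last exact: qA.
  have /nbhs_ballP[e /= e0 eA] : nbhs x A by exact: open_nbhs_nbhs.
  (* a rational square of half-side between e / 4 and e / 2 whose centre is within
     e / 4 of x contains x and stays within the ball of radius e *)
  have e4 : 0 < e / 4 by lra.
  have [r] : exists r : rat, ratr r \in `]e / 4, e / 2[ by apply: rat_in_itvoo; lra.
  have [p] : exists r : rat, ratr r \in `]x.1 - e / 4, x.1 + e / 4[.
    by apply: rat_in_itvoo; lra.
  have [q] : exists r : rat, ratr r \in `]x.2 - e / 4, x.2 + e / 4[.
    by apply: rat_in_itvoo; lra.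
  rewrite !in_itv/= => /andP[q1 q2] /andP[p1 p2] /andP[r1 r2].
  exists (p, q, r) => /=; last first.
    by split => /=; rewrite in_itv/=; apply/andP; split; lra.
  move=> y [/=]; rewrite !in_itv/= => /andP[y1 y2] /andP[y3 y4].
  apply: eA; split => /=; rewrite /ball/= ltr_norml; apply/andP; split; lra.
rewrite bigcup_mkcond; apply: countable_bigcupT_measurable => // q.
by case: ifP => // _; apply: measurableX; exact: measurable_itv.
Qed.

Lemma continuous_measurable_plane (f : R * R -> R) : continuous f ->
  measurable_fun setT (f : mplane -> R).
Proof.
move=> cf; apply: (measurability _ (@RGenOInfty.measurableE R)) => //.
move=> _ [_ [a ->] <-]; rewrite setTI; apply: open_measurable_plane.
by apply: open_comp => //; exact: interval_open.
Qed.

End Plane.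

(** * The Fourier transform of a Gaussian on the line *)

Section GaussLine.
Context (R : realType).
Notation leb := (@lebesgue_measure R).

Definition gau1 (a x : R) : R := expR (- (a * x ^+ 2)).

Lemma gau1_ge0 a x : 0 <= gau1 a x. Proof. exact: expR_ge0. Qed.

Lemma continuous_gau1 a : continuous (gau1 a).
Proof.
move=> x; apply: continuous_comp; last exact: continuous_expR.
apply: continuousN; apply: continuousM; first exact: cst_continuous.
exact: exprn_continuous.
Qed.

Lemma measurable_gau1 a : measurable_fun setT (gau1 a).
Proof. by apply: continuous_measurable_fun; exact: continuous_gau1. Qed.

Lemma integral_gau1 a : 0 < a ->
  (\int[leb]_x (gau1 a x)%:E = (Num.sqrt (pi / a))%:E)%E.
Proof.
move=> a0; have s0 : 0 < Num.sqrt a by rewrite sqrtr_gt0.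
have := @ge0_integral_scale_pos R (Num.sqrt a) 0 (fun x => (gauss_fun x)%:E) s0.
rewrite integralT_gauss => /(_ _ _) H.
have {H} : ((Num.sqrt a)%:E * \int[leb]_x (gau1 a x)%:E = (Num.sqrt pi)%:E)%E.
  rewrite -H; last 2 first.
  - by apply/measurable_EFinP; exact: measurable_gauss_fun.
  - by move=> x; rewrite lee_fin gauss_fun_ge0.
  congr (_ * _)%E; apply: eq_integral => x _.
  by rewrite /gauss_fun addr0 exprMn sqr_sqrtr ?(ltW a0).
have : (0 <= \int[leb]_x (gau1 a x)%:E)%E.
  by apply: integral_ge0 => x _; rewrite lee_fin gau1_ge0.
case: (\int[leb]_x (gau1 a x)%:E)%E => [r|_|//].
  move=> _; rewrite -EFinM => -[E]; congr EFin.
  rewrite sqrtrM ?pi_ge0// sqrtrV ?(ltW a0)// -E; field.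
  by rewrite gt_eqF.
by rewrite gt0_muley// lte_fin.
Qed.

Lemma integrable_gau1 a : 0 < a ->
  leb.-integrable setT (fun x => (gau1 a x)%:E).
Proof.
move=> a0; apply/integrableP; split.
  by apply/measurable_EFinP; exact: measurable_gau1.
under eq_integral do rewrite gee0_abs ?lee_fin ?gau1_ge0//.
by rewrite integral_gau1// ltry.
Qed.

(** The integral over [-n, n] is F n - F (- n). *)
Lemma Rintegral_derivative0 (F f : R -> R) :
  (forall x, is_derive (x : R) (1 : R) F (f x)) -> continuous f ->
  leb.-integrable setT (fun x => (f x)%:E) ->
  (fun n : nat => F n%:R) @ \oo --> (0 : R) ->
  (fun n : nat => F (- n%:R)) @ \oo --> (0 : R) ->
  Rintegral leb setT f = 0.
Proof.
move=> dF cf If F1 F2.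
have C1 : (fun n : nat => Rintegral leb setT (f \_ `[- n.+1%:R, n.+1%:R])) @ \oo
    --> Rintegral leb setT f.
  have [] := @dominated_convergence _ _ _ leb _ measurableT
    (fun n x => ((f \_ `[- n.+1%:R, n.+1%:R]) x)%:E) (fun x => (f x)%:E)
    (fun x => `|f x|%:E).
  - move=> n; apply/measurable_EFinP/measurable_restrict => //.
    by apply: measurable_funTS; exact: continuous_measurable_fun.
  - by apply/measurable_EFinP; exact: continuous_measurable_fun.
  - apply: aeW => x _ /=; apply: cvg_near_cst.
    near=> n; rewrite patchE ifT// inE/= in_itv/= -ler_norml.
    have : `|x| <= n%:R by near: n; exact: nbhs_infty_ger.
    by move=> /le_trans; apply; rewrite ler_nat.
  - exact: integrable_norm.
  - apply: aeW => x n _ /=; rewrite patchE; case: ifPn => // _.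
    by rewrite normr0 lee_fin.
  move=> I1 _ H; apply: fine_cvg; rewrite fineK//; exact: integrable_fin_num.
have C2 : (fun n : nat => F n.+1%:R - F (- n.+1%:R)) @ \oo --> (0 : R).
  rewrite -[X in _ --> X](subr0 0); apply: cvgB.
    by rewrite (cvg_shiftS (fun n : nat => F n%:R)).
  by rewrite (cvg_shiftS (fun n : nat => F (- n%:R))).
apply: (cvg_unique _ C1); first exact: norm_hausdorff.
apply: cvg_trans C2; apply: near_eq_cvg; apply: nearW => n.
rewrite -Rintegral_mkcond /Rintegral.
rewrite (@continuous_FTC2 _ f F).
- by rewrite -EFinB.
- by rewrite gtrN// ltr0n.
- exact: continuous_subspaceT.
- split.
  + by move=> x _; exact: (@ex_derive _ _ _ _ _ _ _ (dF x)).
  + apply: cvg_at_right_filter; apply: differentiable_continuous.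
    apply/derivable1_diffP; exact: (@ex_derive _ _ _ _ _ _ _ (dF _)).
  + apply: cvg_at_left_filter; apply: differentiable_continuous.
    apply/derivable1_diffP; exact: (@ex_derive _ _ _ _ _ _ _ (dF _)).
- by move=> x _; rewrite derive1E; exact: (@derive_val _ _ _ _ _ _ _ (dF _)).
Unshelve. all: by end_near. Qed.

(** The cosine transform of the standard Gaussian, computed below from the
    differential equation that it satisfies. *)
Let J (z : R) := Rintegral leb setT (fun x => gau1 1 x * cos (x * z)).

Let absle (x : R) : `|x| * gau1 1 x <= gau1 (1 / 2) x.
Proof.
rewrite /gau1 mul1r -ler_pdivlMr ?expR_gt0// -expRN -expRD opprK.
rewrite (_ : _ + _ = 1 / 2 * x ^+ 2); last by field.
apply: le_trans (expR_ge1Dx _); rewrite -normr_sqr; have := normr_ge0 x.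
by set t := `|x|; have := sqr_ge0 (t - 1); nra.
Qed.

Let integrable_gM (h : R -> R) : measurable_fun setT h ->
  (forall x, `|h x| <= 1) ->
  leb.-integrable setT (fun x => (gau1 1 x * h x)%:E).
Proof.
move=> mh h1; apply: (le_integrable measurableT _ _ (integrable_gau1 ltr01)).
  by apply/measurable_EFinP; apply: measurable_funM => //; exact: measurable_gau1.
move=> x _ /=; rewrite lee_fin normrM ger0_norm ?gau1_ge0//.
by rewrite -[leRHS]mulr1 ler_wpM2l// gau1_ge0.
Qed.

Let integrable_xgM (h : R -> R) : measurable_fun setT h ->
  (forall x, `|h x| <= 1) ->
  leb.-integrable setT (fun x => (x * gau1 1 x * h x)%:E).
Proof.
move=> mh h1; have h0 : 0 < 1 / 2 :> R by lra.
apply: (le_integrable measurableT _ _ (integrable_gau1 h0)).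
  apply/measurable_EFinP; apply: measurable_funM => //.
  by apply: measurable_funM => //; exact: measurable_gau1.
move=> x _ /=; rewrite lee_fin !normrM [X in _ * X * _]ger0_norm ?gau1_ge0//.
rewrite [leRHS]ger0_norm ?gau1_ge0//.
rewrite -[leRHS]mulr1; apply: ler_pM => //.
by rewrite mulr_ge0// gau1_ge0.
Qed.

Let cos1 (t : R) : `|cos t| <= 1. Proof. by rewrite ler_norml cos_geN1 cos_le1. Qed.
Let sin1 (t : R) : `|sin t| <= 1. Proof. by rewrite ler_norml sin_geN1 sin_le1. Qed.

Let mcos z : measurable_fun setT (fun x : R => cos (x * z)).
Proof.
apply: continuous_measurable_fun => x; apply: continuous_comp; last exact: continuous_cos.
by apply: continuousM => //; exact: cst_continuous.
Qed.
Let msin z : measurable_fun setT (fun x : R => sin (x * z)).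
Proof.
apply: continuous_measurable_fun => x; apply: continuous_comp; last exact: continuous_sin.
by apply: continuousM => //; exact: cst_continuous.
Qed.

Let dgau x : is_derive (x : R) (1 : R) (gau1 1) (- 2 * x * gau1 1 x).
Proof.
rewrite /gau1; apply: is_derive_eq.
by rewrite /= /GRing.scale /=; ring.
Qed.

Let dcos (x z : R) : is_derive (z : R) (1 : R) (fun w => cos (x * w)) (- x * sin (x * z)).
Proof.
have H : is_derive (z : R) (1 : R) (fun w : R => x * w) x.
  by apply: is_derive_eq; rewrite /GRing.scale /=; ring.
apply: (@is_derive_eq _ _ _ _ _ _ _ _ (@is_derive1_comp _ cos (fun w => x * w) _ _ _ (is_derive_cos _) H)).
by ring.
Qed.

Let dsin (x z : R) : is_derive (x : R) (1 : R) (fun w => sin (w * z)) (z * cos (x * z)).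
Proof.
have H : is_derive (x : R) (1 : R) (fun w : R => w * z) z.
  by apply: is_derive_eq; rewrite /GRing.scale /=; ring.
apply: (@is_derive_eq _ _ _ _ _ _ _ _ (@is_derive1_comp _ sin (fun w => w * z) _ _ _ (is_derive_sin _) H)).
by ring.
Qed.

Let dgs (x z : R) : is_derive (x : R) (1 : R) (fun x => gau1 1 x * sin (x * z))
  (z * (gau1 1 x * cos (x * z)) - 2 * (x * gau1 1 x * sin (x * z))).
Proof.
have H := @is_deriveM _ _ _ _ _ _ _ _ (dgau x) (dsin x z).
apply: (@is_derive_eq _ _ _ _ _ _ _ _ H).
by rewrite /GRing.scale /=; ring.
Qed.

(** Differentiation under the integral sign produces the integral of
    - x exp (- x^2) sin (x z); integrating the derivative of
    exp (- x^2) sin (x z) expresses it through J. *)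
Let dJ z : is_derive (z : R) (1 : R) J (- (z / 2) * J z).
Proof.
pose f (w x : R) := gau1 1 x * cos (x * w).
have df w x : is_derive (w : R) (1 : R) (f^~ x) (gau1 1 x *: (- x * sin (x * w)) ).
  by have := @is_deriveZ _ _ _ (fun w => cos (x * w)) (gau1 1 x) w 1 _ (dcos x w).
have d1f w x : partial1of2 f w x = - (x * gau1 1 x * sin (x * w)).
  rewrite partial1of2E (@derive_val _ _ _ _ _ _ _ (df w x)).
  by rewrite /GRing.scale /=; ring.
have Iz : `]z - 1, z + 1[%classic z by rewrite /= in_itv/=; apply/andP; split; lra.
have If w : leb.-integrable setT (EFin \o f w).
  by apply: integrable_gM => // x; exact: cos1.
have dif w x : derivable (f^~ x) w 1.
  exact: (@ex_derive _ _ _ _ _ _ _ (df w x)).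
have Ig : leb.-integrable setT (EFin \o (gau1 (1 / 2))).
  by apply: integrable_gau1; lra.
have b w x : `|partial1of2 f w x| <= gau1 (1 / 2) x.
  rewrite d1f normrN normrM -[leRHS]mulr1; apply: ler_pM => //.
  by rewrite normrM [X in _ * X]ger0_norm ?gau1_ge0// absle.
have D1 := @derivable_under_integral _ _ _ leb f setT measurableT z (z - 1) (z + 1)
  Iz (fun w _ => If w) (fun w x _ _ => dif w x) (gau1 (1 / 2)) (@gau1_ge0 _) Ig
  (fun w x _ _ => b w x).
have D2 := @differentiation_under_integral _ _ _ leb f setT measurableT z (z - 1) (z + 1)
  Iz (fun w _ => If w) (fun w x _ _ => dif w x) (gau1 (1 / 2)) (@gau1_ge0 _) Ig
  (fun w x _ _ => b w x).
have -> : - (z / 2) * J z = 'D_1 J z.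
  rewrite -derive1E [RHS]D2.
  under eq_Rintegral do rewrite d1f -mulN1r.
  rewrite RintegralZl//; last exact: integrable_xgM.
  rewrite mulN1r.
  have A1 (x : R) : is_derive (x : R) (1 : R) (fun x => gau1 1 x * sin (x * z))
      (z * (gau1 1 x * cos (x * z)) - 2 * (x * gau1 1 x * sin (x * z))).
    exact: dgs.
  have cc (p : R -> R) : continuous p -> continuous (fun x : R => p (x * z)).
    move=> cp x; apply: continuous_comp; last exact: cp.
    by apply: continuousM => //; exact: cst_continuous.
  have A2 : continuous (fun x : R =>
      z * (gau1 1 x * cos (x * z)) - 2 * (x * gau1 1 x * sin (x * z))).
    move=> x; apply: cvgB; apply: cvgM; try exact: cvg_cst.
      apply: cvgM; first exact: continuous_gau1.
      exact: (cc cos (@continuous_cos R)).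
    apply: cvgM; last exact: (cc sin (@continuous_sin R)).
    by apply: cvgM; [exact: cvg_id|exact: continuous_gau1].
  have I1 : leb.-integrable setT (EFin \o (fun x => z * (gau1 1 x * cos (x * z)))).
    rewrite (_ : _ \o _ = fun x => (z%:E * (gau1 1 x * cos (x * z))%:E)%E)//.
    by apply: integrableZl => //; exact: integrable_gM.
  have I2 : leb.-integrable setT (EFin \o (fun x => 2 * (x * gau1 1 x * sin (x * z)))).
    rewrite (_ : _ \o _ = fun x => (2%:E * (x * gau1 1 x * sin (x * z))%:E)%E)//.
    by apply: integrableZl => //; exact: integrable_xgM.
  have A3 : leb.-integrable setT (fun x : R =>
      (z * (gau1 1 x * cos (x * z)) - 2 * (x * gau1 1 x * sin (x * z)))%:E).
    by under eq_fun do rewrite EFinB; exact: integrableB.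
  have A4 (s : nat -> R) : (forall n, s n ^+ 2 = n%:R ^+ 2) ->
      (fun n : nat => gau1 1 (s n) * sin (s n * z)) @ \oo --> (0 : R).
    move=> sn; apply: norm_cvg0.
    apply: (@squeeze_cvgr _ _ _ _ (fun=> 0) harmonic); last exact: cvg_harmonic;
      last exact: cvg_cst.
    apply: nearW => n; rewrite normr_ge0/= normrM ger0_norm ?gau1_ge0//.
    rewrite -[leRHS]mulr1; apply: ler_pM => //; first exact: gau1_ge0.
    rewrite /gau1 mul1r sn expRN lef_pV2 ?posrE ?expR_gt0//.
    apply: le_trans (expR_ge1Dx _); rewrite -natrX -natr1 addrC lerD2l ler_nat.
    by rewrite expnS expn1; case: (n) => // m; rewrite leq_pmulr.
  have E0 := Rintegral_derivative0 A1 A2 A3 (A4 (fun n => n%:R) (fun=> erefl))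
    (A4 (fun n => - n%:R) (fun n => sqrrN _)).
  rewrite RintegralB// !RintegralZl// in E0;
    [|exact: integrable_xgM|exact: integrable_gM].
  move/eqP: E0; rewrite -/(J z).
  rewrite subr_eq0 => /eqP; lra.
exact: derivableP.
Qed.

(** J z exp (z^2 / 4) has zero derivative. *)
Let JE z : J z = Num.sqrt pi * expR (- (z ^+ 2 / 4)).
Proof.
pose K w := J w * expR (w ^+ 2 / 4).
have dK w : is_derive (w : R) (1 : R) K 0.
  apply: is_derive_eq.
    have H : is_derive (w : R) (1 : R) (fun w : R => expR (w ^+ 2 / 4)) (w / 2 * expR (w ^+ 2 / 4)).
      by apply: is_derive_eq; rewrite /= /GRing.scale /= /cst /=; field.
    exact: (@is_deriveM _ _ _ _ _ _ _ _ (dJ w) H).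
  by rewrite /GRing.scale /=; ring.
have := @is_derive_0_is_cst _ K z 0 dK.
rewrite /K expr0n mul0r expR0 mulr1.
have -> : J 0 = Num.sqrt pi.
  rewrite /J /Rintegral; under eq_integral do rewrite mulr0 cos0 mulr1.
  by rewrite integral_gau1// divr1.
by move=> <-; rewrite -mulrA -expRD subrr expR0 mulr1.
Qed.

Lemma cintable_gau1_expi a c : 0 < a ->
  cintable leb (fun x : R => real_complex R (gau1 a x) * expi (x * c)).
Proof.
move=> a0; apply: (cintable_le _ _ (integrable_gau1 a0)).
  apply: cmeasM; first by apply: cmeas_real; exact: measurable_gau1.
  by apply: cmeas_expi; apply: measurable_funM => //; exact: measurable_cst.
by move=> x; rewrite nrmM nrm_real nrm_expi mulr1 ger0_norm// gau1_ge0.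
Qed.

Lemma cintg_opp (f : R -> R[i]) : cmeas f ->
  cintg leb (fun x : R => f (- x)) = cintg leb f.
Proof.
have H (u : R -> R) : measurable_fun setT u ->
    Rintegral leb setT (fun x => u (- x)) = Rintegral leb setT u.
  move=> mu; rewrite /Rintegral; congr fine.
  rewrite [LHS]integralE [RHS]integralE.
  rewrite -(ge0_integral_opp (f := ((fun x => (u x)%:E)^\+)%E))//; last first.
    by apply: measurable_funepos; exact/measurable_EFinP.
  rewrite -(ge0_integral_opp (f := ((fun x => (u x)%:E)^\-)%E))//; last first.
    by apply: measurable_funeneg; exact/measurable_EFinP.
  congr (_ - _)%E; apply: eq_integral => x _.
    exact: (congr1 (fun h => h x) (funepos_comp (fun x => (u x)%:E) -%R)).
  exact: (congr1 (fun h => h x) (funeneg_comp (fun x => (u x)%:E) -%R)).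
by move=> [fr fi]; apply: complex_ext => /=; [exact: (H _ fr)|exact: (H _ fi)].
Qed.

Lemma Rintegral_scale a (u : R -> R) : 0 < a -> measurable_fun setT u ->
  leb.-integrable setT (fun x => (u x)%:E) ->
  a * Rintegral leb setT (fun x => u (a * x)) = Rintegral leb setT u.
Proof.
move=> a0 mu Iu.
pose p := (EFin \o u)^\+%E; pose q := (EFin \o u)^\-%E.
have mp : measurable_fun setT p by apply: measurable_funepos; exact/measurable_EFinP.
have mq : measurable_fun setT q by apply: measurable_funeneg; exact/measurable_EFinP.
have p0 x : (0 <= p x)%E by exact: funepos_ge0.
have q0 x : (0 <= q x)%E by exact: funeneg_ge0.
have Ep : (a%:E * \int[leb]_x p (a * x)%R = \int[leb]_x p x)%E.
  rewrite -(ge0_integral_scale_pos 0 a0 mp)//; congr (_ * _)%E.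
  by apply: eq_integral => x _; rewrite addr0.
have Eq : (a%:E * \int[leb]_x q (a * x)%R = \int[leb]_x q x)%E.
  rewrite -(ge0_integral_scale_pos 0 a0 mq)//; congr (_ * _)%E.
  by apply: eq_integral => x _; rewrite addr0.
have fp : (\int[leb]_x p x \is a fin_num)%E.
  by apply: integrable_fin_num => //; exact: integrable_funepos.
have fq : (\int[leb]_x q x \is a fin_num)%E.
  by apply: integrable_fin_num => //; exact: integrable_funeneg.
have F (r : \bar R) : ((a%:E * r)%E \is a fin_num) -> r \is a fin_num.
  by case: r => [r //||]; rewrite ?gt0_muley ?gt0_muleNy ?lte_fin.
have fpa : (\int[leb]_x p (a * x)%R \is a fin_num)%E by apply: F; rewrite Ep.
have fqa : (\int[leb]_x q (a * x)%R \is a fin_num)%E by apply: F; rewrite Eq.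
rewrite /Rintegral.
rewrite [X in _ * fine X]integralE [X in _ = fine X]integralE -/p -/q.
rewrite (fineB fp fq) -Ep -Eq !fineM// -mulrBr -fineB//.
congr (_ * fine (_ - _)); apply: eq_integral => x _.
  exact: (congr1 (fun h => h x) (funepos_comp (EFin \o u) ( *%R a))).
exact: (congr1 (fun h => h x) (funeneg_comp (EFin \o u) ( *%R a))).
Qed.

(** The imaginary part is the integral of an odd function; the real part is J
    after a change of scale. *)
Lemma gauss_fourier1 a c : 0 < a ->
  cintg leb (fun x : R => real_complex R (gau1 a x) * expi (x * c)) =
  real_complex R (Num.sqrt (pi / a) * expR (- (c ^+ 2 / (4 * a)))).
Proof.
move=> a0; have s0 : 0 < Num.sqrt a by rewrite sqrtr_gt0.
have I := cintable_gau1_expi c a0; set f := (fun x : R => _) in I *.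
apply: complex_ext => /=.
  rewrite (_ : (fun x => complex.Re (f x)) =
      fun x => gau1 1 (Num.sqrt a * x) * cos (Num.sqrt a * x * (c / Num.sqrt a))).
    apply: (mulfI (lt0r_neq0 s0)).
    rewrite (Rintegral_scale (u := fun x => gau1 1 x * cos (x * (c / Num.sqrt a)))) //.
    - rewrite -/(J _) JE sqrtrM ?pi_ge0// sqrtrV ?(ltW a0)// expr_div_n.
      rewrite sqr_sqrtr ?(ltW a0)//.
      rewrite (_ : c ^+ 2 / a / 4 = c ^+ 2 / (4 * a)); first by field; rewrite gt_eqF.
      by field; rewrite gt_eqF.
    - by apply: measurable_funM => //; exact: measurable_gau1.
    - exact: integrable_gM.
  apply/funext => x; rewrite /f cReM /= mul0r subr0; congr (_ * cos _).
    by rewrite /gau1 exprMn sqr_sqrtr ?(ltW a0)// mul1r.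
  by field; rewrite gt_eqF.
have /(congr1 (@complex.Im R)) /= := cintg_opp (cintable_meas I).
rewrite (_ : (fun x : R => complex.Im (f (- x))) = (fun x => -1 * complex.Im (f x))).
  rewrite RintegralZl//; last by have [_] := I.
  lra.
apply/funext => x; rewrite /f !cImM /= mulN1r !mul0r !addr0 mulNr sinN mulrN.
by rewrite /gau1 sqrrN.
Qed.

End GaussLine.

(** * Gaussians in the plane and Schwartz functions *)

Section GaussPlane.
Context (R : realType).
Notation mR := (measurableTypeR R).
Notation mplane := (mR * mR)%type.
Notation leb := (@lebesgue_measure R).
Notation mu2 := (@plane_mu R).

Definition gau2 (a : R) (b x : R * R) : R :=
  expR (- (a * ((x.1 - b.1) ^+ 2 + (x.2 - b.2) ^+ 2))).

Lemma gau2_ge0 a b x : 0 <= gau2 a b x. Proof. exact: expR_ge0. Qed.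

Lemma gau2_gt0 a b x : 0 < gau2 a b x. Proof. exact: expR_gt0. Qed.

Lemma gau2_le1 a b x : 0 <= a -> gau2 a b x <= 1.
Proof.
move=> a0; rewrite /gau2 -[leRHS]expR0 ler_expR oppr_le0 mulr_ge0//.
by rewrite addr_ge0// sqr_ge0.
Qed.

Lemma gau2E a x : gau2 a 0 x = gau1 a x.1 * gau1 a x.2.
Proof. by rewrite /gau2 /gau1 -expRD /= !subr0; congr expR; ring. Qed.

Lemma gau2_shift a b x : gau2 a b (x.1 + b.1, x.2 + b.2) = gau2 a 0 x.
Proof. by rewrite /gau2 /= !addrK !subr0. Qed.

Lemma gau2_sym a b x : gau2 a b x = gau2 a x b.
Proof. by rewrite /gau2; congr expR; ring. Qed.

Lemma measurable_dotp (c : R * R) : measurable_fun setT (fun x : mplane => dotp x c).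
Proof.
by apply: measurable_funD; apply: measurable_funM.
Qed.

Lemma measurable_gau2 a b : measurable_fun setT (gau2 a b : mplane -> R).
Proof.
apply: (measurableT_comp (f := expR)) => //; apply: measurable_funN.
by apply: measurable_funM => //; apply: measurable_funD; apply: measurable_funX;
  apply: measurable_funB.
Qed.

Lemma measurable_gau22 a : measurable_fun setT (fun z : mplane * mplane => gau2 a z.1 z.2).
Proof.
apply: (measurableT_comp (f := expR)) => //; apply: measurable_funN.
by apply: measurable_funM => //; apply: measurable_funD; apply: measurable_funX;
  apply: measurable_funB; exact: measurableT_comp.
Qed.

Lemma integral_gau2 a b : 0 < a ->
  (\int[mu2]_z (gau2 a b z)%:E = (pi / a)%:E)%E.
Proof.
move=> a0.
have mg : measurable_fun setT (fun z : mplane => (gau2 a b z)%:E).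
  by apply/measurable_EFinP; exact: measurable_gau2.
rewrite -(ge0_integral_plane_shift b mg); last by move=> z; rewrite lee_fin gau2_ge0.
under eq_integral do rewrite gau2_shift gau2E.
rewrite ge0_integral_planeM; last 4 first.
- exact: measurable_gau1.
- exact: measurable_gau1.
- exact: gau1_ge0.
- exact: gau1_ge0.
rewrite integral_gau1// -EFinM -expr2 sqr_sqrtr// divr_ge0 ?pi_ge0//.
exact: ltW.
Qed.

Lemma integrable_gau2 a b : 0 < a ->
  mu2.-integrable setT (fun z => (gau2 a b z)%:E).
Proof.
move=> a0; apply/integrableP; split.
  by apply/measurable_EFinP; exact: measurable_gau2.
under eq_integral do rewrite gee0_abs ?lee_fin ?gau2_ge0//.
by rewrite integral_gau2// ltry.
Qed.

Lemma cintg_plane_shift (e : R * R) (f : mplane -> R[i]) : cmeas f ->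
  cintg mu2 (fun z => f (z.1 + e.1, z.2 + e.2)) = cintg mu2 f.
Proof.
have H (u : mplane -> R) : measurable_fun setT u ->
    Rintegral mu2 setT (fun z => u (z.1 + e.1, z.2 + e.2)) = Rintegral mu2 setT u.
  move=> mu; rewrite /Rintegral; congr fine.
  rewrite [LHS]integralE [RHS]integralE.
  rewrite -(ge0_integral_plane_shift e (f := ((fun x => (u x)%:E)^\+)%E))//; last first.
    by apply: measurable_funepos; exact/measurable_EFinP.
  rewrite -(ge0_integral_plane_shift e (f := ((fun x => (u x)%:E)^\-)%E))//; last first.
    by apply: measurable_funeneg; exact/measurable_EFinP.
  congr (_ - _)%E; apply: eq_integral => x _.
    exact: (congr1 (fun h => h x) (funepos_comp (fun x => (u x)%:E) (fun z => (z.1 + e.1, z.2 + e.2)))).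
  exact: (congr1 (fun h => h x) (funeneg_comp (fun x => (u x)%:E) (fun z => (z.1 + e.1, z.2 + e.2)))).
by move=> [fr fi]; apply: complex_ext => /=; [exact: (H _ fr)|exact: (H _ fi)].
Qed.

(** Modulated Gaussians: up to constants this family is stable under the Fourier
    transform, and it contains the real Gaussians. *)
Definition gchar (a : R) (b c x : R * R) : R[i] :=
  real_complex R (gau2 a b x) * expi (dotp x c).

Lemma cmeas_gchar a b c : cmeas (gchar a b c : mplane -> _).
Proof.
apply: cmeasM; first by apply: cmeas_real; exact: measurable_gau2.
by apply: cmeas_expi; exact: measurable_dotp.
Qed.

Lemma nrm_gchar a b c x : nrm (gchar a b c x) = gau2 a b x.
Proof. by rewrite nrmM nrm_real nrm_expi mulr1 ger0_norm// gau2_ge0. Qed.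

Lemma cintable_gchar a b c : 0 < a -> cintable mu2 (gchar a b c).
Proof.
move=> a0; apply: (cintable_le _ _ (integrable_gau2 b a0)).
  exact: cmeas_gchar.
by move=> x; rewrite nrm_gchar.
Qed.

Lemma cintg_gchar a b c : 0 < a ->
  cintg mu2 (gchar a b c) =
  real_complex R (pi / a * expR (- (dotp c c / (4 * a)))) * expi (dotp b c).
Proof.
move=> a0; rewrite -(cintg_plane_shift b); last exact: cmeas_gchar.
transitivity (cintg mu2 (fun z => expi (dotp b c) * gchar a 0 c z)).
  apply: eq_cintg => z; rewrite /gchar gau2_shift mulrCA -expiD; congr (_ * expi _).
  by rewrite /dotp /=; ring.
rewrite cintgZ; last exact: cintable_gchar.
rewrite mulrC; congr (_ * _).
rewrite -[LHS](@cfubini1 _ _ _ _ _ leb leb); last exact: cintable_gchar.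
transitivity (cintg leb (fun x : R => real_complex R (gau1 a x) * expi (x * c.1)) *
   cintg leb (fun y : R => real_complex R (gau1 a y) * expi (y * c.2))).
  rewrite mulrC -cintgZ; last exact: cintable_gau1_expi.
  apply: eq_cintg => x; rewrite mulrC -cintgZ; last exact: cintable_gau1_expi.
  apply: eq_cintg => y; rewrite /gchar gau2E /dotp /= expiD rmorphM /=.
  by rewrite mulrACA.
rewrite !gauss_fourier1// -rmorphM /=; congr (real_complex R _).
rewrite mulrACA -expr2 sqr_sqrtr ?divr_ge0 ?pi_ge0 ?(ltW a0)// -expRD.
by congr (_ * expR _); rewrite /dotp -!expr2; field; rewrite gt_eqF.
Qed.

End GaussPlane.

Section GaussSchwartz.
Context (R : realType).
Local Notation plane := (R * R)%type.

(** The combinations of Gaussians times cosines and sines with polynomial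
    coefficients.  This class is stable under partial derivatives and consists
    of rapidly decreasing functions, hence of Schwartz functions.  The boolean
    of [gclassX] selects the coordinate, as in [pderiv]. *)
Inductive gclass (a : R) (b c : R * R) : (plane -> R) -> Prop :=
| gclass_cos : gclass a b c (fun x => gau2 a b x * cos (dotp x c))
| gclass_sin : gclass a b c (fun x => gau2 a b x * sin (dotp x c))
| gclassZ k f : gclass a b c f -> gclass a b c (fun x => k * f x)
| gclassD f g : gclass a b c f -> gclass a b c g -> gclass a b c (fun x => f x + g x)
| gclassX (i : bool) f : gclass a b c f ->
    gclass a b c (fun x => (if i then x.1 else x.2) * f x).

Let e_ (i : bool) : plane := if i then (1, 0) else (0, 1).

Lemma differentiable_fst (x : plane) : differentiable (fst : plane -> R) x.
Proof. apply: (linear_differentiable (f := fst)) => y; exact: cvg_fst. Qed.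

Lemma differentiable_snd (x : plane) : differentiable (snd : plane -> R) x.
Proof. apply: (linear_differentiable (f := snd)) => y; exact: cvg_snd. Qed.

Lemma differentiable_fun1 (f : plane -> R) (h : R -> R) (x : plane) :
  differentiable f x -> (forall t, derivable h t 1) ->
  differentiable (fun x => h (f x)) x.
Proof.
by move=> df dh; apply: (@differentiable_comp _ _ _ _ f h) => //; exact/derivable1_diffP.
Qed.

Lemma differentiable_dotp (c x : plane) : differentiable (fun y : plane => dotp y c) x.
Proof.
apply: differentiableD; apply: differentiableM => //;
  [exact: differentiable_fst|exact: differentiable_snd].
Qed.

Lemma differentiable_gau2 a b (x : plane) : differentiable (gau2 a b) x.
Proof.
apply: (differentiable_fun1 (h := expR)) => //.
apply: differentiableN; apply: differentiableM => //.
under eq_fun do rewrite !expr2.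
apply: differentiableD; apply: differentiableM; apply: differentiableB => //;
  by [exact: differentiable_fst|exact: differentiable_snd].
Qed.

Lemma gclass_differentiable a b c f : gclass a b c f -> forall x, differentiable f x.
Proof.
elim=> {f} [||k f _ IH|f g _ IHf _ IHg|i f _ IH] x.
- apply: differentiableM; first exact: differentiable_gau2.
  by apply: (differentiable_fun1 (h := cos)) => //; exact: differentiable_dotp.
- apply: differentiableM; first exact: differentiable_gau2.
  by apply: (differentiable_fun1 (h := sin)) => //; exact: differentiable_dotp.
- by apply: differentiableM.
- by apply: differentiableD.
- apply: differentiableM => //; case: i; [exact: differentiable_fst|exact: differentiable_snd].
Qed.

(** Directional derivatives are derivatives of functions of one variable, to
    which the rules of differentiation apply. *)
Lemma derive_line (f : plane -> R) (x v : plane) (l : R) :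
  is_derive (0 : R) (1 : R) (fun h : R => f (h *: v + x)) l -> 'D_v f x = l.
Proof.
move=> [_ <-]; rewrite /derive.
suff -> : (fun h : R => h^-1 *: ((f \o shift x) (h *: v) - f x)) =
  (fun h : R => h^-1 *: (((fun h : R => f (h *: v + x)) \o shift 0) (h *: 1) -
    f (0 *: v + x))) by [].
apply/funext => h; rewrite [in RHS]scale0r [in RHS]add0r.
congr (_ *: (f _ - _)); change (h *: v + x = ((h *: (1 : R)) + 0) *: v + x).
by rewrite addr0 [h *: 1]mulr1.
Qed.

Lemma derive_along (f : plane -> R) (x v : plane) : differentiable f x ->
  is_derive (0 : R) (1 : R) (fun h : R => f (h *: v + x)) ('D_v f x).
Proof.
move=> df; have /derivable1P D := @diff_derivable _ _ _ f x v df.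
by rewrite (derive_line (derivableP D)); exact: derivableP.
Qed.

Lemma is_derive_dotp (x v c : plane) :
  is_derive (0 : R) (1 : R) (fun h : R => dotp (h *: v + x) c) (dotp v c).
Proof.
rewrite /dotp /=; apply: is_derive_eq.
by rewrite /GRing.scale /=; ring.
Qed.

Lemma is_derive_gau2 (a : R) (b x v : plane) :
  is_derive (0 : R) (1 : R) (fun h : R => gau2 a b (h *: v + x))
   (- 2 * a * (v.1 * (x.1 - b.1) + v.2 * (x.2 - b.2)) * gau2 a b x).
Proof.
have H : is_derive (0 : R) (1 : R) (fun h : R =>
    - (a * ((h * v.1 + x.1 - b.1) ^+ 2 + (h * v.2 + x.2 - b.2) ^+ 2)))
    (- 2 * a * (v.1 * (x.1 - b.1) + v.2 * (x.2 - b.2))).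
  by apply: is_derive_eq; rewrite /GRing.scale /=; ring.
apply: (@is_derive_eq _ _ _ _ _ _ _ _ (@is_derive1_comp _ expR _ _ _ _ (is_derive_expR _) H)).
by rewrite mulrC /gau2 !mul0r !add0r.
Qed.

Lemma gclass_derive a b c f i : gclass a b c f -> gclass a b c ('D_(e_ i) f).
Proof.
elim=> {f} [||k f Gf IH|f g Gf IHf Gg IHg|j f Gf IH].
- rewrite [X in gclass _ _ _ X](_ : _ = (fun x =>
     - 2 * a * ((if i then x.1 else x.2) * (gau2 a b x * cos (dotp x c))) +
     (2 * a * (if i then b.1 else b.2) * (gau2 a b x * cos (dotp x c)) +
      - (if i then c.1 else c.2) * (gau2 a b x * sin (dotp x c))))).
    by do ![apply: gclassD|apply: gclassZ|apply: gclassX|apply: gclass_cos|apply: gclass_sin].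
  apply/funext => x; apply: derive_line.
  have Hg := is_derive_gau2 a b x (e_ i).
  have Hc := @is_derive1_comp _ cos _ _ _ _ (is_derive_cos _) (is_derive_dotp x (e_ i) c).
  apply: (@is_derive_eq _ _ _ _ _ _ _ _ (@is_deriveM _ _ _ _ _ _ _ _ Hg Hc)).
  cbv beta delta [comp]; rewrite !scale0r !add0r /GRing.scale /= /dotp /e_.
  by case: i {Hg Hc} => /=; ring.
- rewrite [X in gclass _ _ _ X](_ : _ = (fun x =>
     - 2 * a * ((if i then x.1 else x.2) * (gau2 a b x * sin (dotp x c))) +
     (2 * a * (if i then b.1 else b.2) * (gau2 a b x * sin (dotp x c)) +
      (if i then c.1 else c.2) * (gau2 a b x * cos (dotp x c))))).
    by do ![apply: gclassD|apply: gclassZ|apply: gclassX|apply: gclass_cos|apply: gclass_sin].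
  apply/funext => x; apply: derive_line.
  have Hg := is_derive_gau2 a b x (e_ i).
  have Hc := @is_derive1_comp _ sin _ _ _ _ (is_derive_sin _) (is_derive_dotp x (e_ i) c).
  apply: (@is_derive_eq _ _ _ _ _ _ _ _ (@is_deriveM _ _ _ _ _ _ _ _ Hg Hc)).
  cbv beta delta [comp]; rewrite !scale0r !add0r /GRing.scale /= /dotp /e_.
  by case: i {Hg Hc} => /=; ring.
- rewrite [X in gclass _ _ _ X](_ : _ = (fun x => k * 'D_(e_ i) f x)).
    exact: gclassZ.
  apply/funext => x; apply: derive_line.
  have H := derive_along (e_ i) (gclass_differentiable Gf x).
  exact: (@is_deriveZ _ _ _ _ k _ _ _ H).
- rewrite [X in gclass _ _ _ X](_ : _ = (fun x => 'D_(e_ i) f x + 'D_(e_ i) g x)).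
    exact: gclassD.
  apply/funext => x; apply: derive_line.
  have Hf := derive_along (e_ i) (gclass_differentiable Gf x).
  have Hg := derive_along (e_ i) (gclass_differentiable Gg x).
  exact: (@is_deriveD _ _ _ _ _ _ _ _ _ Hf Hg).
- rewrite [X in gclass _ _ _ X](_ : _ = (fun x =>
     (if j then (e_ i).1 else (e_ i).2) * f x +
     (if j then x.1 else x.2) * 'D_(e_ i) f x)).
    by apply: gclassD; [exact: gclassZ|exact: gclassX].
  apply/funext => x; apply: derive_line.
  have Hf := derive_along (e_ i) (gclass_differentiable Gf x).
  have Hx : is_derive (0 : R) (1 : R) (fun h : R => if j then (h *: e_ i + x).1
      else (h *: e_ i + x).2) (if j then (e_ i).1 else (e_ i).2).
    by case: j => /=; apply: is_derive_eq; rewrite /GRing.scale /=; ring.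
  apply: (@is_derive_eq _ _ _ _ _ _ _ _ (@is_deriveM _ _ _ _ _ _ _ _ Hx Hf)).
  by rewrite scale0r add0r /GRing.scale /=; ring.
Qed.

Lemma gclass_pderiv a b c f w : gclass a b c f -> gclass a b c (pderiv w f).
Proof. by move=> Gf; elim: w => //= i w IH; exact: gclass_derive. Qed.

Lemma enorm_ge0 (x : plane) : 0 <= enorm x. Proof. exact: sqrtr_ge0. Qed.

Lemma enorm_sqr (x : plane) : enorm x ^+ 2 = x.1 ^+ 2 + x.2 ^+ 2.
Proof.
by rewrite /enorm sqr_sqrtr /dotp -!expr2// addr_ge0// sqr_ge0.
Qed.

Lemma fst_le_enorm (x : plane) : `|x.1| <= enorm x.
Proof.
by rewrite -ler_sqr ?nnegrE ?enorm_ge0// enorm_sqr normr_sqr lerDl sqr_ge0.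
Qed.

Lemma snd_le_enorm (x : plane) : `|x.2| <= enorm x.
Proof.
by rewrite -ler_sqr ?nnegrE ?enorm_ge0// enorm_sqr normr_sqr lerDr sqr_ge0.
Qed.

(** The difference of the exponents is a / 2 |x - 2 b|^2. *)
Lemma gau2_le (a : R) (b x : plane) : 0 < a ->
  gau2 a b x <= expR (a * (b.1 ^+ 2 + b.2 ^+ 2)) * expR (- (a / 2 * enorm x ^+ 2)).
Proof.
move=> a0; rewrite /gau2 -expRD ler_expR enorm_sqr.
rewrite -subr_ge0 (_ : _ - _ = a / 2 * ((x.1 - 2 * b.1) ^+ 2 + (x.2 - 2 * b.2) ^+ 2)).
  by apply: mulr_ge0; [lra|rewrite addr_ge0// sqr_ge0].
by field.
Qed.

(** exp (a t^2 / 2) is at least (a t^2 / 2)^k / k!, and t^k <= t^(2 k) for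
    1 <= t. *)
Lemma gau2_decay (a : R) (b : plane) (k : nat) : 0 < a ->
  exists M : R, forall x : plane, enorm x ^+ k * gau2 a b x <= M.
Proof.
move=> a0; set K := expR (a * (b.1 ^+ 2 + b.2 ^+ 2)).
exists (K * (1 + k`!%:R / (a / 2) ^+ k)) => x.
apply: le_trans (ler_wpM2l _ (gau2_le b x a0)) _; first by rewrite exprn_ge0// enorm_ge0.
rewrite -/K mulrCA ler_wpM2l ?expR_ge0//; set t := enorm x.
have t0 : 0 <= t by exact: enorm_ge0.
have a2 : 0 < a / 2 by lra.
have [t1|t1] := leP t 1.
  rewrite -[leLHS]mulr1; apply: (@le_trans _ _ 1); last first.
    by rewrite lerDl divr_ge0// exprn_ge0// ltW.
  rewrite mulr1 -[leRHS]mulr1; apply: ler_pM; rewrite ?exprn_ge0 ?expR_ge0//.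
    exact: exprn_ile1.
  by rewrite -[leRHS]expR0 ler_expR oppr_le0 mulr_ge0 ?sqr_ge0// ltW.
have E : (a / 2 * t ^+ 2) ^+ k / k`!%:R <= expR (a / 2 * t ^+ 2).
  case: (k) => [|m]; first by rewrite expr0 fact0 divr1 -[leLHS]expR0 ler_expR mulr_ge0 ?sqr_ge0// ltW.
  have p0 : 0 <= a / 2 * t ^+ 2 by rewrite mulr_ge0 ?sqr_ge0// ltW.
  by apply: le_trans (expR_ge1Dxn m p0); rewrite lerDr.
apply: (@le_trans _ _ (k`!%:R / (a / 2) ^+ k)); last by rewrite lerDr.
rewrite expRN ler_pdivrMr ?expR_gt0// mulrAC ler_pdivlMr ?exprn_gt0//.
have kf : 0 < k`!%:R :> R by rewrite ltr0n fact_gt0.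
move: E; rewrite ler_pdivrMr// => E; rewrite [leRHS]mulrC.
apply: (le_trans _ E); have -> : (a / 2 * t ^+ 2) ^+ k = (t ^+ 2) ^+ k * (a / 2) ^+ k.
  by rewrite mulrC exprMn.
rewrite ler_wpM2r ?exprn_ge0 ?(ltW a2)//.
by rewrite -exprM ler_weXn2l ?leq_pmull// ltW.
Qed.

Lemma gclass_decay a b c f : 0 < a -> gclass a b c f -> forall k : nat,
  exists M : R, forall x : plane, enorm x ^+ k * `|f x| <= M.
Proof.
move=> a0; elim=> {f} [k|k|r f _ IH k|f g _ IHf _ IHg k|i f _ IH k].
- have [M HM] := gau2_decay b k a0; exists M => x; apply: le_trans (HM x).
  rewrite ler_wpM2l ?exprn_ge0 ?enorm_ge0// normrM ger0_norm ?gau2_ge0//.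
  by rewrite ler_piMr ?gau2_ge0// ler_norml cos_geN1 cos_le1.
- have [M HM] := gau2_decay b k a0; exists M => x; apply: le_trans (HM x).
  rewrite ler_wpM2l ?exprn_ge0 ?enorm_ge0// normrM ger0_norm ?gau2_ge0//.
  by rewrite ler_piMr ?gau2_ge0// ler_norml sin_geN1 sin_le1.
- have [M HM] := IH k; exists (`|r| * M) => x.
  by rewrite normrM mulrCA ler_wpM2l.
- have [M HM] := IHf k; have [N HN] := IHg k; exists (M + N) => x.
  apply: le_trans (lerD (HM x) (HN x)).
  by rewrite -mulrDr ler_wpM2l ?exprn_ge0 ?enorm_ge0// ler_normD.
- have [M HM] := IH k.+1; exists M => x; apply: le_trans (HM x).
  rewrite normrM mulrA ler_wpM2r// exprSr ler_wpM2l ?exprn_ge0 ?enorm_ge0//.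
  by case: i; [exact: fst_le_enorm|exact: snd_le_enorm].
Qed.

Lemma gclass_rschwartz a b c f : 0 < a -> gclass a b c f -> rschwartz f.
Proof.
move=> a0 Gf; split => w; have Gw := gclass_pderiv w Gf.
  exact: gclass_differentiable Gw.
exact: (gclass_decay a0 Gw).
Qed.

Lemma schwartz_gchar (a : R) (b c : plane) : 0 < a -> schwartz (gchar a b c).
Proof.
move=> a0; split; apply: (@gclass_rschwartz a b c) => //.
  rewrite (_ : (fun x => _) = (fun x => gau2 a b x * cos (dotp x c))).
    exact: gclass_cos.
  by apply/funext => x; rewrite cReM /= mul0r subr0.
rewrite (_ : (fun x => _) = (fun x => gau2 a b x * sin (dotp x c))).
  exact: gclass_sin.
by apply/funext => x; rewrite cImM /= mul0r addr0.
Qed.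

End GaussSchwartz.

Section SchwartzBasics.
Context (R : realType).
Notation mR := (measurableTypeR R).
Notation mplane := (mR * mR)%type.
Notation leb := (@lebesgue_measure R).
Notation mu2 := (@plane_mu R).

Lemma schwartz_cmeas (phi : R * R -> R[i]) : schwartz phi ->
  cmeas (phi : mplane -> _).
Proof.
move=> [[d1 _] [d2 _]]; split; apply: continuous_measurable_plane => x;
  apply: differentiable_continuous; [exact: (d1 [::])|exact: (d2 [::])].
Qed.

Definition weight1 (x : R) : R := (1 + x ^+ 2)^-1.

Lemma weight1_ge0 x : 0 <= weight1 x.
Proof. by rewrite invr_ge0 addr_ge0// sqr_ge0. Qed.

Lemma continuous_weight1 : continuous weight1.
Proof.
move=> x; apply: cvgV; first by rewrite gt_eqF// ltr_pwDl// sqr_ge0.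
by apply: cvgD; [exact: cvg_cst|exact: exprn_continuous].
Qed.

Lemma integrable_weight1 : leb.-integrable setT (fun x => (weight1 x)%:E).
Proof.
have mw : measurable_fun setT weight1.
  by apply: continuous_measurable_fun; exact: continuous_weight1.
apply/integrableP; split; first exact/measurable_EFinP.
under eq_integral do rewrite gee0_abs ?lee_fin ?weight1_ge0//.
rewrite ge0_symfun_integralT//; last 3 first.
- exact: weight1_ge0.
- exact: continuous_weight1.
- by move=> x; rewrite /weight1 /= sqrrN.
rewrite (_ : [set x | _] = `[0, +oo[%classic); last first.
  by apply/seteqP; split => x /=; rewrite in_itv/= andbT.
by rewrite (@integral0y_oneDsqr R) -EFinM ltry.
Qed.

Lemma integrable_weight2 :
  mu2.-integrable setT (fun z => (weight1 z.1 * weight1 z.2)%:E).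
Proof.
have mw : measurable_fun setT weight1.
  by apply: continuous_measurable_fun; exact: continuous_weight1.
apply/integrableP; split.
  apply/measurable_EFinP; apply: measurable_funM; exact: measurableT_comp.
under eq_integral do rewrite gee0_abs ?lee_fin ?mulr_ge0 ?weight1_ge0//.
rewrite ge0_integral_planeM//; try exact: weight1_ge0.
have := integrable_lty measurableT integrable_weight1.
have : (0 <= \int[leb]_x (weight1 x)%:E)%E.
  by apply: integral_ge0 => x _; rewrite lee_fin weight1_ge0.
by case: (\int[leb]_x _)%E => // r _ _; rewrite -EFinM ltry.
Qed.

(** Expanding the product of the 1 + x_i^2 gives at most 1 + |x|^2 + |x|^4, so
    that a bound on three moments of a Schwartz function bounds it by a multiple
    of the product weight. *)
Lemma weight2_lower (x : R * R) : 1 <= (1 + 2 * enorm x ^+ 2 + enorm x ^+ 4) * (weight1 x.1 * weight1 x.2).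
Proof.
have h (t : R) : 0 < 1 + t ^+ 2 by rewrite ltr_pwDl// sqr_ge0.
rewrite /weight1 -invfM ler_pdivlMr ?mulr_gt0// mul1r.
rewrite (_ : enorm x ^+ 4 = (enorm x ^+ 2) ^+ 2); last by rewrite -exprM.
rewrite enorm_sqr; have := sqr_ge0 x.1; have := sqr_ge0 x.2.
by set u := x.1 ^+ 2; set v := x.2 ^+ 2; nra.
Qed.

Lemma schwartz_bound (phi : R * R -> R[i]) : schwartz phi ->
  exists M, 0 < M /\ forall x, nrm (phi x) <= M * (weight1 x.1 * weight1 x.2).
Proof.
have H (f : R * R -> R) : rschwartz f ->
    exists M, 0 < M /\ forall x, `|f x| <= M * (weight1 x.1 * weight1 x.2).
  move=> [_ /(_ [::])] /= D; have [A HA] := D 0; have [B HB] := D 2; have [C HC] := D 4.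
  exists (`|A| + 2 * `|B| + `|C| + 1); split; first by rewrite ltr_wpDl// !addr_ge0.
  move=> x; have := weight2_lower x.
  set W := weight1 x.1 * weight1 x.2.
  have W0 : 0 <= W by rewrite mulr_ge0 ?weight1_ge0.
  move=> /(ler_wpM2r (normr_ge0 (f x))); rewrite mul1r => /le_trans; apply.
  rewrite mulrAC ler_wpM2r//.
  have := HA x; have := HB x; have := HC x.
  have := ler_norm A; have := ler_norm B; have := ler_norm C.
  by rewrite expr0 mul1r !mulrDl mul1r; lra.
move=> [/H[M [M0 HM]] /H[N [N0 HN]]]; exists (M + N); split; first exact: addr_gt0.
by move=> x; rewrite mulrDl; apply: le_trans (nrm_le_ReIm _) (lerD (HM x) (HN x)).
Qed.

Lemma schwartz_cintable (phi : R * R -> R[i]) : schwartz phi -> cintable mu2 phi.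
Proof.
move=> sphi; have [M [M0 HM]] := schwartz_bound sphi.
apply: (cintable_le (schwartz_cmeas sphi) HM).
under eq_fun do rewrite EFinM; apply: integrableZl => //; exact: integrable_weight2.
Qed.

Lemma schwartz_bounded (phi : R * R -> R[i]) : schwartz phi ->
  exists M, 0 < M /\ forall x, nrm (phi x) <= M.
Proof.
move=> /schwartz_bound[M [M0 HM]]; exists M; split => // x.
apply: (le_trans (HM x)); rewrite ler_piMr ?(ltW M0)// mulr_ile1 ?weight1_ge0//;
by rewrite invf_le1 ?lerDl ?sqr_ge0// ltr_pwDl// sqr_ge0.
Qed.

End SchwartzBasics.

(** * A function with vanishing Gaussian integrals is null *)

Section Uniqueness.
Context (R : realType).
Notation mR := (measurableTypeR R).
Notation mplane := (mR * mR)%type.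
Notation leb := (@lebesgue_measure R).
Notation mu2 := (@plane_mu R).

(** The distance by which the quadrants below are shrunk at step k; the Gaussian
    that regularizes their indicators has width pw k ^+ 2. *)
Let pw (k : nat) : R := k.+1%:R^-1.

(** None stands for the whole line: with it the quadrants form a generating class
    that is stable under intersection and contains the plane. *)
Let ray (p : option R) (e : R) : set mR :=
  if p is Some p then `]p + e, +oo[%classic else setT.

Let mray p e : measurable (ray p e).
Proof. by case: p => [p|] //=; exact: measurable_itv. Qed.

Let box (p q : option R) (e : R) : set mplane := ray p e `*` ray q e.

Let mbox p q e : measurable (box p q e).
Proof. by apply: measurableX; exact: mray. Qed.

Let cind (A : set mplane) (x : mplane) : R[i] := real_complex R (\1_A x).

Let cmeas_cind A : measurable A -> cmeas (cind A).
Proof. by move=> mA; apply: cmeas_real; exact: measurable_indic. Qed.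

Let nrm_cind A x : nrm (cind A x) <= 1.
Proof.
rewrite nrm_real indicE; case: (x \in A); by rewrite ?normr0 ?normr1.
Qed.

(** The ray recedes by pw n while the point moves by O(pw n ^+ 2), which is
    eventually smaller: the convergence thus holds at the endpoint as well. *)
Let ray_cvg p (s t : R) : \forall n \near \oo,
  (s - pw n ^+ 2 * t \in ray p (pw n)) = (s \in ray p 0).
Proof.
case: p => [p|]; last by apply: nearW => n; rewrite !in_setT.
have [sp|ps] := leP s p.
  have -> : (s \in ray (Some p) 0) = false.
    by apply/negbTE; rewrite notin_setE /= in_itv/= andbT addr0; apply/negP; rewrite -leNgt.
  near=> n; apply/negbTE; rewrite notin_setE /= in_itv/= andbT; apply/negP; rewrite -leNgt.
  have w0 : 0 < pw n by rewrite invr_gt0.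
  have : `|t| * pw n <= 1.
    rewrite /pw ler_pdivrMr// mul1r; apply: (@le_trans _ _ n%:R).
      by near: n; exact: nbhs_infty_ger.
    by rewrite ler_nat.
  have := ler_norm (- t); rewrite normrN; nra.
have -> : (s \in ray (Some p) 0) = true.
  by apply/mem_set; rewrite /= in_itv/= andbT addr0.
near=> n; apply/mem_set; rewrite /= in_itv/= andbT.
have w0 : 0 < pw n by rewrite invr_gt0.
have w1 : pw n <= 1 by rewrite invf_le1// ler1n.
have : (1 + `|t|) * pw n < s - p.
  rewrite /pw ltr_pdivrMr// -ltr_pdivrMl ?subr_gt0//.
  apply: (@lt_le_trans _ _ n%:R); last by rewrite ler_nat.
  by near: n; exact: nbhs_infty_gtr.
have w2 : pw n ^+ 2 <= pw n by rewrite expr2 ler_piMl// ltW.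
have := ler_wpM2l (sqr_ge0 (pw n)) (ler_norm t).
have := ler_wpM2r (normr_ge0 t) w2; lra.
Unshelve. all: by end_near. Qed.

Let box_cvg p q (x t : mplane) : \forall n \near \oo,
  cind (box p q (pw n)) (x.1 - pw n ^+ 2 * t.1, x.2 - pw n ^+ 2 * t.2) =
  cind (box p q 0) x.
Proof.
near=> n; rewrite /cind !indicE /box !in_setX /=; congr (real_complex R (_ && _)%:R).
  by near: n; exact: ray_cvg.
by near: n; exact: ray_cvg.
Unshelve. all: by end_near. Qed.

Let kern p q n (x t : mplane) : R[i] :=
  cind (box p q (pw n)) (x.1 - pw n ^+ 2 * t.1, x.2 - pw n ^+ 2 * t.2) *
  real_complex R (gau2 1 0 t).

Let cmeas_kern p q n : cmeas (fun z : mplane * mplane => kern p q n z.1 z.2).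
Proof.
apply: cmeasM.
  apply: (cmeas_comp (cmeas_cind (mbox p q (pw n)))).
  by apply: measurable_fun_pair; apply: measurable_funB;
    do ?[exact: measurableT_comp|apply: measurable_funM => //].
by apply: cmeas_real; exact: (measurableT_comp (@measurable_gau2 R 1 0) measurable_snd).
Qed.

Let nrm_kern p q n x t : nrm (kern p q n x t) <= gau2 1 0 t.
Proof.
rewrite nrmM nrm_real [X in _ * X]ger0_norm ?gau2_ge0//.
by rewrite ler_piMl ?gau2_ge0// nrm_cind.
Qed.

Let cmeas_kernx p q n x : cmeas (kern p q n x).
Proof. exact: (cmeas_comp (cmeas_kern p q n) (measurable_pair1 x)). Qed.

(** The convolution of the indicator of the shrunk quadrant with a Gaussian of
    mass pi and width pw n ^+ 2. *)
Let moll p q n (x : mplane) : R[i] := cintg mu2 (kern p q n x).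

Let cmeas_moll p q n : cmeas (moll p q n).
Proof.
have := @cmeas_partial_cintg _ _ mplane mplane R mu2 (fun z : mplane * mplane => kern p q n z.1 z.2)
  (cmeas_kern p q n).
by [].
Qed.

Let one0 : 0 < 1 :> R. Proof. exact: ltr01. Qed.

Let nrm_moll p q n x : nrm (moll p q n x) <= pi.
Proof.
have I : cintable mu2 (kern p q n x).
  by apply: (cintable_le (cmeas_kernx p q n x) (nrm_kern p q n x)); exact: integrable_gau2.
rewrite -lee_fin; apply: le_trans (nrm_cintg_le I) _.
rewrite -[pi]divr1 -(integral_gau2 0 one0); apply: ge0_le_integral => //.
- by move=> t _; rewrite lee_fin nrm_ge0.
- by apply/measurable_EFinP; exact: measurable_nrm.
- by apply/measurable_EFinP; exact: measurable_gau2.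
- by move=> t _; rewrite lee_fin nrm_kern.
Qed.

Let moll_cvg p q x :
  (fun n => nrm (moll p q n x - cind (box p q 0) x * real_complex R pi)) @ \oo --> (0 : R).
Proof.
have E : cind (box p q 0) x * real_complex R pi =
    cintg mu2 (fun t => cind (box p q 0) x * real_complex R (gau2 1 0 t)).
  rewrite cintgZ; last first.
    apply: (cintable_le _ _ (integrable_gau2 0 one0)).
      by apply: cmeas_real; exact: measurable_gau2.
    by move=> t; rewrite nrm_real ger0_norm// gau2_ge0.
  by rewrite cintg_real /Rintegral integral_gau2//= divr1.
rewrite E; apply: (@cintg_cvg _ _ _ _ (kern p q ^~ x) _ (gau2 1 0)).
- by move=> n; exact: cmeas_kernx.
- by apply: cmeasM; [exact: cmeas_cst|apply: cmeas_real; exact: measurable_gau2].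
- apply: aeW => t; apply: cvg_near_cst; near=> n.
  rewrite /kern; have -> : cind (box p q (pw n))
      (x.1 - pw n ^+ 2 * t.1, x.2 - pw n ^+ 2 * t.2) = cind (box p q 0) x.
    by near: n; exact: box_cvg.
  by rewrite subrr nrm0.
- exact: integrable_gau2.
- by move=> n t; exact: nrm_kern.
Unshelve. all: by end_near. Qed.

Let scale n : R := (pw n ^+ 2)^-1 ^+ 2.

Let scale_gt0 n : 0 < scale n.
Proof. by rewrite exprn_gt0// invr_gt0 exprn_gt0// invr_gt0. Qed.

(** The substitution b = x - pw n ^+ 2 * t turns the convolution into an average
    of Gaussians over their centres b, to which the hypothesis on H applies. *)
Let mollE p q n x : moll p q n x = real_complex R (scale n) *
  cintg mu2 (fun b => cind (box p q (pw n)) b * real_complex R (gau2 (scale n) b x)).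
Proof.
set e := pw n ^+ 2; have e0 : 0 < e by rewrite exprn_gt0// invr_gt0.
pose f (b : mplane) := (\1_(box p q (pw n)) b * gau2 (scale n) b x)%R.
have mf : measurable_fun setT (fun b => (f b)%:E).
  apply/measurable_EFinP; apply: measurable_funM; first exact: measurable_indic.
  by under eq_fun do rewrite gau2_sym; exact: measurable_gau2.
have f0 b : (0 <= (f b)%:E)%E by rewrite lee_fin mulr_ge0// gau2_ge0.
have := ge0_integral_plane_rescale x e0 mf f0.
have fE t : f (x.1 - e * t.1, x.2 - e * t.2) =
    \1_(box p q (pw n)) (x.1 - e * t.1, x.2 - e * t.2) * gau2 1 0 t.
  rewrite /f; congr (_ * _); rewrite /gau2 /scale -/e /=; congr expR.
  by field; rewrite gt_eqF.
under eq_integral do rewrite fE.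
rewrite /moll (_ : kern p q n x = fun t => real_complex R
    (\1_(box p q (pw n)) (x.1 - e * t.1, x.2 - e * t.2) * gau2 1 0 t)); last first.
  by apply/funext => t; rewrite /kern /cind -rmorphM.
rewrite [X in _ = _ * cintg _ X](_ : _ = fun b => real_complex R (f b)); last first.
  by apply/funext => b; rewrite /cind -rmorphM.
rewrite !cintg_real -rmorphM /= => E; congr (real_complex R _).
rewrite [X in _ = _ * X]/Rintegral -E.
rewrite {1}/Rintegral; set u := (\int[mu2]_t _)%E.
rewrite [X in _ = _ * X](_ : _ = e * e * fine u).
  by rewrite mulrA /scale -/e -expr2 -exprMn mulVf ?gt_eqF// expr1n mul1r.
have : (0 <= u)%E.
  by apply: integral_ge0 => t _; rewrite -fE lee_fin mulr_ge0// gau2_ge0.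
case: u E => [r _ _|_ _|//]; first by [].
have ee : (0 < (e * e)%:E)%E by rewrite lte_fin mulr_gt0.
by rewrite gt0_muley//= mulr0.
Qed.

Variable H : mplane -> R[i].
Hypothesis IH : cintable mu2 H.
Hypothesis H0 : forall a b, 0 < a ->
  cintg mu2 (fun x => H x * real_complex R (gau2 a b x)) = 0.

Let moll0 p q n : cintg mu2 (fun x => H x * moll p q n x) = 0.
Proof.
set B := box p q (pw n); set a := scale n.
pose K x := real_complex R a * H x.
have IK : cintable mu2 K by exact: cintableZ.
have mK := cintable_meas IK.
have a0 : 0 < a by exact: scale_gt0.
pose Phi (z : mplane * mplane) := K z.1 * (cind B z.2 * real_complex R (gau2 a z.2 z.1)).
have mPhi : cmeas Phi.
  apply: cmeasM; first exact: (cmeas_comp mK measurable_fst).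
  apply: cmeasM; first exact: (cmeas_comp (cmeas_cind (mbox p q (pw n))) measurable_snd).
  by apply: cmeas_real; under eq_fun do rewrite gau2_sym; exact: measurable_gau22.
have Igx x : cintable mu2 (fun b => cind B b * real_complex R (gau2 a b x)).
  apply: (cintable_le _ _ (integrable_gau2 x a0)).
    apply: cmeasM; first by apply: cmeas_cind; exact: mbox.
    by apply: cmeas_real; under eq_fun do rewrite gau2_sym; exact: measurable_gau2.
  move=> b; rewrite nrmM nrm_real ger0_norm ?gau2_ge0// gau2_sym.
  by rewrite ler_piMl ?gau2_ge0// nrm_cind.
have IPhi : cintable (mu2 \x mu2)%E Phi.
  apply: cintable_prod => //.
  apply: (@le_lt_trans _ _ (\int[mu2]_x ((nrm (K x))%:E * (pi / a)%:E))%E).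
    apply: ge0_le_integral => //.
    - by move=> x _; apply: integral_ge0 => b _; rewrite lee_fin nrm_ge0.
    - apply: (@measurable_partial_integral _ _ mplane mplane R mu2 (fun z => (nrm (Phi z))%:E)).
      by apply/measurable_EFinP; exact: measurable_nrm.
    - apply: emeasurable_funM => //; apply/measurable_EFinP; exact: measurable_nrm.
    - move=> x _; rewrite -(integral_gau2 x a0) -ge0_integralZl ?lee_fin ?nrm_ge0//; last 2 first.
      + by apply/measurable_EFinP; exact: measurable_gau2.
      + by move=> b _; rewrite lee_fin gau2_ge0.
      apply: ge0_le_integral => //.
      + by move=> b _; rewrite lee_fin nrm_ge0.
      + apply/measurable_EFinP; apply: measurable_nrm.
        exact: (cmeas_comp mPhi (measurable_pair1 x)).
      + by apply: emeasurable_funM => //; apply/measurable_EFinP; exact: measurable_gau2.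
      + move=> b _; rewrite -EFinM lee_fin.
        have -> : nrm (Phi (x, b)) = nrm (K x) * (nrm (cind B b) * gau2 a b x).
          rewrite nrmM [X in _ * X]nrmM; congr (_ * (_ * _)).
          by rewrite nrm_real ger0_norm ?gau2_ge0.
        rewrite ler_wpM2l ?nrm_ge0// gau2_sym.
        by rewrite ler_piMl ?gau2_ge0// nrm_cind.
  rewrite ge0_integralZr//; last 3 first.
  - by apply/measurable_EFinP; exact: measurable_nrm.
  - by move=> x _; rewrite lee_fin nrm_ge0.
  - by rewrite lee_fin divr_ge0 ?pi_ge0// ltW.
  have := cintable_lty IK.
  have : (0 <= \int[mu2]_x (nrm (K x))%:E)%E.
    by apply: integral_ge0 => x _; rewrite lee_fin nrm_ge0.
  by case: (\int[mu2]_x _)%E => // r _ _; rewrite -EFinM ltry.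
rewrite (_ : (fun x => _) = (fun x => cintg mu2 (fun b => Phi (x, b)))); last first.
  apply/funext => x; rewrite mollE -/a -/B mulrA [H x * _]mulrC -cintgZ//.
rewrite (cfubini IPhi) (_ : (fun b => _) = fun=> 0).
  by apply: complex_ext => /=; rewrite Rintegral_cst// mul0r.
apply/funext => b.
have Ig : cintable mu2 (fun x => H x * real_complex R (gau2 a b x)).
  apply: (cintable_le _ _ (cintable_nrm IH)).
    apply: cmeasM; first exact: (cintable_meas IH).
    by apply: cmeas_real; exact: measurable_gau2.
  move=> x; rewrite nrmM nrm_real ger0_norm ?gau2_ge0// ler_piMr ?nrm_ge0//.
  by rewrite gau2_le1// ltW.
rewrite -[RHS](mulr0 (cind B b * real_complex R a)) -(H0 b a0) -cintgZ//.
by apply: eq_cintg => x; rewrite /Phi /K /=; ring.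
Qed.

Let box0 p q : cintg mu2 (fun x => cind (box p q 0) x * H x) = 0.
Proof.
have mH := cintable_meas IH.
have C : (fun n => nrm (cintg mu2 (fun x => H x * moll p q n x) -
    cintg mu2 (fun x => real_complex R pi * (cind (box p q 0) x * H x)))) @ \oo --> (0 : R).
  apply: (@cintg_cvg _ _ _ _ (fun n x => H x * moll p q n x) _ (fun x => pi * nrm (H x))).
  - by move=> n; apply: cmeasM => //; exact: cmeas_moll.
  - by apply: cmeasM; [exact: cmeas_cst|apply: cmeasM => //; exact: cmeas_cind].
  - apply: aeW => x; rewrite -[X in _ --> X](mulr0 (nrm (H x))).
    rewrite (_ : (fun n => _) = (fun n => nrm (H x) *
      nrm (moll p q n x - cind (box p q 0) x * real_complex R pi))).
      by apply: cvgM; [exact: cvg_cst|exact: moll_cvg].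
    apply/funext => n; rewrite -nrmM mulrBr; congr (nrm (_ - _)).
    by ring.
  - under eq_fun do rewrite EFinM; apply: integrableZl => //; exact: cintable_nrm.
  - by move=> n x; rewrite nrmM mulrC ler_wpM2r ?nrm_ge0// nrm_moll.
have Ib : cintable mu2 (fun x => cind (box p q 0) x * H x).
  apply: (cintable_le _ _ (cintable_nrm IH)); first by apply: cmeasM => //; exact: cmeas_cind.
  by move=> x; rewrite nrmM ler_piMl ?nrm_ge0// nrm_cind.
move: C; under eq_fun do rewrite moll0 sub0r nrmN cintgZ// nrmM.
move=> /(cvg_unique _ (cvg_cst _)) E.
apply: nrm_eq0; have /eqP := E (@norm_hausdorff _ _).
rewrite mulf_eq0 nrm_real normr_eq0 gt_eqF ?pi_gt0//= => /eqP.
by [].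
Qed.

Let G : set (set mplane) := [set A | exists p q, A = box p q 0].

Let GE : measurable = <<s G >> :> set (set mplane).
Proof.
apply/seteqP; split; last first.
  by apply: smallest_sub; [exact: sigma_algebra_measurable|move=> _ [p [q ->]]; exact: mbox].
pose GT := g_sigma_algebraType G.
have mf : measurable_fun (setT : set GT) (fst : GT -> mR).
  apply: (measurability _ (@RGenOInfty.measurableE R)) => //.
  move=> _ [_ [a ->] <-]; apply: sub_sigma_algebra; exists (Some a), None.
  by rewrite /box /ray addr0; apply/seteqP; split => x /= [].
have ms : measurable_fun (setT : set GT) (snd : GT -> mR).
  apply: (measurability _ (@RGenOInfty.measurableE R)) => //.
  move=> _ [_ [a ->] <-]; apply: sub_sigma_algebra; exists None, (Some a).
  by rewrite /box /ray addr0; apply/seteqP; split => x /= [].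
apply: smallest_sub; first exact: smallest_sigma_algebra.
move=> A [[B mB <-]|[B mB <-]].
  exact: (mf _ B mB).
exact: (ms _ B mB).
Qed.

Let GI : setI_closed G.
Proof.
have rI p p' : exists r, ray p 0 `&` ray p' 0 = ray r 0.
  case: p => [p|]; last by exists p'; rewrite setTI.
  case: p' => [p'|]; last by exists (Some p); rewrite setIT.
  exists (Some (Num.max p p')); rewrite /ray !addr0; apply/seteqP.
  split => x /=; rewrite !in_itv/= !andbT gt_max; first by move=> [-> ->].
  by move=> /andP[].
move=> _ _ [p [q ->]] [p' [q' ->]].
have [r rE] := rI p p'; have [s sE] := rI q q'; exists r, s.
by rewrite /box -setXI rE sE.
Qed.

Let all0 A : measurable A -> cintg mu2 (fun x => cind A x * H x) = 0.
Proof.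
have mH := cintable_meas IH.
have Ib B : measurable B -> cintable mu2 (fun x => cind B x * H x).
  move=> mB; apply: (cintable_le _ _ (cintable_nrm IH)).
    by apply: cmeasM => //; exact: cmeas_cind.
  by move=> x; rewrite nrmM ler_piMl ?nrm_ge0// nrm_cind.
have T0 : cintg mu2 (fun x => cind setT x * H x) = 0.
  by have := box0 None None; rewrite /box /ray setXTT.
move=> mA; have : <<s G >> A by rewrite -GE.
apply: (@dynkin_induction _ _ G (fun A => cintg mu2 (fun x => cind A x * H x) = 0)) => //.
- by move=> _ [p [q ->]]; exact: box0.
- move=> B mB B0.
  rewrite (_ : (fun x => _) = (fun x => cind setT x * H x - cind B x * H x)).
    by rewrite cintgB ?T0 ?B0 ?subrr//; exact: Ib.
  apply/funext => x; rewrite -mulrBl /cind -rmorphB; congr (real_complex R _ * _).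
  by rewrite !indicE in_setT in_setC; case: (x \in B); rewrite ?subrr ?subr0.
- move=> F mF tF F0.
  have U0 n : cintg mu2 (fun x => cind (\big[setU/set0]_(i < n) F i) x * H x) = 0.
    elim: n => [|n IHn].
      rewrite big_ord0 (_ : (fun x => _) = fun=> 0).
        by apply: complex_ext => /=; rewrite Rintegral_cst// mul0r.
      by apply/funext => x; rewrite /cind indic0 mul0r.
    rewrite (_ : (fun x => _) = (fun x =>
      cind (\big[setU/set0]_(i < n) F i) x * H x + cind (F n) x * H x)).
      rewrite cintgD ?IHn ?F0 ?addr0//; apply: Ib => //.
      exact: bigsetU_measurable.
    apply/funext => x; rewrite -mulrDl /cind -rmorphD; congr (real_complex R _ * _).
    rewrite big_ord_recr /= !indicE in_setU.
    have [xF|//] := boolP (x \in F n); last by rewrite orbF addr0.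
    have -> : (x \in \big[setU/set0]_(i < n) F i) = false.
      apply/negbTE; rewrite notin_setE -bigcup_mkord => -[k /= kn Fk].
      have /trivIsetP/(_ k n I I) := tF; rewrite ltn_eqF// => /(_ isT) kn0.
      have : (F k `&` F n) x by split => //; exact/set_mem.
      by rewrite kn0.
    by rewrite add0r.
  have C : (fun n => nrm (cintg mu2 (fun x => cind (\big[setU/set0]_(i < n) F i) x * H x) -
      cintg mu2 (fun x => cind (\bigcup_k F k) x * H x))) @ \oo --> (0 : R).
    apply: (@cintg_cvg _ _ _ _ (fun n x => cind (\big[setU/set0]_(i < n) F i) x * H x)
      _ (fun x => nrm (H x))).
    + by move=> n; apply: cmeasM => //; apply: cmeas_cind; exact: bigsetU_measurable.
    + by apply: cmeasM => //; apply: cmeas_cind; exact: bigcupT_measurable.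
    + apply: aeW => x; apply: cvg_near_cst.
      have [[k _ Fk]|nF] := pselect ((\bigcup_k F k) x).
        near=> n; rewrite -mulrBl /cind !indicE.
        have -> : x \in \big[setU/set0]_(i < n) F i.
          apply/mem_set; rewrite -bigcup_mkord; exists k => //=.
          by near: n; exact: nbhs_infty_gt.
        have -> : x \in \bigcup_k F k by apply/mem_set; exists k.
        by rewrite subrr mul0r nrm0.
      apply: nearW => n; rewrite -mulrBl /cind !indicE.
      have -> : (x \in \big[setU/set0]_(i < n) F i) = false.
        apply/negbTE; rewrite notin_setE -bigcup_mkord => -[k _ Fk]; apply: nF.
        by exists k.
      have -> : (x \in \bigcup_k F k) = false by apply/negbTE; rewrite notin_setE.
      by rewrite subrr mul0r nrm0.
    + exact: cintable_nrm.
    + by move=> n x; rewrite nrmM ler_piMl ?nrm_ge0// nrm_cind.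
  move: C; under eq_fun do rewrite U0 sub0r nrmN.
  move=> /(cvg_unique _ (cvg_cst _)) E.
  by apply: nrm_eq0; apply: E; exact: norm_hausdorff.
Unshelve. all: by end_near. Qed.

(** The integrals of H over quadrants vanish, as limits of integrals against
    averages of Gaussians; by Dynkin's theorem so do the integrals over all
    measurable sets. *)
Lemma gauss_null : {ae mu2, forall x, H x = 0}.
Proof.
have P (p : R[i] -> R) : measurable_fun setT (fun x => p (H x)) ->
   mu2.-integrable setT (fun x => (p (H x))%:E) ->
   (forall A, measurable A -> Rintegral mu2 setT (fun x => \1_A x * p (H x)) = 0) ->
   {ae mu2, forall x, p (H x) = 0}.
  move=> mp Ip p0.
  have : ae_eq mu2 setT (fun x => (p (H x))%:E) (cst 0%E).
    apply: integral_ae_eq => // E _ mE; rewrite integral0.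
    have IE : mu2.-integrable E (fun x => (p (H x))%:E) by exact: integrableS Ip.
    rewrite -[LHS]fineK; last exact: integrable_fin_num.
    congr EFin; rewrite -[RHS](p0 E mE) /Rintegral integral_mkcond; congr fine.
    apply: eq_integral => x _; rewrite patchE indicE.
    by case: ifPn => _; rewrite ?mul1r ?mul0r.
  by apply: filterS => x /(_ I) [].
have [mr mi] := cintable_meas IH; have [Ir Ii] := IH.
have Pr : {ae mu2, forall x, complex.Re (H x) = 0}.
  apply: P => // A mA; have /(congr1 (@complex.Re R)) /= := all0 mA.
  by move=> <-; apply: eq_Rintegral => x _; rewrite cReM /= mul0r subr0.
have Pi : {ae mu2, forall x, complex.Im (H x) = 0}.
  apply: P => // A mA; have /(congr1 (@complex.Im R)) /= := all0 mA.
  by move=> <-; apply: eq_Rintegral => x _; rewrite cImM /= mul0r addr0.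
by apply: filterS2 Pr Pi => x r i; exact: complex_ext.
Qed.

End Uniqueness.

(** * The Fourier transform of integrable functions *)

Arguments Normc.normc {R} x : simpl never.
Arguments cintg : simpl never.
Arguments Defs.fourier : simpl never.
Arguments Defs.ifourier : simpl never.
Arguments expi : simpl never.

Section FourierL1.
Context (R : realType).
Notation mR := (measurableTypeR R).
Notation mplane := (mR * mR)%type.
Notation mu2 := (@plane_mu R).
Implicit Types f g k u w : mplane -> R[i].

Definition N2 f : \bar R := (\int[mu2]_x (nrm (f x) ^+ 2)%:E)%E.

Definition inL2 f := cmeas f /\ (N2 f < +oo)%E.

Definition inL12 k := cintable mu2 k /\ (N2 k < +oo)%E.

Lemma N2_ge0 f : (0 <= N2 f)%E.
Proof. by apply: integral_ge0 => x _; rewrite lee_fin sqr_ge0. Qed.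

Lemma inL12_L2 k : inL12 k -> inL2 k.
Proof. by move=> [/cintable_meas mk Nk]; split. Qed.

Lemma measurable_N2 f : cmeas f ->
  measurable_fun setT (fun x => (nrm (f x) ^+ 2)%:E).
Proof. by move=> mf; apply/measurable_EFinP; exact: measurable_nrm2. Qed.

Lemma eq_N2 f g : (forall x, nrm (f x) = nrm (g x)) -> N2 f = N2 g.
Proof. by move=> fg; apply: eq_integral => x _; rewrite fg. Qed.

Lemma le_N2 f g : cmeas f -> cmeas g -> (forall x, nrm (f x) <= nrm (g x)) ->
  (N2 f <= N2 g)%E.
Proof.
move=> mf mg fg; apply: ge0_le_integral => //.
- by move=> x _; rewrite lee_fin sqr_ge0.
- exact: measurable_N2.
- exact: measurable_N2.
- by move=> x _; rewrite lee_fin ler_sqr ?nnegrE ?nrm_ge0.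
Qed.

Lemma ae_eq_N2 f g : cmeas f -> cmeas g -> {ae mu2, forall x, f x = g x} ->
  N2 f = N2 g.
Proof.
move=> mf mg fg; apply: ae_eq_integral => //; try exact: measurable_N2.
by apply: filterS fg => x /= ->.
Qed.

Lemma N2Z (c : R[i]) f : cmeas f ->
  N2 (fun x => c * f x) = ((nrm c ^+ 2)%:E * N2 f)%E.
Proof.
move=> mf; rewrite /N2 -ge0_integralZl ?lee_fin ?sqr_ge0//; last 2 first.
- exact: measurable_N2.
- by move=> x _; rewrite lee_fin sqr_ge0.
by apply: eq_integral => x _; rewrite nrmM exprMn EFinM.
Qed.

Lemma N2J f : N2 (fun x => conjc (f x)) = N2 f.
Proof. by apply: eq_N2 => x; rewrite nrmJ. Qed.

Lemma N2N f : N2 (fun x => - f x) = N2 f.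
Proof. by apply: eq_N2 => x; rewrite nrmN. Qed.

Lemma N2D f g : cmeas f -> cmeas g ->
  (N2 (fun x => (f x + g x)%R) <= 2%:E * N2 f + 2%:E * N2 g)%E.
Proof.
move=> mf mg.
have m1 := measurable_N2 mf; have m2 := measurable_N2 mg.
rewrite /N2 -!ge0_integralZl ?lee_fin//; try by move=> x _; rewrite lee_fin sqr_ge0.
rewrite -ge0_integralD//; last 4 first.
- by move=> x _; rewrite -EFinM lee_fin mulr_ge0 ?sqr_ge0.
- exact: emeasurable_funM.
- by move=> x _; rewrite -EFinM lee_fin mulr_ge0 ?sqr_ge0.
- exact: emeasurable_funM.
apply: ge0_le_integral => //.
- by move=> x _; rewrite lee_fin sqr_ge0.
- by apply: measurable_N2; exact: cmeasD.
- by apply: emeasurable_funD; exact: emeasurable_funM.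
- by move=> x _; rewrite -!EFinM -EFinD lee_fin nrm_sqrD.
Qed.

Lemma N2B f g : cmeas f -> cmeas g ->
  (N2 (fun x => (f x - g x)%R) <= 2%:E * N2 f + 2%:E * N2 g)%E.
Proof.
move=> mf mg; rewrite -(N2N g); apply: N2D => //; exact: cmeasN.
Qed.

Lemma inL2D f g : inL2 f -> inL2 g -> inL2 (fun x => f x + g x).
Proof.
move=> [mf Nf] [mg Ng]; split; first exact: cmeasD.
apply: le_lt_trans (N2D mf mg) _.
by rewrite lte_add_pinfty// lte_mul_pinfty.
Qed.

Lemma inL2B f g : inL2 f -> inL2 g -> inL2 (fun x => f x - g x).
Proof.
move=> [mf Nf] [mg Ng]; split; first exact: cmeasB.
apply: le_lt_trans (N2B mf mg) _.
by rewrite lte_add_pinfty// lte_mul_pinfty.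
Qed.

Lemma inL2J f : inL2 f -> inL2 (fun x => conjc (f x)).
Proof. by move=> [mf Nf]; split; [exact: cmeasJ|rewrite N2J]. Qed.

Lemma inL12J f : inL12 f -> inL12 (fun x => conjc (f x)).
Proof. by move=> [mf Nf]; split; [exact: cintableJ|rewrite N2J]. Qed.

Lemma inL12B f g : inL12 f -> inL12 g -> inL12 (fun x => f x - g x).
Proof.
move=> If Ig; split; last by have [] := inL2B (inL12_L2 If) (inL12_L2 Ig).
by apply: cintableB; [have [] := If|have [] := Ig].
Qed.

Lemma N2_pairing f g : cmeas f -> cmeas g ->
  ((\int[mu2]_x (nrm (f x) * nrm (g x))%:E) *
   (\int[mu2]_x (nrm (f x) * nrm (g x))%:E) <= N2 f * N2 g)%E.
Proof.
move=> mf mg; apply: cauchy_schwarz; try exact: measurable_nrm.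
  by move=> x; exact: nrm_ge0.
by move=> x; exact: nrm_ge0.
Qed.

Lemma cintableM_L2 f g : inL2 f -> inL2 g -> cintable mu2 (fun x => f x * g x).
Proof.
move=> [mf Nf] [mg Ng]; apply: cintableP; first exact: cmeasM.
under eq_integral do rewrite nrmM.
have := N2_pairing mf mg.
case: (\int[mu2]_x _)%E => [r||]//; first by rewrite ltry.
rewrite mulyy leye_eq => /eqP E.
by have := lte_mul_pinfty (N2_ge0 f) _ Ng; rewrite ge0_fin_numE ?N2_ge0// Nf => /(_ isT); rewrite E.
Qed.

Lemma nrm_cintgM_le f g : inL2 f -> inL2 g ->
  ((nrm (cintg mu2 (fun x => f x * g x)) ^+ 2)%:E <= N2 f * N2 g)%E.
Proof.
move=> Lf Lg; have [[mf _] [mg _]] := (Lf, Lg).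
have I := cintableM_L2 Lf Lg.
apply: le_trans (N2_pairing mf mg); rewrite expr2 EFinM.
have := nrm_cintg_le I; under eq_integral do rewrite nrmM.
by move=> H; apply: lee_pmul => //; rewrite lee_fin nrm_ge0.
Qed.

Notation fourier := (@fourier R).

Let measurable_dotp2 : measurable_fun setT (fun z : mplane * mplane => dotp z.1 z.2).
Proof.
by apply: measurable_funD; apply: measurable_funM; exact: measurableT_comp.
Qed.

Lemma cmeas_expi2 : cmeas (fun z : mplane * mplane => expi (- dotp z.1 z.2)).
Proof. by apply: cmeas_expi; exact: measurable_funN. Qed.

Lemma dotpC (x y : R * R) : dotp x y = dotp y x.
Proof. by rewrite /dotp; ring. Qed.

Lemma cmeas_fourier k : cmeas k -> cmeas (fourier k).
Proof.
move=> mk.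
have := @cmeas_partial_cintg _ _ mplane mplane R mu2
  (fun z => k z.2 * expi (- dotp z.2 z.1)); apply.
apply: cmeasM; first exact: (cmeas_comp mk measurable_snd).
under eq_fun do rewrite dotpC; exact: cmeas_expi2.
Qed.

Lemma cmeas_char (xi : mplane) : cmeas (fun x : mplane => expi (- dotp x xi)).
Proof. by apply: cmeas_expi; apply: measurable_funN; exact: measurable_dotp. Qed.

Lemma cintable_char k xi : cintable mu2 k ->
  cintable mu2 (fun x => k x * expi (- dotp x xi)).
Proof.
move=> Ik; apply: (cintable_le _ _ (cintable_nrm Ik)).
  by apply: cmeasM; [exact: cintable_meas Ik|exact: cmeas_char].
by move=> x; rewrite nrmM nrm_expi mulr1.
Qed.

Definition N1 k : R := Rintegral mu2 setT (fun x => nrm (k x)).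

Lemma nrm_fourier_le k xi : cintable mu2 k -> nrm (fourier k xi) <= N1 k.
Proof.
move=> Ik; have := nrm_cintg_le (cintable_char xi Ik).
under eq_integral do rewrite nrmM nrm_expi mulr1.
rewrite -lee_fin /N1 /Rintegral fineK//.
exact: (integrable_fin_num measurableT (cintable_nrm Ik)).
Qed.

Lemma fourierB k l xi : cintable mu2 k -> cintable mu2 l ->
  fourier (fun x => k x - l x) xi = fourier k xi - fourier l xi.
Proof.
move=> Ik Il; rewrite /Defs.fourier !cintE -cintgB; [|exact: cintable_char..].
by apply: eq_cintg => x; rewrite mulrBl.
Qed.

(** Fubini's theorem: the kernel expi (- x y) is symmetric. *)
Lemma fourier_duality k phi : cintable mu2 k -> cintable mu2 phi ->
  cintg mu2 (fun x => k x * fourier phi x) =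
  cintg mu2 (fun x => fourier k x * phi x).
Proof.
move=> Ik Ip.
pose Phi (z : mplane * mplane) := k z.1 * (phi z.2 * expi (- dotp z.2 z.1)).
have IPhi : cintable (mu2 \x mu2)%E Phi.
  apply: (@cintable_prodM _ _ mplane mplane R mu2 mu2 Phi (fun x => nrm (k x)) (fun y => nrm (phi y))).
  - apply: cmeasM; first exact: (cmeas_comp (cintable_meas Ik) measurable_fst).
    apply: cmeasM; first exact: (cmeas_comp (cintable_meas Ip) measurable_snd).
    under eq_fun do rewrite dotpC; exact: cmeas_expi2.
  - by move=> x y; rewrite !nrmM nrm_expi mulr1.
  - by move=> x; exact: nrm_ge0.
  - by move=> x; exact: nrm_ge0.
  - exact: cintable_nrm.
  - exact: cintable_nrm.
transitivity (cintg mu2 (fun x => cintg mu2 (fun y => Phi (x, y)))).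
  by apply: eq_cintg => x; rewrite -cintgZ//; exact: cintable_char.
rewrite (cfubini IPhi); apply: eq_cintg => y.
rewrite [RHS]mulrC -cintgZ; last exact: cintable_char.
by apply: eq_cintg => x; rewrite /Phi /= mulrCA dotpC.
Qed.

End FourierL1.

Section Plancherel.
Context (R : realType).
Notation mR := (measurableTypeR R).
Notation mplane := (mR * mR)%type.
Notation mu2 := (@plane_mu R).
Notation fourier := (@fourier R).
Variable k : mplane -> R[i].
Hypothesis Ik : cintable mu2 k.

Let mk : cmeas k := cintable_meas Ik.

(** The Fourier transform of exp (- e |y|^2) at b - a. *)
Let heat (e : R) (a b : mplane) : R := pi / e * gau2 (1 / (4 * e)) b a.

(** Writing |k^|^2 as a double integral and integrating in y first, which the
    Gaussian factor makes absolutely convergent, produces the heat kernel. *)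
Let quad e : 0 < e ->
  cintg mu2 (fun y => real_complex R (nrm (fourier k y) ^+ 2 * gau2 e 0 y)) =
  cintg mu2 (fun b => conjc (k b) *
    cintg mu2 (fun a => k a * real_complex R (heat e a b))).
Proof.
move=> e0.
have mF := cmeas_fourier mk.
pose Psi (z : mplane * mplane) :=
  (real_complex R (gau2 e 0 z.1) * fourier k z.1) * (conjc (k z.2) * expi (dotp z.2 z.1)).
have IPsi : cintable (mu2 \x mu2)%E Psi.
  apply: (@cintable_prodM _ _ mplane mplane R mu2 mu2 Psi (fun y => N1 k * gau2 e 0 y) (fun b => nrm (k b))).
  - apply: cmeasM.
      apply: cmeasM; last exact: (cmeas_comp mF measurable_fst).
      by apply: cmeas_real; exact: (measurableT_comp (@measurable_gau2 R e 0) measurable_fst).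
    apply: cmeasM; first exact: (cmeas_comp (cmeasJ mk) measurable_snd).
    apply: cmeas_expi.
    by apply: measurable_funD; apply: measurable_funM; exact: measurableT_comp.
  - move=> y b; rewrite !nrmM nrmJ nrm_expi mulr1 nrm_real ger0_norm ?gau2_ge0//.
    rewrite ler_wpM2r ?nrm_ge0// mulrC ler_wpM2r ?gau2_ge0//.
    exact: nrm_fourier_le.
  - move=> y; rewrite mulr_ge0 ?gau2_ge0//.
    by apply: Rintegral_ge0 => x _; exact: nrm_ge0.
  - by move=> b; exact: nrm_ge0.
  - under eq_fun do rewrite EFinM; apply: integrableZl => //; exact: integrable_gau2.
  - exact: cintable_nrm.
transitivity (cintg mu2 (fun y => cintg mu2 (fun b => Psi (y, b)))).
  apply: eq_cintg => y; rewrite /Psi /= cintgZ; last first.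
    apply: (cintable_le _ _ (cintable_nrm Ik)).
      apply: cmeasM; first exact: cmeasJ.
      by apply: cmeas_expi; exact: measurable_dotp.
    by move=> b; rewrite nrmM nrmJ nrm_expi mulr1.
  have -> : cintg mu2 (fun b => conjc (k b) * expi (dotp b y)) = conjc (fourier k y).
    rewrite /Defs.fourier cintE -cintgJ; last exact: cintable_char.
    by apply: eq_cintg => b; rewrite conjM expiN conjcK.
  by rewrite rcM -mulJ_nrm; ring.
rewrite (cfubini IPsi); apply: eq_cintg => b.
pose Xi (z : mplane * mplane) := k z.2 * gchar e 0 (b.1 - z.2.1, b.2 - z.2.2) z.1.
have IXi : cintable (mu2 \x mu2)%E Xi.
  apply: (@cintable_prodM _ _ mplane mplane R mu2 mu2 Xi (gau2 e 0) (fun a => nrm (k a))).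
  - apply: cmeasM; first exact: (cmeas_comp mk measurable_snd).
    apply: cmeasM.
      by apply: cmeas_real; exact: (measurableT_comp (@measurable_gau2 R e 0) measurable_fst).
    apply: cmeas_expi; rewrite /dotp /=.
    by apply: measurable_funD; apply: measurable_funM;
      do ?[exact: measurableT_comp|apply: measurable_funB => //].
  - by move=> y a; rewrite nrmM nrm_gchar mulrC.
  - by move=> y; exact: gau2_ge0.
  - by move=> a; exact: nrm_ge0.
  - exact: integrable_gau2.
  - exact: cintable_nrm.
transitivity (conjc (k b) * cintg mu2 (fun y => cintg mu2 (fun a => Xi (y, a)))).
  rewrite -cintgZ.
    apply: eq_cintg => y; rewrite /Psi /Xi /=.
    transitivity (conjc (k b) * real_complex R (gau2 e 0 y) * expi (dotp b y) * fourier k y).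
      by ring.
    rewrite -!mulrA; congr (_ * _); rewrite !mulrA /Defs.fourier cintE -cintgZ; last exact: cintable_char.
    apply: eq_cintg => a; rewrite /gchar.
    rewrite (_ : dotp y _ = dotp b y + - dotp a y); last by rewrite /dotp /=; ring.
    by rewrite expiD; ring.
  exact: (cintable_partial IXi).
rewrite (cfubini IXi); congr (_ * _); apply: eq_cintg => a.
rewrite /Xi /= cintgZ; last exact: cintable_gchar.
rewrite cintg_gchar// /heat; congr (_ * _).
rewrite (_ : dotp 0 _ = 0) ?expi0 ?mulr1; last by rewrite /dotp /= !mul0r addr0.
by congr (real_complex R (_ * expR _)); rewrite /dotp /=; field; rewrite gt_eqF.
Qed.

Hypothesis k2 : (N2 k < +oo)%E.

Let c4 : R := 4 * pi ^+ 2.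

Let heat_mass (e : R) (b : mplane) : 0 < e ->
  (\int[mu2]_a (heat e a b)%:E = c4%:E)%E.
Proof.
move=> e0; have pe : 0 <= pi / e by rewrite divr_ge0 ?pi_ge0// ltW.
rewrite /heat; under eq_integral do rewrite EFinM.
rewrite ge0_integralZl ?lee_fin//; last 2 first.
- by apply/measurable_EFinP; exact: measurable_gau2.
- by move=> x _; rewrite lee_fin gau2_ge0.
rewrite integral_gau2; last by rewrite divr_gt0// mulr_gt0.
by rewrite -EFinM; congr EFin; rewrite /c4; field; rewrite gt_eqF.
Qed.

Let heat_ge0 e a b : 0 < e -> 0 <= heat e a b.
Proof. by move=> e0; rewrite mulr_ge0 ?gau2_ge0// divr_ge0 ?pi_ge0// ltW. Qed.

Let heat_sym e a b : heat e a b = heat e b a.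
Proof. by rewrite /heat gau2_sym. Qed.

(** By |k a| |k b| <= (|k a|^2 + |k b|^2) / 2 and symmetry the double integral is
    at most the mass of the heat kernel times the integral of |k|^2. *)
Let quad_le e : 0 < e ->
  (\int[mu2]_y (nrm (fourier k y) ^+ 2 * gau2 e 0 y)%:E <= c4%:E * N2 k)%E.
Proof.
move=> e0.
have mF := cmeas_fourier mk.
have mheat : measurable_fun setT (fun z : mplane * mplane => heat e z.2 z.1).
  by apply: measurable_funM => //; exact: measurable_gau22.
have mheatx b : measurable_fun setT (fun a => heat e a b).
  by apply: measurable_funM => //; exact: measurable_gau2.
have c40 : 0 <= c4 by rewrite mulr_ge0// sqr_ge0.
have Iheat b : cintable mu2 (fun a => k a * real_complex R (heat e a b)).
  apply: (cintable_le (g := fun a => pi / e * nrm (k a))).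
  - by apply: cmeasM => //; exact: cmeas_real.
  - move=> a; rewrite nrmM nrm_real ger0_norm ?heat_ge0// mulrC ler_wpM2r ?nrm_ge0//.
    rewrite ler_piMr//; first by rewrite divr_ge0 ?pi_ge0// ltW.
    by rewrite gau2_le1// divr_ge0// mulr_ge0// ltW.
  - by under eq_fun do rewrite EFinM; apply: integrableZl => //; exact: cintable_nrm.
have Lfin : cintable mu2 (fun y => real_complex R (nrm (fourier k y) ^+ 2 * gau2 e 0 y)).
  have Ig : mu2.-integrable setT (fun y => (N1 k ^+ 2 * gau2 e 0 y)%:E).
    by under eq_fun do rewrite EFinM; apply: integrableZl => //; exact: integrable_gau2.
  apply: (cintable_le _ _ Ig).
  - apply: cmeas_real; apply: measurable_funM; first exact: measurable_nrm2.
    exact: measurable_gau2.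
  - move=> y; rewrite nrm_real ger0_norm; last first.
      by apply: mulr_ge0; [exact: sqr_ge0|exact: gau2_ge0].
    have nk := nrm_fourier_le y Ik.
    have n0 : 0 <= N1 k by apply: le_trans nk; exact: nrm_ge0.
    by rewrite ler_wpM2r ?gau2_ge0// ler_pXn2r// nnegrE ?nrm_ge0.
have Q := quad e0; rewrite cintg_real in Q.
have Lint : mu2.-integrable setT (fun y => (nrm (fourier k y) ^+ 2 * gau2 e 0 y)%:E).
  by have [] := Lfin.
rewrite -(fineK (integrable_fin_num measurableT Lint)).
rewrite -[fine _]/(Rintegral mu2 setT (fun y => nrm (fourier k y) ^+ 2 * gau2 e 0 y)).
rewrite -[Rintegral _ _ _]ger0_norm; last first.
  by apply: Rintegral_ge0 => y _; rewrite mulr_ge0 ?sqr_ge0 ?gau2_ge0.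
rewrite -nrm_real Q.
have mB : cmeas (fun b => conjc (k b) * cintg mu2 (fun a => k a * real_complex R (heat e a b))).
  apply: cmeasM; first exact: cmeasJ.
  apply: (@cmeas_partial_cintg _ _ mplane mplane R mu2
    (fun z => k z.2 * real_complex R (heat e z.2 z.1))).
  by apply: cmeasM; [exact: (cmeas_comp mk measurable_snd)|exact: cmeas_real].
pose D (z : mplane * mplane) : \bar R :=
  ((nrm (k z.1) ^+ 2 * heat e z.2 z.1)%:E + (nrm (k z.2) ^+ 2 * heat e z.2 z.1)%:E)%E.
have mD1 : measurable_fun setT (fun z : mplane * mplane => (nrm (k z.1) ^+ 2 * heat e z.2 z.1)%:E).
  apply/measurable_EFinP; apply: measurable_funM => //.
  exact: (measurableT_comp (measurable_nrm2 mk) measurable_fst).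
have mD2 : measurable_fun setT (fun z : mplane * mplane => (nrm (k z.2) ^+ 2 * heat e z.2 z.1)%:E).
  apply/measurable_EFinP; apply: measurable_funM => //.
  exact: (measurableT_comp (measurable_nrm2 mk) measurable_snd).
have mD : measurable_fun setT D by exact: emeasurable_funD.
have I1 : (\int[mu2]_b \int[mu2]_a (nrm (k b) ^+ 2 * heat e a b)%:E = c4%:E * N2 k)%E.
  rewrite /N2 -ge0_integralZl ?lee_fin//; last 2 first.
  - exact: measurable_N2.
  - by move=> x _; rewrite lee_fin sqr_ge0.
  apply: eq_integral => b _; under eq_integral do rewrite EFinM.
  rewrite ge0_integralZl ?lee_fin ?sqr_ge0//; last 2 first.
  - exact/measurable_EFinP.
  - by move=> a _; rewrite lee_fin heat_ge0.
  by rewrite heat_mass// muleC.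
have I2 : (\int[mu2]_b \int[mu2]_a (nrm (k a) ^+ 2 * heat e a b)%:E = c4%:E * N2 k)%E.
  have F := @fubini_tonelli _ _ mplane mplane R mu2 mu2 _ mD2.
  etransitivity; first by apply: F => z; rewrite lee_fin mulr_ge0 ?sqr_ge0 ?heat_ge0.
  by rewrite -I1; apply: eq_integral => b _; apply: eq_integral => a _; rewrite heat_sym.
have ID : (\int[mu2]_b \int[mu2]_a D (b, a) = c4%:E * N2 k + c4%:E * N2 k)%E.
  rewrite -{1}I1 -I2 -ge0_integralD//; last 4 first.
  - by move=> b _; apply: integral_ge0 => a _; rewrite lee_fin mulr_ge0 ?sqr_ge0 ?heat_ge0.
  - exact: (@measurable_partial_integral _ _ mplane mplane R mu2 (fun z => (nrm (k z.1) ^+ 2 * heat e z.2 z.1)%:E)).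
  - by move=> b _; apply: integral_ge0 => a _; rewrite lee_fin mulr_ge0 ?sqr_ge0 ?heat_ge0.
  - exact: (@measurable_partial_integral _ _ mplane mplane R mu2 (fun z => (nrm (k z.2) ^+ 2 * heat e z.2 z.1)%:E)).
  apply: eq_integral => b _; rewrite ge0_integralD//.
  - by move=> a _; rewrite lee_fin mulr_ge0 ?sqr_ge0 ?heat_ge0.
  - exact: (measurableT_comp mD1 (measurable_pair1 b)).
  - by move=> a _; rewrite lee_fin mulr_ge0 ?sqr_ge0 ?heat_ge0.
  - exact: (measurableT_comp mD2 (measurable_pair1 b)).
have E2 : (\int[mu2]_b \int[mu2]_a ((2^-1)%:E * D (b, a)) = c4%:E * N2 k)%E.
  under eq_integral => b _.
    rewrite ge0_integralZl ?lee_fin//; last 2 first.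
    - exact: (measurableT_comp mD (measurable_pair1 b)).
    - by move=> a _; rewrite adde_ge0// lee_fin mulr_ge0 ?sqr_ge0 ?heat_ge0.
    over.
  rewrite ge0_integralZl ?lee_fin//; last 2 first.
  - exact: (@measurable_partial_integral _ _ mplane mplane R mu2 D).
  - by move=> b _; apply: integral_ge0 => a _; rewrite adde_ge0// lee_fin mulr_ge0 ?sqr_ge0 ?heat_ge0.
  rewrite ID; have := k2; have := N2_ge0 k; case: (N2 k) => // r _ _.
  by rewrite -(EFinM c4) -EFinD -EFinM; congr EFin; field.
have Hb b : ((nrm (conjc (k b) * cintg mu2 (fun a => k a * real_complex R (heat e a b))))%:E <=
    \int[mu2]_a ((2^-1)%:E * D (b, a)))%E.
  rewrite nrmM nrmJ EFinM.
  apply: (@le_trans _ _ ((nrm (k b))%:E * \int[mu2]_a (nrm (k a * real_complex R (heat e a b)))%:E)%E).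
    by rewrite lee_wpmul2l ?lee_fin ?nrm_ge0// nrm_cintg_le.
  rewrite -ge0_integralZl ?lee_fin ?nrm_ge0//; last 2 first.
  - by apply/measurable_EFinP; apply: measurable_nrm; have [] := cintable_meas (Iheat b).
  - by move=> a _; rewrite lee_fin nrm_ge0.
  apply: ge0_le_integral => //.
  - by move=> a _; rewrite mule_ge0 ?lee_fin ?nrm_ge0.
  - by apply: emeasurable_funM => //; apply/measurable_EFinP; apply: measurable_nrm; exact: cintable_meas (Iheat b).
  - apply: emeasurable_funM => //; exact: (measurableT_comp mD (measurable_pair1 b)).
  move=> a _; rewrite /D /= -EFinD -!EFinM lee_fin nrmM nrm_real ger0_norm ?heat_ge0//.
  rewrite mulrA -mulrDl [leRHS]mulrA; apply: ler_wpM2r; first exact: heat_ge0.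
  by have := sqr_ge0 (nrm (k b) - nrm (k a)); nra.
have IB : cintable mu2 (fun b => conjc (k b) * cintg mu2 (fun a => k a * real_complex R (heat e a b))).
  apply: cintableP => //; apply: (@le_lt_trans _ _ (c4%:E * N2 k)%E).
    rewrite -E2; apply: ge0_le_integral => //.
    - by move=> b _; rewrite lee_fin nrm_ge0.
    - by apply/measurable_EFinP; exact: measurable_nrm.
    - apply: (@measurable_partial_integral _ _ mplane mplane R mu2 (fun z => (2^-1)%:E * D z)%E).
      exact: emeasurable_funM.
  by rewrite lte_mul_pinfty// ge0_fin_numE ?lee_fin// ltry.
apply: le_trans (nrm_cintg_le IB) _; rewrite -E2; apply: ge0_le_integral => //.
- by move=> b _; rewrite lee_fin nrm_ge0.
- by apply/measurable_EFinP; exact: measurable_nrm.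
- apply: (@measurable_partial_integral _ _ mplane mplane R mu2 (fun z => (2^-1)%:E * D z)%E).
  exact: emeasurable_funM.
Qed.

(** The Gaussian factor is removed by letting its parameter tend to 0; the mass
    of the heat kernel is independent of that parameter. *)
Lemma plancherel_le : (N2 (fourier k) <= (4 * pi ^+ 2)%:E * N2 k)%E.
Proof.
have mF := cmeas_fourier mk.
pose h (n : nat) (y : mplane) := (nrm (fourier k y) ^+ 2 * gau2 n.+1%:R^-1 0 y)%:E.
have mh n : measurable_fun setT (h n).
  apply/measurable_EFinP; apply: measurable_funM; first exact: measurable_nrm2.
  exact: measurable_gau2.
have h0 n y : (0 <= h n y)%E by rewrite lee_fin mulr_ge0 ?sqr_ge0 ?gau2_ge0.
have hl y : h ^~ y @ \oo --> (nrm (fourier k y) ^+ 2)%:E.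
  apply: cvg_EFin; first by apply: nearW.
  rewrite -[X in _ --> X]mulr1; apply: cvgM; first exact: cvg_cst.
  rewrite -[X in _ --> X](expR0 R) -[X in expR X](oppr0) -(mul0r ((y.1 - 0) ^+ 2 + (y.2 - 0) ^+ 2)).
  apply: (@cvg_comp _ _ _ (fun n : nat => - (n.+1%:R^-1 * ((y.1 - 0) ^+ 2 + (y.2 - 0) ^+ 2))) expR);
    last exact: continuous_expR.
  by apply: cvgN; apply: cvgM; [exact: cvg_harmonic|exact: cvg_cst].
apply: (@fatou_bound _ _ _ mu2 h (fun y => (nrm (fourier k y) ^+ 2)%:E)) => //.
- exact: measurable_N2.
- by move=> y; rewrite lee_fin sqr_ge0.
- exact: aeW.
- by move=> n; apply: quad_le; rewrite invr_gt0.
Qed.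

End Plancherel.

Section RieszFischer.
Context (R : realType).
Notation mR := (measurableTypeR R).
Notation mplane := (mR * mR)%type.
Notation mu2 := (@plane_mu R).
Implicit Types f g k u w : mplane -> R[i].

(** The sum of the 4^j |w_(j+1) - w_j|^2 is integrable, hence finite almost
    everywhere, so that the increments are O(2^-j) there.  The limit is taken as a
    limsup to be measurable everywhere. *)
Lemma rapid_cvg (w_ : nat -> mplane -> R[i]) (C : R) :
  (forall j, cmeas (w_ j)) ->
  (forall j, N2 (fun x => (w_ j.+1 x - w_ j x)%R) <= (C * (1 / 8) ^+ j)%:E)%E ->
  exists2 w, cmeas w & {ae mu2, forall x, (fun j => nrm (w_ j x - w x)) @ \oo --> (0 : R)}.
Proof.
move=> mw Hw.
pose d j x := nrm (w_ j.+1 x - w_ j x) ^+ 2.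
have md j : measurable_fun setT (fun x => (4 ^+ j * d j x)%:E).
  by apply/measurable_EFinP; apply: measurable_funM => //; apply: measurable_nrm2; exact: cmeasB.
have d0 j x : (0 <= (4 ^+ j * d j x)%:E)%E.
  by rewrite lee_fin mulr_ge0 ?sqr_ge0// exprn_ge0.
pose S x := (\sum_(j <oo) (4 ^+ j * d j x)%:E)%E.
have IS : (\int[mu2]_x S x < +oo)%E.
  rewrite integral_nneseries//.
  apply: (@le_lt_trans _ _ (\sum_(j <oo) (C * (1 / 2) ^+ j)%:E)%E).
    apply: lee_nneseries; first by move=> *; apply: integral_ge0 => x _; exact: d0.
    move=> j *.
    under eq_integral do rewrite EFinM.
    rewrite ge0_integralZl ?lee_fin ?exprn_ge0//; last 2 first.
    - by apply/measurable_EFinP; apply: measurable_nrm2; exact: cmeasB.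
    - by move=> x _; rewrite lee_fin sqr_ge0.
    apply: (@le_trans _ _ ((4 ^+ j)%:E * (C * (1 / 8) ^+ j)%:E)%E).
      by rewrite lee_wpmul2l ?lee_fin ?exprn_ge0//; exact: Hw.
    rewrite -EFinM lee_fin mulrCA -exprMn; rewrite (_ : 4 * (1 / 8) = 1 / 2)//; lra.
  rewrite (_ : (\sum_(j <oo) _)%E = (C * 2)%:E) ?ltry//; apply/cvg_lim => //.
  have G : series (geometric C (1 / 2)) @ \oo --> C * 2.
    rewrite (_ : C * 2 = C * (1 - 1 / 2)^-1); last by field.
    by apply: cvg_geometric_series; rewrite ger0_norm; lra.
  rewrite (_ : (fun n => _) = EFin \o series (geometric C (1 / 2))).
    by apply: cvg_EFin => //; apply: nearW.
  by apply/funext => n; rewrite /= sumEFin.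
have [S0 mS] : (forall x, 0 <= S x)%E /\ measurable_fun setT S.
  split; first by move=> x; apply: nneseries_ge0 => j _ _; exact: d0.
  by apply: ge0_emeasurable_sum => //.
have aeS : {ae mu2, forall x, S x \is a fin_num}.
  have IS' : mu2.-integrable setT S.
    apply/integrableP; split => //.
    by under eq_integral do rewrite gee0_abs//.
  by have := integrable_ae measurableT IS'; apply: filterS => x /(_ I).
pose w x : R[i] := Complex (fine (limn_esup (fun j => (complex.Re (w_ j x))%:E)))
   (fine (limn_esup (fun j => (complex.Im (w_ j x))%:E))).
exists w.
  split => /=.
    apply: (measurableT_comp (f := fine)) => //; apply: measurable_fun_limn_esup => j.
    by apply/measurable_EFinP; have [] := mw j.
  apply: (measurableT_comp (f := fine)) => //; apply: measurable_fun_limn_esup => j.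
  by apply/measurable_EFinP; have [] := mw j.
apply: filterS aeS => x Sx.
have dS j : nrm (w_ j.+1 x - w_ j x) <= Num.sqrt (fine (S x)) * (1 / 2) ^+ j.
  have : ((4 ^+ j * d j x)%:E <= S x)%E.
    apply: le_trans (nneseries_lim_ge j.+1 _); last by move=> n _ _; exact: d0.
    rewrite big_mkord big_ord_recr /= leeDr// sume_ge0// => i _; exact: d0.
  rewrite -(fineK Sx) lee_fin => H.
  have fS : 0 <= fine (S x) by rewrite fine_ge0.
  rewrite -ler_sqr ?nnegrE ?nrm_ge0// ?mulr_ge0 ?sqrtr_ge0 ?exprn_ge0//.
  rewrite exprMn sqr_sqrtr// -exprM mulnC exprM.
  rewrite (_ : (1 / 2) ^+ 2 = 4^-1); last by field.
  by rewrite exprVn ler_pdivlMr ?exprn_gt0// mulrC.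
have cv (p : R[i] -> R) : (forall z, `|p z| <= nrm z) ->
    (forall z z', p (z - z') = p z - p z') -> cvgn (fun j => p (w_ j x)).
  move=> pn pB; pose u j := p (w_ j x).
  have cu : cvgn (series (telescope u)).
    apply: normed_cvg; apply: (@series_le_cvg _ _ (geometric (Num.sqrt (fine (S x))) (1 / 2))).
    - by move=> j; rewrite normr_ge0.
    - by move=> j; rewrite mulr_ge0 ?sqrtr_ge0// exprn_ge0.
    - move=> j; apply: le_trans (dS j).
      by change (`|p (w_ j.+1 x) - p (w_ j x)| <= nrm (w_ j.+1 x - w_ j x)); rewrite -pB.
    - by apply: is_cvg_geometric_series; rewrite ger0_norm; lra.
  have -> : (fun j => p (w_ j x)) = (fun j => series (telescope u) j + u 0).
    by apply/funext => j; rewrite telescopeK subrK.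
  by apply: is_cvgD => //; exact: is_cvg_cst.
have [c1 c2] : cvgn (fun j => complex.Re (w_ j x)) /\ cvgn (fun j => complex.Im (w_ j x)).
  split; first by apply: cv => [z|z z']; [exact: Re_le_nrm|rewrite cReD cReN].
  by apply: cv => [z|z z']; [exact: Im_le_nrm|rewrite cImD cImN].
have lE (s : nat -> R) : cvgn s -> fine (limn_esup (fun j => (s j)%:E)) = limn s.
  move=> cs.
  have cE : (fun j => (s j)%:E) @ \oo --> (limn s)%:E.
    by apply: cvg_EFin => //; apply: nearW.
  by rewrite (is_cvg_limn_esupE (cvgP _ cE)) (cvg_lim _ cE).
have N0 (a : R^nat) : cvgn a -> (fun n => `|a n - limn a|) @ \oo --> (0 : R).
  by move=> al; rewrite -(@normr0 _ R); apply: cvg_norm; exact/subr_cvg0.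
have C3 : (fun j => `|complex.Re (w_ j x) - limn (fun j => complex.Re (w_ j x))| +
    `|complex.Im (w_ j x) - limn (fun j => complex.Im (w_ j x))|) @ \oo --> (0 : R).
  by rewrite -[X in _ --> X](addr0 0); apply: cvgD; exact: N0.
apply: (@squeeze_cvgr _ _ _ _ (fun=> 0)); last exact: C3; last exact: cvg_cst.
apply: nearW => n; apply/andP; split; first exact: nrm_ge0.
by apply: le_trans (nrm_le_ReIm _) _; rewrite !ReImE /w /= !lE.
Qed.

End RieszFischer.

(** * The Fourier transform of square integrable functions *)

Section FourierL2.
Context (R : realType).
Notation mR := (measurableTypeR R).
Notation mplane := (mR * mR)%type.
Notation mu2 := (@plane_mu R).
Notation fourier := (@fourier R).
Implicit Types f g k u w : mplane -> R[i].

Lemma geometric_le0 (x K : R) : (forall j : nat, x <= K * (1 / 8) ^+ j) -> x <= 0.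
Proof.
move=> H; have G : geometric K (1 / 8) @ \oo --> (0 : R).
  by apply: cvg_geometric; rewrite ger0_norm; lra.
rewrite -(cvg_lim _ G)//; apply: limr_ge; first exact: cvgP G.
by apply: nearW => j; exact: H.
Qed.

(** w is the Fourier transform of the square integrable function u: the limit of
    the transforms of a sequence of integrable functions that tends to u.  The
    rate is the one that [rapid_cvg] asks for. *)
Definition L2_fourier u w := [/\ inL2 u, inL2 w & exists (k_ : nat -> mplane -> R[i]) (C : R),
  forall j, [/\ inL12 (k_ j), (N2 (fun x => (u x - k_ j x)%R) <= (C * (1 / 8) ^+ j)%:E)%E &
    (N2 (fun x => (w x - fourier (k_ j) x)%R) <= (C * (1 / 8) ^+ j)%:E)%E]].

Lemma inL2_gau2 a b : 0 < a -> inL2 (fun x => real_complex R (gau2 a b x)).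
Proof.
move=> a0; split; first by apply: cmeas_real; exact: measurable_gau2.
rewrite /N2; under eq_integral do rewrite nrm_real normr_sqr.
apply: (@le_lt_trans _ _ (\int[mu2]_x (gau2 a b x)%:E)%E).
  apply: ge0_le_integral => //.
  - by move=> x _; rewrite lee_fin sqr_ge0.
  - by apply/measurable_EFinP; apply: measurable_funX; exact: measurable_gau2.
  - by apply/measurable_EFinP; exact: measurable_gau2.
  - move=> x _; rewrite lee_fin expr2 ler_piMr ?gau2_ge0//.
    by rewrite gau2_le1// ltW.
by rewrite integral_gau2// ltry.
Qed.

Let damp u (n : nat) : mplane -> R[i] := fun x => u x * real_complex R (gau2 n.+1%:R^-1 0 x).

Lemma inL12_damp u n : inL2 u -> inL12 (damp u n).
Proof.
move=> Lu; have a0 : 0 < n.+1%:R^-1 :> R by rewrite invr_gt0.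
have I := cintableM_L2 Lu (inL2_gau2 0 a0); split=> //.
have [mu Nu] := Lu; apply: le_lt_trans Nu; apply: le_N2 => //.
  exact: cintable_meas I.
move=> x; rewrite nrmM nrm_real ger0_norm ?gau2_ge0// ler_piMr ?nrm_ge0//.
by rewrite gau2_le1// ltW.
Qed.

Lemma gau2_cvg1 (x : mplane) : (fun n : nat => gau2 n.+1%:R^-1 0 x) @ \oo --> (1 : R).
Proof.
rewrite -[X in _ --> X](expR0 R) -[X in expR X](oppr0) -(mul0r ((x.1 - 0) ^+ 2 + (x.2 - 0) ^+ 2)).
apply: (@cvg_comp _ _ _ (fun n : nat => - (n.+1%:R^-1 * ((x.1 - 0) ^+ 2 + (x.2 - 0) ^+ 2))) expR);
  last exact: continuous_expR.
by apply: cvgN; apply: cvgM; [exact: cvg_harmonic|exact: cvg_cst].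
Qed.

Lemma damp_cvg u (e : R) : inL2 u -> 0 < e ->
  exists n, (N2 (fun x => (u x - damp u n x)%R) <= e%:E)%E.
Proof.
move=> Lu e0; have [mu Nu] := Lu.
pose h n (x : mplane) : \bar R := (nrm (u x) ^+ 2 * (1 - gau2 n.+1%:R^-1 0 x) ^+ 2)%:E.
have hE n : N2 (fun x => (u x - damp u n x)%R) = (\int[mu2]_x h n x)%E.
  apply: eq_integral => x _; rewrite /h /damp -exprMn.
  rewrite (_ : u x - _ = u x * real_complex R (1 - gau2 n.+1%:R^-1 0 x)).
    by rewrite nrmM nrm_real ger0_norm// subr_ge0 gau2_le1// invr_ge0.
  by rewrite rmorphB rmorph1 mulrBr mulr1.
have mh n : measurable_fun setT (h n).
  apply/measurable_EFinP; apply: measurable_funM; first exact: measurable_nrm2.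
  apply: measurable_funX; apply: measurable_funB => //; exact: measurable_gau2.
have [] := @dominated_convergence _ _ _ mu2 setT measurableT h (cst 0%E)
  (fun x => (nrm (u x) ^+ 2)%:E) mh.
- exact: measurable_cst.
- apply: aeW => x _; rewrite /h; apply: cvg_EFin; first exact: nearW.
  rewrite -[X in _ --> X](mulr0 (nrm (u x) ^+ 2)); apply: cvgM; first exact: cvg_cst.
  rewrite -[X in _ --> X](mulr0 (0 : R)); apply: cvgM;
    rewrite -[X in _ --> X](subrr (1 : R)); (apply: cvgB; [exact: cvg_cst|exact: gau2_cvg1]).
- apply/integrableP; split; first exact: measurable_N2.
  by under eq_integral do rewrite gee0_abs ?lee_fin ?sqr_ge0//.
- apply: aeW => x n _; rewrite /h /= lee_fin ger0_norm; last by apply: mulr_ge0; exact: sqr_ge0.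
  rewrite ler_piMr ?sqr_ge0//; apply: exprn_ile1.
  + by rewrite subr_ge0 gau2_le1// invr_ge0.
  + by rewrite lerBlDr lerDl gau2_ge0.
move=> _ _; rewrite integral_cst// mul0e => C.
have /fine_cvgP[F C'] := C.
move/cvgrPdist_le : C' => /(_ e e0) C'.
have [n Hn] : exists n, (\int[mu2]_x h n x)%E \is a fin_num /\ `|0 - fine (\int[mu2]_x h n x)%E| <= e.
  by near \oo => n; exists n; split; near: n.
have [Fn Cn] := Hn; exists n.
rewrite hE -(fineK Fn) lee_fin; move: Cn; rewrite sub0r normrN; exact: le_trans (ler_norm _).
Unshelve. all: by end_near. Qed.

Lemma plancherelB k l : inL12 k -> inL12 l ->
  (N2 (fun x => (fourier k x - fourier l x)%R) <=
   (4 * pi ^+ 2)%:E * N2 (fun x => (k x - l x)%R))%E.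
Proof.
move=> Lk Ll; have [Ik _] := Lk; have [Il _] := Ll.
rewrite (_ : (fun x => fourier k x - _) = fourier (fun x => k x - l x)).
  by have [I N] := inL12B Lk Ll; exact: plancherel_le.
by apply/funext => x; rewrite fourierB.
Qed.

Lemma inL2_fourier k : inL12 k -> inL2 (fourier k).
Proof.
move=> [Ik Nk]; split; first by apply: cmeas_fourier; exact: (cintable_meas Ik).
apply: le_lt_trans (plancherel_le Ik Nk) _.
by rewrite lte_mul_pinfty// lee_fin mulr_ge0// sqr_ge0.
Qed.

(** u is approximated by its products with wider and wider Gaussians; by the
    Plancherel inequality their transforms converge rapidly too. *)
Lemma L2_fourier_exists u : inL2 u -> exists w, L2_fourier u w.
Proof.
move=> Lu; have [mu Nu] := Lu.
have /choice[k_ Hk] : forall j : nat, exists k,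
    inL12 k /\ (N2 (fun x => (u x - k x)%R) <= ((1 / 8) ^+ j)%:E)%E.
  move=> j; have [|n Hn] := @damp_cvg u ((1 / 8) ^+ j) Lu; first by rewrite exprn_gt0.
  by exists (damp u n); split => //; exact: inL12_damp.
have Lk j := (Hk j).1; have Nk j := (Hk j).2.
have mk j : cmeas (k_ j) by have [/cintable_meas] := Lk j.
have mF j : cmeas (fourier (k_ j)) by exact: cmeas_fourier.
pose D : R := 16 * pi ^+ 2.
have D0 : 0 <= D by rewrite mulr_ge0// sqr_ge0.
have HD j m : (N2 (fun x => (fourier (k_ (j + m)%N) x - fourier (k_ j) x)%R) <= (D * (1 / 8) ^+ j)%:E)%E.
  apply: le_trans (plancherelB (Lk _) (Lk _)) _.
  rewrite (_ : D * _ = (4 * pi ^+ 2) * (4 * (1 / 8) ^+ j)); last by rewrite /D; ring.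
  rewrite [X in (_ <= X)%E]EFinM; apply: lee_wpmul2l; first by rewrite lee_fin mulr_ge0// sqr_ge0.
  rewrite (_ : (fun x => _) = (fun x => (u x - k_ j x) - (u x - k_ (j + m)%N x))); last first.
    by apply/funext => x; ring.
  apply: le_trans (N2B (cmeasB mu (mk _)) (cmeasB mu (mk _))) _.
  rewrite (_ : (4 * _)%:E = 2%:E * ((1 / 8) ^+ j)%:E + 2%:E * ((1 / 8) ^+ j)%:E)%E; last first.
    by rewrite -EFinM -EFinD; congr EFin; ring.
  apply: leeD; apply: lee_wpmul2l => //; apply: (le_trans (Nk _)); rewrite lee_fin exprD.
  by rewrite ler_piMr ?exprn_ge0// exprn_ile1//; lra.
have [|w mw Hw] := @rapid_cvg R (fun j => fourier (k_ j)) D mF.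
  by move=> j; rewrite -addn1; exact: HD.
have Nw j : (N2 (fun x => (w x - fourier (k_ j) x)%R) <= (D * (1 / 8) ^+ j)%:E)%E.
  pose h (m : nat) (x : mplane) : \bar R := (nrm (fourier (k_ (j + m)%N) x - fourier (k_ j) x) ^+ 2)%:E.
  apply: (@fatou_bound _ _ _ mu2 h) => //.
  - by move=> m; exact: (measurable_N2 (cmeasB (mF _) (mF _))).
  - by move=> m x; rewrite lee_fin sqr_ge0.
  - exact: (measurable_N2 (cmeasB mw (mF _))).
  - by move=> x; rewrite lee_fin sqr_ge0.
  - apply: filterS Hw => x Hx; apply: cvg_EFin; first exact: nearW.
    have Hx' : (fun m => nrm (fourier (k_ (j + m)%N) x - w x)) @ \oo --> (0 : R).
      by under eq_fun do rewrite addnC; rewrite -(cvg_shiftn j) in Hx.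
    suff : (fun m => nrm (fourier (k_ (j + m)%N) x - fourier (k_ j) x)) @ \oo -->
        nrm (w x - fourier (k_ j) x) by move=> C; exact: (cvgM C C).
    apply/cvgrPdist_le => e e0; move/cvgrPdist_le: Hx' => /(_ e e0).
    apply: filterS => m; rewrite sub0r normrN ger0_norm ?nrm_ge0//.
    set a := w x; set b := fourier _ x; set c := fourier _ x => H.
    have H1 : nrm (b - c) <= nrm (b - a) + nrm (a - c).
      by rewrite (_ : b - c = (b - a) + (a - c)); [exact: nrmD|ring].
    have H2 : nrm (a - c) <= nrm (b - a) + nrm (b - c).
      rewrite (_ : a - c = - (b - a) + (b - c)); last by ring.
      by apply: le_trans (nrmD _ _) _; rewrite nrmN.
    by rewrite ler_norml; apply/andP; split; lra.
  - by move=> m; exact: HD.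
exists w; split => //.
  split=> //.
  rewrite (_ : w = (fun x => (w x - fourier (k_ 0) x) + fourier (k_ 0) x)); last first.
    by apply/funext => x; rewrite subrK.
  have [_ //] : inL2 (fun x => (w x - fourier (k_ 0) x) + fourier (k_ 0) x).
  have L1 : inL2 (fun x => w x - fourier (k_ 0) x).
    by split; [exact: (cmeasB mw (mF 0))|exact: le_lt_trans (Nw 0) (ltry _)].
  exact: (inL2D L1 (inL2_fourier (Lk 0))).
exists k_, (D + 1) => j; split => //.
  by apply: (le_trans (Nk j)); rewrite lee_fin ler_peMl ?exprn_ge0// lerDr.
by apply: (le_trans (Nw j)); rewrite lee_fin ler_wpM2r ?exprn_ge0// lerDl.
Qed.

(** The constant is 4 times the one of [plancherel_le], because each of the two
    passages to the limit uses |x + y|^2 <= 2 |x|^2 + 2 |y|^2. *)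
Lemma L2_fourier_bound u w : L2_fourier u w -> (N2 w <= (16 * pi ^+ 2)%:E * N2 u)%E.
Proof.
move=> [[mu Nu] [mw Nw] [k_ [C Hk]]].
have fu : N2 u \is a fin_num by rewrite ge0_fin_numE ?N2_ge0.
have fw : N2 w \is a fin_num by rewrite ge0_fin_numE ?N2_ge0.
have p0 : 0 <= pi ^+ 2 :> R by exact: sqr_ge0.
rewrite -(fineK fu) -(fineK fw) -EFinM lee_fin -subr_le0.
apply: (@geometric_le0 _ (2 * C + 16 * pi ^+ 2 * C)) => j.
have [[Ik Nk] Hu Hw] := Hk j; have mk := cintable_meas Ik; have mF := cmeas_fourier mk.
have E1 : (N2 w <= 2%:E * N2 (fun x => (w x - fourier (k_ j) x)%R) + 2%:E * N2 (fourier (k_ j)))%E.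
  apply: le_trans (N2D (cmeasB mw mF) mF).
  by rewrite le_eqVlt; apply/orP; left; apply/eqP; apply: eq_N2 => x; rewrite subrK.
have E2 : (N2 (k_ j) <= 2%:E * N2 u + 2%:E * N2 (fun x => (u x - k_ j x)%R))%E.
  apply: le_trans (N2B mu (cmeasB mu mk)).
  by rewrite le_eqVlt; apply/orP; left; apply/eqP; apply: eq_N2 => x; congr nrm; ring.
have E3 := plancherel_le Ik Nk.
have fin v (r : R) : (N2 v <= r%:E)%E -> N2 v = (fine (N2 v))%:E.
  by move=> H; rewrite fineK// ge0_fin_numE ?N2_ge0// (le_lt_trans H)// ltry.
move: (fin _ _ Hu) (fin _ _ Hw) => Eu Ew; move: E1 E2 E3 Hu Hw; rewrite Eu Ew.
have fk : N2 (k_ j) \is a fin_num by rewrite ge0_fin_numE ?N2_ge0.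
have fF : N2 (fourier (k_ j)) \is a fin_num.
  by rewrite ge0_fin_numE ?N2_ge0//; have [] := @inL2_fourier (k_ j).
rewrite -(fineK fu) -(fineK fw) -(fineK fk) -(fineK fF).
set a := fine (N2 w); set b := fine (N2 (fourier _)); set c := fine (N2 (k_ j)).
set d := fine (N2 u); set e := fine _; set h := fine _.
rewrite -!EFinM -!EFinD !lee_fin => E1 E2 E3 E4 E5.
set q := (1 / 8) ^+ j in E4 E5 *; have q0 : 0 <= q by rewrite exprn_ge0.
have H : 4 * pi ^+ 2 * c <= 4 * pi ^+ 2 * (2 * d + 2 * (C * q)).
  by apply: ler_wpM2l; [exact: mulr_ge0|lra].
rewrite /=; lra.
Qed.

(** Both sides are continuous in the square integral norm, and the identity holds
    for integrable functions. *)
Lemma L2_fourier_duality u w k : L2_fourier u w -> inL12 k ->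
  cintg mu2 (fun x => w x * k x) = cintg mu2 (fun x => u x * fourier k x).
Proof.
move=> [Lu Lw [k_ [C Hk]]] Lk; apply/eqP; rewrite -subr_eq0; apply/eqP.
apply: nrm_eq0; apply/eqP; rewrite -sqrf_eq0 eq_le sqr_ge0 andbT.
set z := _ - _; have LF := inL2_fourier Lk.
have Lk2 := inL12_L2 Lk.
pose A := fine (N2 k); pose B := fine (N2 (fourier k)).
have fA : N2 k = A%:E by rewrite fineK// ge0_fin_numE ?N2_ge0//; case: Lk.
have fB : N2 (fourier k) = B%:E by rewrite fineK// ge0_fin_numE ?N2_ge0//; case: LF.
apply: (@geometric_le0 _ (2 * (C * A) + 2 * (C * B))) => j.
have [Lkj Hu Hw] := Hk j.
have Lkj2 := inL12_L2 Lkj; have LFj := inL2_fourier Lkj.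
have L1 := inL2B Lw LFj; have L2 := inL2B Lu Lkj2.
have -> : z = cintg mu2 (fun x => (w x - fourier (k_ j) x) * k x) -
   cintg mu2 (fun x => (u x - k_ j x) * fourier k x).
  rewrite /z; under [X in _ = X - _]eq_cintg do rewrite mulrBl.
  under [X in _ = _ - X]eq_cintg do rewrite mulrBl.
  rewrite !cintgB; [|exact: cintableM_L2..].
  rewrite (fourier_duality (k := k_ j) (phi := k)); [ring|by case: Lkj|by case: Lk].
have E1 := nrm_cintgM_le L1 Lk2; have E2 := nrm_cintgM_le L2 LF.
set a := cintg _ _ in E1 *; set b := cintg _ _ in E2 *.
have E1' : nrm a ^+ 2 <= C * (1 / 8) ^+ j * A.
  rewrite -lee_fin [X in (_ <= X)%E]EFinM; apply: le_trans E1 _; rewrite fA lee_wpmul2r//.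
  by rewrite -fA N2_ge0.
have E2' : nrm b ^+ 2 <= C * (1 / 8) ^+ j * B.
  rewrite -lee_fin [X in (_ <= X)%E]EFinM; apply: le_trans E2 _; rewrite fB lee_wpmul2r//.
  by rewrite -fB N2_ge0.
have := nrm_sqrD a (- b); rewrite nrmN; lra.
Qed.

End FourierL2.

(** * Fourier inversion and the transform of a product *)

Section Inversion.
Context (R : realType).
Notation mR := (measurableTypeR R).
Notation mplane := (mR * mR)%type.
Notation mu2 := (@plane_mu R).
Notation fourier := (@fourier R).
Implicit Types f g k u v w : mplane -> R[i].

Lemma conj_real (x : R) : conjc (real_complex R x) = real_complex R x.
Proof. by apply: complex_ext; rewrite /= ?oppr0. Qed.

Lemma gau2M (a : R) (b x : mplane) : 0 < a ->
  gau2 1 0 x * gau2 a b x = expR (- (a / (a + 1) * (b.1 ^+ 2 + b.2 ^+ 2))) *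
    gau2 (a + 1) (a / (a + 1) * b.1, a / (a + 1) * b.2) x.
Proof.
move=> a0; rewrite /gau2 -!expRD; congr expR => /=; field.
by rewrite gt_eqF// ltr_wpDl// ltW.
Qed.

(** The product of v - w and exp (- |x|^2) is integrable, and by completing the
    square its integrals against Gaussians are multiples of those of v - w. *)
Lemma gauss_unique v w :
  (forall a b, 0 < a -> cintable mu2 (fun x => v x * real_complex R (gau2 a b x))) ->
  (forall a b, 0 < a -> cintable mu2 (fun x => w x * real_complex R (gau2 a b x))) ->
  (forall a b, 0 < a -> cintg mu2 (fun x => v x * real_complex R (gau2 a b x)) =
                        cintg mu2 (fun x => w x * real_complex R (gau2 a b x))) ->
  {ae mu2, forall x, v x = w x}.
Proof.
move=> Iv Iw E.
pose H (x : mplane) := (v x - w x) * real_complex R (gau2 1 0 x).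
have IH : cintable mu2 H.
  rewrite (_ : H = fun x => v x * real_complex R (gau2 1 0 x) - w x * real_complex R (gau2 1 0 x)).
    by apply: cintableB; [exact: Iv|exact: Iw].
  by apply/funext => x; rewrite /H mulrBl.
have H0 (a : R) (b : R * R) : 0 < a -> cintg mu2 (fun x => H x * real_complex R (gau2 a b x)) = 0.
  move=> a0; have a1 : 0 < a + 1 by lra.
  (* the factor and the centre come from completing the square, see [gau2M] *)
  set K := expR (- (a / (a + 1) * (b.1 ^+ 2 + b.2 ^+ 2))).
  set b' : R * R := (a / (a + 1) * b.1, a / (a + 1) * b.2).
  transitivity (cintg mu2 (fun x => real_complex R K * (v x * real_complex R (gau2 (a + 1) b' x) -
     w x * real_complex R (gau2 (a + 1) b' x)))).
    apply: eq_cintg => x; rewrite /H -mulrA -rcM gau2M// -/K -/b' rcM; ring.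
  by rewrite cintgZ ?cintgB ?E ?subrr ?mulr0//; [exact: Iv|exact: Iw|apply: cintableB; [exact: Iv|exact: Iw]].
have := gauss_null IH H0; apply: filterS => x /eqP.
rewrite mulf_eq0 => /orP[/eqP/subr0_eq//|/eqP/(congr1 (@complex.Re R)) /= /eqP].
by rewrite gt_eqF// gau2_gt0.
Qed.

(** Dividing by the Gaussian recovers v. *)
Lemma gauss_cmeas v : cintable mu2 (fun x => v x * real_complex R (gau2 1 0 x)) -> cmeas v.
Proof.
move=> /cintable_meas mv.
rewrite (_ : v = fun x => (v x * real_complex R (gau2 1 0 x)) * real_complex R ((gau2 1 0 x)^-1)).
  apply: cmeasM => //; apply: cmeas_real.
  rewrite (_ : (fun x => _) = fun x : mplane => expR (x.1 ^+ 2 + x.2 ^+ 2)).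
    apply: (measurableT_comp (f := expR)) => //.
    by apply: measurable_funD; apply: measurable_funX.
  by apply/funext => x; rewrite /gau2 -expRN; congr expR; rewrite /= opprK mul1r !subr0.
by apply/funext => x; rewrite -mulrA -rcM mulfV ?mulr1// gt_eqF// gau2_gt0.
Qed.

Lemma inL2_gauss v a b : inL2 v -> 0 < a ->
  cintable mu2 (fun x => v x * real_complex R (gau2 a b x)).
Proof. by move=> Lv a0; apply: cintableM_L2 => //; exact: inL2_gau2. Qed.

Lemma inL12_gau2 (a : R) b : 0 < a -> inL12 (fun x : mplane => real_complex R (gau2 a b x)).
Proof.
move=> a0; have [m N] := inL2_gau2 b a0; split => //.
apply: (cintable_le m _ (integrable_gau2 b a0)) => x.
by rewrite nrm_real ger0_norm ?gau2_ge0.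
Qed.

Lemma inL12_gchar (a : R) b c : 0 < a -> inL12 (gchar a b c : mplane -> _).
Proof.
move=> a0; split; first exact: cintable_gchar.
rewrite (@eq_N2 _ _ (fun x : mplane => real_complex R (gau2 a b x))); first by have [] := inL12_gau2 b a0.
by move=> x; rewrite nrm_gchar nrm_real ger0_norm ?gau2_ge0.
Qed.

Lemma fourier_gau2 (a : R) (b y : mplane) : 0 < a ->
  fourier (fun x => real_complex R (gau2 a b x)) y =
  real_complex R (pi / a) * conjc (gchar (4 * a)^-1 0 b y).
Proof.
move=> a0; rewrite /Defs.fourier cintE.
transitivity (cintg mu2 (gchar a b (- y.1, - y.2))).
  by apply: eq_cintg => x; rewrite /gchar; congr (_ * expi _); rewrite /dotp /=; ring.
rewrite cintg_gchar// rcM -mulrA; congr (_ * _).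
rewrite /gchar conjM -expiN; congr (_ * _).
  by apply: complex_ext; rewrite /= ?oppr0//; congr expR; rewrite /dotp /=; field; rewrite gt_eqF.
by congr expi; rewrite /dotp /=; ring.
Qed.

Lemma fourier_gchar (a : R) (b c y : mplane) : 0 < a ->
  fourier (gchar a b c) y =
  real_complex R (pi / a * gau2 (4 * a)^-1 c y) * expi (dotp b (c.1 - y.1, c.2 - y.2)).
Proof.
move=> a0; rewrite /Defs.fourier cintE.
transitivity (cintg mu2 (gchar a b (c.1 - y.1, c.2 - y.2))).
  apply: eq_cintg => x; rewrite /gchar -mulrA -expiD; congr (_ * expi _).
  by rewrite /dotp /=; ring.
rewrite cintg_gchar//; congr (real_complex R (_ * expR _) * _).
by rewrite /dotp /=; field; rewrite gt_eqF.
Qed.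

Lemma fourier_gchar_inv (a : R) (b y : mplane) : 0 < a ->
  fourier (fun x => real_complex R (pi / a) * gchar (4 * a)^-1 0 b x) y =
  real_complex R (4 * pi ^+ 2 * gau2 a b y).
Proof.
move=> a0; have a4 : 0 < (4 * a)^-1 by rewrite invr_gt0 mulr_gt0.
rewrite /Defs.fourier cintE.
transitivity (real_complex R (pi / a) * fourier (gchar (4 * a)^-1 0 b) y).
  rewrite /Defs.fourier cintE -cintgZ; last by apply: cintable_char; exact: cintable_gchar.
  by apply: eq_cintg => x; rewrite mulrA.
rewrite fourier_gchar// (_ : dotp 0 _ = 0) ?expi0 ?mulr1; last by rewrite /dotp /= !mul0r addr0.
rewrite -rcM; congr (real_complex R _); rewrite (_ : (4 / (4 * a))^-1 = a); last by field; rewrite gt_eqF.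
by field; rewrite gt_eqF.
Qed.

(** The transform h of the conjugate of G is 4 pi^2 times the conjugate of g: the
    duality of [L2_fourier_duality], used twice, shows that both have the same integrals
    against Gaussians.  The claim is the duality for h and conj k, conjugated. *)
Lemma L2_fourier_inversion g G k : L2_fourier g G -> inL12 k ->
  cintg mu2 (fun x => G x * conjc (fourier (fun y => conjc (k y)) x)) =
  real_complex R (4 * pi ^+ 2) * cintg mu2 (fun x => g x * k x).
Proof.
move=> gG Lk; have [Lg LG _] := gG.
have [h hG] := L2_fourier_exists (inL2J LG); have [_ Lh _] := hG.
set c := 4 * pi ^+ 2.
have Lcg : inL2 (fun x => real_complex R c * conjc (g x)).
  have [m N] := inL2J Lg; split; first by apply: cmeasM => //; exact: cmeas_cst.
  by rewrite N2Z// lte_mul_pinfty// lee_fin sqr_ge0.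
have E : {ae mu2, forall x, h x = real_complex R c * conjc (g x)}.
  apply: gauss_unique => [a b a0|a b a0|a b a0]; [exact: inL2_gauss..|].
  rewrite (L2_fourier_duality hG (inL12_gau2 b a0)).
  have a4 : 0 < (4 * a)^-1 by rewrite invr_gt0 mulr_gt0.
  (* phi is the conjugate of the transform of the Gaussian gau2 a b *)
  pose phi (x : mplane) := real_complex R (pi / a) * gchar (4 * a)^-1 0 b x.
  have Lphi : inL12 phi.
    have [I N] := inL12_gchar 0 b a4; split; first exact: cintableZ.
    by rewrite N2Z ?lte_mul_pinfty// ?lee_fin ?sqr_ge0//; exact: cmeas_gchar.
  transitivity (conjc (cintg mu2 (fun x => G x * phi x))).
    rewrite -cintgJ; last by apply: cintableM_L2 => //; exact: inL12_L2.
    apply: eq_cintg => x; rewrite fourier_gau2// [RHS]conjM; congr (_ * _).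
    by rewrite /phi [RHS]conjM conj_real.
  rewrite (L2_fourier_duality gG Lphi) -cintgJ.
    apply: eq_cintg => x; rewrite fourier_gchar_inv// conjM -/c.
    by rewrite conj_real rcM; ring.
  by apply: cintableM_L2 => //; exact: inL2_fourier.
have D := L2_fourier_duality hG (inL12J Lk).
transitivity (conjc (cintg mu2 (fun x => h x * conjc (k x)))).
  rewrite D -cintgJ; last by apply: cintableM_L2; [exact: inL2J|exact: inL2_fourier (inL12J Lk)].
  by apply: eq_cintg => x; rewrite conjM conjcK.
have [mk _] := inL12_L2 (inL12J Lk); have [mh _] := Lh; have [mcg _] := Lcg.
rewrite (ae_eq_cintg (mu := mu2) (g := fun x => real_complex R c * conjc (g x) * conjc (k x))); last 3 first.
- exact: cmeasM.
- exact: cmeasM.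
- by apply: filterS E => x ->.
rewrite -cintgJ; last by apply: cintableM_L2 => //; exact: inL12_L2 (inL12J Lk).
rewrite -cintgZ; last by apply: cintableM_L2 => //; exact: inL12_L2.
apply: eq_cintg => x; rewrite !conjM !conjcK -mulrA; congr (_ * _).
by apply: complex_ext; rewrite /= ?oppr0.
Qed.

Definition refl (xi : R * R) f : mplane -> R[i] := fun y => f (xi.1 - y.1, xi.2 - y.2).

Lemma measurable_refl (xi : R * R) :
  measurable_fun setT (fun y : mplane => (xi.1 - y.1, xi.2 - y.2) : mplane).
Proof. by apply: measurable_fun_pair; apply: measurable_funB. Qed.

Lemma cmeas_refl xi f : cmeas f -> cmeas (refl xi f).
Proof. by move=> mf; apply: (cmeas_comp mf); exact: measurable_refl. Qed.

Lemma N2_refl xi f : cmeas f -> N2 (refl xi f) = N2 f.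
Proof.
move=> mf; rewrite /N2 -(ge0_integral_plane_reflect xi (f := fun y => (nrm (f y) ^+ 2)%:E))//.
  exact: measurable_N2.
by move=> x; rewrite lee_fin sqr_ge0.
Qed.

Lemma inL2_refl xi f : inL2 f -> inL2 (refl xi f).
Proof. by move=> [mf Nf]; split; [exact: cmeas_refl|rewrite N2_refl]. Qed.

Lemma N2_char xi g : N2 (fun x => g x * expi (- dotp x xi)) = N2 g.
Proof. by apply: eq_N2 => x; rewrite nrmM nrm_expi mulr1. Qed.

Lemma inL12_char xi g : inL12 g -> inL12 (fun x => g x * expi (- dotp x xi)).
Proof. by move=> [Ig Ng]; split; [exact: cintable_char|rewrite N2_char]. Qed.

Lemma inL2_char xi g : inL2 g -> inL2 (fun x => g x * expi (- dotp x xi)).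
Proof.
move=> [mg Ng]; split; last by rewrite N2_char.
by apply: cmeasM => //; exact: cmeas_char.
Qed.

(** Inversion for k x = f x expi (- dotp x xi): the conjugate of the transform of
    conj k is the transform of f, reflected at xi. *)
Lemma fourier_mul_L12 f g G xi : inL12 f -> L2_fourier g G ->
  cintg mu2 (fun eta => G eta * refl xi (fourier f) eta) =
  real_complex R (4 * pi ^+ 2) * fourier (fun x => f x * g x) xi.
Proof.
move=> Lf gG; have := L2_fourier_inversion gG (inL12_char xi Lf).
move=> E; transitivity (cintg mu2 (fun x => G x * conjc (fourier (fun y => conjc (f y * expi (- dotp y xi))) x))).
  apply: eq_cintg => eta; congr (_ * _); rewrite /refl /Defs.fourier !cintE.
  have [If _] := Lf.
  rewrite -cintgJ; last by apply: cintable_char; apply: cintableJ; exact: cintable_char.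
  apply: eq_cintg => x; rewrite !conjM !conjcK -!expiN -mulrA -expiD opprK; congr (_ * expi _).
  by rewrite /dotp /=; ring.
rewrite E; congr (_ * _); rewrite /Defs.fourier cintE; apply: eq_cintg => x; ring.
Qed.

(** For fixed xi both sides are continuous in f and F, by the Cauchy-Schwarz
    inequality. *)
Lemma fourier_mul f F g G xi : L2_fourier f F -> L2_fourier g G ->
  cintg mu2 (fun eta => G eta * refl xi F eta) =
  real_complex R (4 * pi ^+ 2) * fourier (fun x => f x * g x) xi.
Proof.
move=> [Lf LF [k_ [C Hk]]] gG; have [Lg LG _] := gG; apply/eqP; rewrite -subr_eq0; apply/eqP.
apply: nrm_eq0; apply/eqP; rewrite -sqrf_eq0 eq_le sqr_ge0 andbT.
set z := _ - _; pose c : R := 4 * pi ^+ 2.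
pose A := fine (N2 g); pose B := fine (N2 G).
have fA : N2 g = A%:E by rewrite fineK// ge0_fin_numE ?N2_ge0//; case: Lg.
have fB : N2 G = B%:E by rewrite fineK// ge0_fin_numE ?N2_ge0//; case: LG.
apply: (@geometric_le0 _ _ (2 * (C * B) + 2 * (c ^+ 2 * (C * A)))) => j.
have [Lkj Hu Hw] := Hk j.
have Lkj2 := inL12_L2 Lkj; have LFj := inL2_fourier Lkj.
have L1 := inL2_refl xi (inL2B LF LFj); have L2 := inL2B Lf Lkj2.
have -> : z = cintg mu2 (fun eta => refl xi (fun y => F y - fourier (k_ j) y) eta * G eta) -
   real_complex R c * cintg mu2 (fun x => (f x - k_ j x) * (g x * expi (- dotp x xi))).
  have -> : cintg mu2 (fun eta => refl xi (fun y => F y - fourier (k_ j) y) eta * G eta) =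
     cintg mu2 (fun eta => G eta * refl xi F eta) -
     cintg mu2 (fun eta => G eta * refl xi (fourier (k_ j)) eta).
    rewrite -(cintgB (cintableM_L2 LG (inL2_refl xi LF)) (cintableM_L2 LG (inL2_refl xi LFj))).
    by apply: eq_cintg => eta; rewrite /refl; ring.
  rewrite (fourier_mul_L12 xi Lkj gG) /z /c.
  have -> : cintg mu2 (fun x => (f x - k_ j x) * (g x * expi (- dotp x xi))) =
     fourier (fun x => f x * g x) xi - fourier (fun x => k_ j x * g x) xi.
    rewrite /Defs.fourier !cintE -cintgB; [|apply: cintable_char; exact: cintableM_L2..].
    by apply: eq_cintg => x; ring.
  ring.
have E1 := nrm_cintgM_le L1 LG; have E2 := nrm_cintgM_le L2 (inL2_char xi Lg).
rewrite N2_char in E2; rewrite N2_refl in E1; last by case: (inL2B LF LFj).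
set a := cintg _ _ in E1 *; set b := cintg _ _ in E2 *.
have E1' : nrm a ^+ 2 <= C * (1 / 8) ^+ j * B.
  rewrite -lee_fin [X in (_ <= X)%E]EFinM; apply: le_trans E1 _; rewrite fB lee_wpmul2r//.
  by rewrite -fB N2_ge0.
have E2' : nrm b ^+ 2 <= C * (1 / 8) ^+ j * A.
  rewrite -lee_fin [X in (_ <= X)%E]EFinM; apply: le_trans E2 _; rewrite fA lee_wpmul2r//.
  by rewrite -fA N2_ge0.
have := nrm_sqrD a (- (real_complex R c * b)); rewrite nrmN nrmM nrm_real exprMn normr_sqr => H.
have H2 : c ^+ 2 * nrm b ^+ 2 <= c ^+ 2 * (C * (1 / 8) ^+ j * A).
  by rewrite ler_wpM2l// sqr_ge0.
lra.
Qed.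

Lemma nrm_fourier_mul_le f F g G xi : L2_fourier f F -> L2_fourier g G ->
  ((4 * pi ^+ 2 * nrm (fourier (fun x => (f x * g x)%R) xi))%:E <=
   \int[mu2]_eta (nrm (G eta) * nrm (F (xi.1 - eta.1, xi.2 - eta.2)))%:E)%E.
Proof.
move=> fF gG; have [_ LF _] := fF; have [_ LG _] := gG.
have := nrm_cintg_le (cintableM_L2 LG (inL2_refl xi LF)).
rewrite (fourier_mul xi fF gG) nrmM nrm_real ger0_norm; last by apply: mulr_ge0 => //; exact: sqr_ge0.
by move=> H; apply: (le_trans H); under eq_integral do rewrite nrmM.
Qed.

End Inversion.

(** * Power weights on the line *)

Section PowerIntegrals.
Context (R : realType).
Notation leb := (@lebesgue_measure R).
Implicit Types (f F : R -> R) (x r e s : R).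

Lemma measurable_indic_itv (a b : R) :
  measurable_fun setT (fun x : R => (a <= x <= b)%R%:R : R).
Proof.
rewrite (_ : (fun x => _) = \1_`[a, b]); first exact: measurable_indic.
by apply/funext => x; rewrite indicE mem_setE in_itv.
Qed.

Lemma measurable_indic_itvoc (a b : R) :
  measurable_fun setT (fun x : R => (a < x <= b)%R%:R : R).
Proof.
rewrite (_ : (fun x => _) = \1_`]a, b]); first exact: measurable_indic.
by apply/funext => x; rewrite indicE mem_setE in_itv.
Qed.

Lemma measurable_indic_pos :
  measurable_fun setT (fun x : R => (0 < x)%R%:R : R).
Proof.
rewrite (_ : (fun x => _) = \1_`]0, +oo[); first exact: measurable_indic.
by apply/funext => x; rewrite indicE mem_setE in_itv /= andbT.
Qed.

Section Primitive.
Variables f F : R -> R.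
Hypothesis mf : measurable_fun setT f.
Hypothesis f0 : forall x, 0 <= f x.
Hypothesis cf : forall x, 0 < x -> {for x, continuous f}.
Hypothesis dF : forall x : R, 0 < x -> is_derive x (1 : R) F (f x).
Hypothesis F0 : forall x, 0 < x -> 0 <= F x.

Lemma integral_segment_le (a b : R) : 0 < a -> a < b ->
  (\int[leb]_x (f x * (a <= x <= b)%R%:R)%:E <= (F b)%:E)%E.
Proof.
move=> a0 ab.
have -> : (\int[leb]_x (f x * (a <= x <= b)%R%:R)%:E = \int[leb]_(x in `[a, b]) (f x)%:E)%E.
  rewrite [RHS]integral_mkcond; apply: eq_integral => x _.
  by rewrite patchE mem_setE in_itv /=; case: ifP; rewrite ?mulr1 ?mulr0.
have cF x : 0 < x -> {for x, continuous F}.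
  move=> x0; apply: differentiable_continuous.
  apply/derivable1_diffP; exact: (@ex_derive _ _ _ _ _ _ _ (dF x0)).
rewrite (@continuous_FTC2 _ f F)//.
- by rewrite -EFinB lee_fin gerBl F0.
- apply: continuous_in_subspaceT => x; rewrite inE/= in_itv/= => /andP[ax _].
  by apply: cf; exact: lt_le_trans ax.
- split.
  + move=> x; rewrite in_itv/= => /andP[ax _].
    exact: (@ex_derive _ _ _ _ _ _ _ (dF (lt_trans a0 ax))).
  + by apply: cvg_at_right_filter; exact: cF.
  + by apply: cvg_at_left_filter; apply: cF; exact: lt_trans ab.
- move=> x; rewrite in_itv/= => /andP[ax _].
  by rewrite derive1E; exact: (@derive_val _ _ _ _ _ _ _ (dF (lt_trans a0 ax))).
Qed.

(** The integrand may be singular at 0; the integrals over [r / (n + 2), r] are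
    bounded by F r and exhaust the half-line. *)
Lemma integral_posoc_le r : 0 < r ->
  (\int[leb]_x (f x * (0 < x <= r)%R%:R)%:E <= (F r)%:E)%E.
Proof.
move=> r0.
pose h (n : nat) x := (f x * (r / n.+2%:R <= x <= r)%R%:R)%:E.
apply: (@fatou_bound _ _ _ leb h).
- by move=> n; apply/measurable_EFinP; apply: measurable_funM => //; exact: measurable_indic_itv.
- by move=> n x; rewrite lee_fin mulr_ge0.
- by apply/measurable_EFinP; apply: measurable_funM => //; exact: measurable_indic_itvoc.
- by move=> x; rewrite lee_fin mulr_ge0.
- apply: aeW => x /=; apply: cvg_near_cst.
  have [x0|x0] := ltP 0 x; last first.
    apply: nearW => n; rewrite /h [(_ <= x)%R]leNgt.
    by rewrite (le_lt_trans x0)// divr_gt0.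
  near=> n; rewrite /h; congr (_ * _%:R)%:E; congr (nat_of_bool (_ && _)).
  rewrite ler_pdivrMr// -ler_pdivrMl// mulrC.
  apply: (@le_trans _ _ n%:R); last by rewrite ler_nat leqW.
  by near: n; exact: nbhs_infty_ger.
- move=> n; apply: integral_segment_le; first by rewrite divr_gt0.
  by rewrite ltr_pdivrMr// ltr_pMr// ltr1n.
Unshelve. all: by end_near. Qed.

Lemma integral_pos_le (M : R) : (forall x, 0 < x -> F x <= M) ->
  (\int[leb]_x (f x * (0 < x)%R%:R)%:E <= M%:E)%E.
Proof.
move=> FM; pose h (n : nat) x := (f x * (0 < x <= n.+1%:R)%R%:R)%:E.
apply: (@fatou_bound _ _ _ leb h).
- by move=> n; apply/measurable_EFinP; apply: measurable_funM => //; exact: measurable_indic_itvoc.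
- by move=> n x; rewrite lee_fin mulr_ge0.
- by apply/measurable_EFinP; apply: measurable_funM => //; exact: measurable_indic_pos.
- by move=> x; rewrite lee_fin mulr_ge0.
- apply: aeW => x /=; apply: cvg_near_cst; near=> n; rewrite /h.
  have -> : x <= n.+1%:R.
    apply: (@le_trans _ _ n%:R); last by rewrite ler_nat.
    by near: n; exact: nbhs_infty_ger.
  by rewrite andbT.
- by move=> n; apply: (le_trans (integral_posoc_le _)) => //; rewrite lee_fin FM.
Unshelve. all: by end_near. Qed.

End Primitive.

(** The value 0 at the origin makes f |x| the sum of the two half-line parts at
    every point. *)
Lemma integral_even_le f (M : R) : measurable_fun setT f -> (forall x, 0 <= f x) ->
  f 0 = 0 -> (\int[leb]_x (f x * (0 < x)%R%:R)%:E <= M%:E)%E ->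
  (\int[leb]_x (f `|x|)%:E <= (M + M)%:E)%E.
Proof.
move=> mf f0 fz H.
pose p x := (f x * (0 < x)%R%:R)%:E.
have mp : measurable_fun setT p.
  by apply/measurable_EFinP; apply: measurable_funM => //; exact: measurable_indic_pos.
have p0 x : (0 <= p x)%E by rewrite lee_fin mulr_ge0.
rewrite (_ : (fun x => _) = (fun x => p x + p (- x)%R)%E); last first.
  apply/funext => x; rewrite /p -EFinD oppr_gt0; case: (ltgtP x 0) => [x0|x0|->].
  - by rewrite ltr0_norm// mulr0 add0r mulr1.
  - by rewrite gtr0_norm// mulr0 addr0 mulr1.
  - by rewrite normr0 oppr0 fz !mul0r addr0.
have mp' : measurable_fun setT (fun x => p (- x)).
  by apply: (measurableT_comp mp); exact: oppr_measurable.
by rewrite ge0_integralD// ge0_integral_opp// EFinD leeD.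
Qed.

Lemma measurable_powR_abs s : measurable_fun setT (fun x : R => `|x| `^ s).
Proof. by apply: (measurableT_comp (f := fun y => powR y s)). Qed.

Lemma integral_sing_le s r : 0 < s < 1 -> 0 < r ->
  (\int[leb]_x (`|x| `^ (- s) * (`|x| <= r)%R%:R)%:E <= (2 * (r `^ (1 - s) / (1 - s)))%:E)%E.
Proof.
move=> /andP[s0 s1] r0; have s1' : 0 < 1 - s by lra.
rewrite (_ : 2 * _ = r `^ (1 - s) / (1 - s) + r `^ (1 - s) / (1 - s)); last by ring.
pose f x := x `^ (- s) * (x <= r)%R%:R.
have mi : measurable_fun setT (fun x : R => (x <= r)%R%:R : R).
  rewrite (_ : (fun x => _) = \1_`]-oo, r]); first exact: measurable_indic.
  by apply/funext => x; rewrite indicE mem_setE in_itv.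
apply: (@integral_even_le f).
- by apply: measurable_funM.
- by move=> x; rewrite mulr_ge0 ?powR_ge0.
- by rewrite /f powR0 ?mul0r// oppr_eq0 gt_eqF.
rewrite (_ : (fun x => _) = (fun x => (x `^ (- s) * (0 < x <= r)%R%:R)%:E)); last first.
  apply/funext => x; rewrite /f; congr EFin; case: (0 < x); rewrite ?andbT ?andbF /= ?mulr1 ?mulr0//.
apply: (@integral_posoc_le (fun x => x `^ (- s)) (fun x => x `^ (1 - s) / (1 - s))) => //.
- by move=> x; exact: powR_ge0.
- move=> x x0; apply: differentiable_continuous; apply/derivable1_diffP.
  by apply: derivable_powR; rewrite in_itv/= x0.
- move=> x x0; have D := is_derive1_powR (1 - s) x0.
  rewrite (_ : (fun x => _) = (1 - s)^-1 *: (fun x => x `^ (1 - s))); last first.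
    by apply/funext => y; rewrite mulrC.
  apply: is_derive_eq; rewrite /GRing.scale /=.
  by rewrite (_ : 1 - s - 1 = - s); [field; lra|ring].
- by move=> x x0; rewrite divr_ge0 ?powR_ge0// ltW.
Qed.

(** Of order |x|^(e-1) near 0 and |x|^(-1-e) at infinity, so integrable on the
    line.  It is chosen because the product of its values at the two coordinates
    of z is, up to a factor, at least 1 / (|z|^(2-2e) + |z|^(2+2e)). *)
Definition lineweight e x : R := (`|x| `^ (1 - e) + `|x| `^ (1 + e))^-1.

Lemma lineweight_ge0 e x : 0 <= lineweight e x.
Proof. by rewrite invr_ge0 addr_ge0// powR_ge0. Qed.

Lemma measurable_inv_ge0 d (T : measurableType d) (u : T -> R) :
  measurable_fun setT u -> (forall t, 0 <= u t) -> measurable_fun setT (fun t => (u t)^-1).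
Proof.
move=> mu u0; under eq_fun do rewrite -powR_inv1//.
exact: (measurableT_comp (f := fun y => powR y (-1))).
Qed.

Lemma measurable_lineweight e : measurable_fun setT (lineweight e).
Proof.
apply: measurable_inv_ge0; last by move=> x; rewrite addr_ge0// powR_ge0.
by apply: measurable_funD; exact: measurable_powR_abs.
Qed.

Lemma continuous_powR s x : 0 < x -> {for x, continuous (fun x => x `^ s)}.
Proof.
move=> x0; apply: differentiable_continuous; apply/derivable1_diffP.
by apply: derivable_powR; rewrite in_itv/= x0.
Qed.

(** On the positive half-line a primitive is atan (x^e) / e. *)
Lemma integral_lineweight_le e : 0 < e < 1 ->
  (\int[leb]_x (lineweight e x)%:E <= (pi / e)%:E)%E.
Proof.
move=> /andP[e0 e1].
pose f x := (x `^ (1 - e) + x `^ (1 + e))^-1.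
have f0 x : 0 <= f x by rewrite invr_ge0 addr_ge0// powR_ge0.
have mf : measurable_fun setT f.
  apply: measurable_inv_ge0; last by move=> x; rewrite addr_ge0// powR_ge0.
  exact: measurable_funD.
rewrite (_ : pi / e = pi / 2 / e + pi / 2 / e); last by field; rewrite gt_eqF.
apply: (@integral_even_le f) => //.
  by rewrite /f !powR0 ?addr0 ?invr0// gt_eqF//; lra.
apply: (@integral_pos_le f (fun x => atan (x `^ e) / e)) => //.
- move=> x x0; apply: cvgV; first by rewrite gt_eqF// addr_gt0// powR_gt0.
  by apply: cvgD; exact: continuous_powR.
- move=> x x0; have D1 := is_derive1_powR e x0; have D2 := is_derive1_atan (x `^ e).
  have D3 : is_derive (x : R) (1 : R) (atan \o (fun x => x `^ e))
     ((1 + (x `^ e) ^+ 2)^-1 * (e * x `^ (e - 1))) by exact: is_derive1_comp.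
  rewrite (_ : (fun x => _) = e^-1 *: (atan \o (fun x => x `^ e))); last first.
    by apply/funext => y; rewrite mulrC.
  apply: is_derive_eq; rewrite /GRing.scale /=.
  rewrite mulrCA mulKf ?gt_eqF// /f.
  rewrite (_ : x `^ (e - 1) = (x `^ (1 - e))^-1); last by rewrite -powRN; congr powR; ring.
  rewrite -invfM; congr (_^-1); rewrite mulrDl mul1r; congr (_ + _).
  have xn : x != 0 by rewrite gt_eqF.
  by rewrite expr2 -!powRD ?xn ?implybT//; congr powR; ring.
- move=> x x0; rewrite divr_ge0 ?(ltW e0)//.
  by rewrite -[leLHS](@atan0 R) le_atan// powR_ge0.
- move=> x x0; rewrite ler_pM2r ?invr_gt0//; apply: ltW; exact: atan_ltpi2.
Qed.

End PowerIntegrals.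

(** * Power weights in the plane *)

Section PlaneIntegral.
Context (R : realType).
Notation mR := (measurableTypeR R).
Notation mplane := (mR * mR)%type.
Notation mu2 := (@plane_mu R).
Implicit Types f g : mplane -> R.

Definition pint f : \bar R := (\int[mu2]_x (f x)%:E)%E.

Lemma pint_ge0 f : (forall x, 0 <= f x) -> (0 <= pint f)%E.
Proof. by move=> f0; apply: integral_ge0 => x _; rewrite lee_fin. Qed.

Lemma ae_le_pint f g : measurable_fun setT f -> measurable_fun setT g ->
  (forall x, 0 <= f x) -> (forall x, 0 <= g x) ->
  {ae mu2, forall x, f x <= g x} -> (pint f <= pint g)%E.
Proof.
move=> mf mg f0 g0 fg; apply: ae_ge0_le_integral => //.
- by move=> x _; rewrite lee_fin.
- exact/measurable_EFinP.
- by move=> x _; rewrite lee_fin.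
- exact/measurable_EFinP.
- by apply: filterS fg => x + _; rewrite lee_fin.
Qed.

Lemma pintZ (c : R) f : measurable_fun setT f -> (forall x, 0 <= f x) -> 0 <= c ->
  pint (fun x => c * f x) = (c%:E * pint f)%E.
Proof.
move=> mf f0 c0; rewrite /pint -ge0_integralZl//; first exact/measurable_EFinP.
by move=> x _; rewrite lee_fin.
Qed.

Lemma pintD f g : measurable_fun setT f -> measurable_fun setT g ->
  (forall x, 0 <= f x) -> (forall x, 0 <= g x) ->
  pint (fun x => f x + g x) = (pint f + pint g)%E.
Proof.
move=> mf mg f0 g0; rewrite /pint -ge0_integralD//.
- by move=> x _; rewrite lee_fin.
- exact/measurable_EFinP.
- by move=> x _; rewrite lee_fin.
- exact/measurable_EFinP.
Qed.

Lemma pint_reflect (xi : R * R) f : measurable_fun setT f -> (forall x, 0 <= f x) ->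
  pint (fun y => f (xi.1 - y.1, xi.2 - y.2)) = pint f.
Proof.
move=> mf f0; apply: (ge0_integral_plane_reflect xi (f := fun z => (f z)%:E)) => //.
exact/measurable_EFinP.
Qed.

Lemma measurable_pint (h : mplane * mplane -> R) : measurable_fun setT h ->
  measurable_fun setT (fun x : mplane => pint (fun y => h (x, y))).
Proof.
move=> mh; apply: (@measurable_partial_integral _ _ mplane mplane R mu2 (fun z => (h z)%:E)).
exact/measurable_EFinP.
Qed.

Lemma pint_tonelli (h : mplane * mplane -> R) : measurable_fun setT h ->
  (forall z, 0 <= h z) ->
  (\int[mu2]_x pint (fun y => h (x, y)) = \int[mu2]_y pint (fun x => h (x, y)))%E.
Proof.
move=> mh h0; have mh' : measurable_fun setT (fun z => (h z)%:E) by exact/measurable_EFinP.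
by apply: (@fubini_tonelli _ _ mplane mplane R mu2 mu2 _ mh') => z; rewrite lee_fin.
Qed.

Lemma measurable_diff2 : measurable_fun setT
  (fun z : mplane * mplane => (z.1.1 - z.2.1, z.1.2 - z.2.2) : mplane).
Proof.
by apply: measurable_fun_pair; apply: measurable_funB;
  apply: (measurableT_comp (f := _ : mplane -> mR)).
Qed.

(** Tonelli's theorem and invariance under translation. *)
Lemma pint_convolution f g : measurable_fun setT f -> measurable_fun setT g ->
  (forall x, 0 <= f x) -> (forall x, 0 <= g x) ->
  (\int[mu2]_x pint (fun y => (f y * g (x.1 - y.1, x.2 - y.2))%R) = pint f * pint g)%E.
Proof.
move=> mf mg f0 g0.
rewrite (@pint_tonelli (fun z => f z.2 * g (z.1.1 - z.2.1, z.1.2 - z.2.2))); last 2 first.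
- apply: measurable_funM; first exact: (measurableT_comp mf measurable_snd).
  exact: (measurableT_comp mg measurable_diff2).
- by move=> z; rewrite mulr_ge0.
transitivity (\int[mu2]_y ((f y)%:E * pint g))%E; last first.
  rewrite ge0_integralZr//.
  - exact/measurable_EFinP.
  - by move=> y _; rewrite lee_fin.
  - exact: pint_ge0.
apply: eq_integral => y _ /=; rewrite pintZ//; last first.
  have mr : measurable_fun setT (fun x : mplane => (x, y) : mplane * mplane).
    by apply: measurable_fun_pair.
  exact: (measurableT_comp mg (measurableT_comp measurable_diff2 mr)).
congr (_ * _)%E; have := @ge0_integral_plane_shift R (- y.1, - y.2) (fun z => (g z)%:E).
by apply; [exact/measurable_EFinP|move=> z; rewrite lee_fin].
Qed.

Lemma cs_pint f g : measurable_fun setT f -> measurable_fun setT g ->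
  (forall x, 0 <= f x) -> (forall x, 0 <= g x) ->
  (pint (fun x => (f x * g x)%R) * pint (fun x => (f x * g x)%R) <=
   pint (fun x => (f x ^+ 2)%R) * pint (fun x => (g x ^+ 2)%R))%E.
Proof. by move=> mf mg f0 g0; exact: cauchy_schwarz. Qed.

End PlaneIntegral.

Section Weights.
Context (R : realType).
Notation mR := (measurableTypeR R).
Notation mplane := (mR * mR)%type.
Notation mu2 := (@plane_mu R).
Notation leb := (@lebesgue_measure R).

Lemma measurable_enorm : measurable_fun setT (@enorm R : mplane -> R).
Proof.
apply: (measurableT_comp (f := @Num.sqrt R)).
  by apply: continuous_measurable_fun; exact: sqrt_continuous.
by apply: measurable_funD; apply: measurable_funM.
Qed.

Lemma measurable_enorm_powR (s : R) : measurable_fun setT (fun x : mplane => enorm x `^ s).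
Proof. exact: (measurableT_comp (measurable_powR s) measurable_enorm). Qed.

Lemma enorm_eq0 (x : R * R) : enorm x = 0 -> x = 0.
Proof.
move=> x0; have := enorm_sqr x; rewrite x0 expr0n /= => /esym/eqP.
rewrite paddr_eq0 ?sqr_ge0// !sqrf_eq0 => /andP[/eqP x1 /eqP x2].
by rewrite (surjective_pairing x) x1 x2.
Qed.

Lemma enorm_gt0 (x : R * R) : x <> 0 -> 0 < enorm x.
Proof.
move=> x0; rewrite lt_neqAle enorm_ge0 andbT eq_sym.
by apply/eqP => /enorm_eq0.
Qed.

Lemma enorm_triangle (x y : R * R) : enorm y <= enorm x + enorm (x.1 - y.1, x.2 - y.2).
Proof.
set z := (_, _).
have nx := enorm_ge0 x; have nz := enorm_ge0 z; have ny := enorm_ge0 y.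
rewrite -ler_sqr ?nnegrE ?addr_ge0// sqrrD.
suff H : - (x.1 * z.1 + x.2 * z.2) <= enorm x * enorm z.
  rewrite !enorm_sqr; move: H; rewrite /z /= => H.
  rewrite mulr2n; set t := enorm x * _ in H *; nra.
apply: (le_trans (ler_norm _)); rewrite normrN.
rewrite -ler_sqr ?nnegrE ?mulr_ge0// normr_sqr exprMn !enorm_sqr.
have := sqr_ge0 (x.1 * z.2 - x.2 * z.1); nra.
Qed.

Variables (s alpha beta e : R).
Hypotheses (hs : 0 < s < 1) (he : 0 < e < 1).
Hypotheses (halpha : alpha <= 1 - e) (hbeta : 1 + e <= beta).

Let s0 : 0 < s. Proof. by case/andP: hs. Qed.
Let s1 : s < 1. Proof. by case/andP: hs. Qed.
Let e0 : 0 < e. Proof. by case/andP: he. Qed.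
Let e1 : e < 1. Proof. by case/andP: he. Qed.

(** The weight of the square of the norm of f in the theorem, seen on the
    Fourier side. *)
Definition wt (z : R * R) : R := (enorm z `^ alpha) ^+ 2 + (enorm z `^ beta) ^+ 2.

Lemma wt_ge0 z : 0 <= wt z. Proof. by rewrite addr_ge0// sqr_ge0. Qed.

Lemma measurable_wt : measurable_fun setT (wt : mplane -> R).
Proof. by apply: measurable_funD; apply: measurable_funX; exact: measurable_enorm_powR. Qed.

(** The term with exponent alpha dominates for |z| <= 1, the one with exponent
    beta for 1 <= |z|. *)
Lemma powR_sqr_le_wt (p : R) z : 0 < p -> alpha <= p <= beta -> (enorm z `^ p) ^+ 2 <= wt z.
Proof.
move=> p0 /andP[ap pb]; have [z0|z0] := eqVneq (enorm z) 0.
  by rewrite z0 powR0 ?gt_eqF// expr0n /= wt_ge0.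
have zp : 0 < enorm z by rewrite lt_neqAle eq_sym z0 enorm_ge0.
have [z1|z1] := leP (enorm z) 1.
  apply: (@le_trans _ _ ((enorm z `^ alpha) ^+ 2)); last by rewrite lerDl sqr_ge0.
  by rewrite ler_pXn2r ?nnegrE ?powR_ge0// ger_powR// zp.
apply: (@le_trans _ _ ((enorm z `^ beta) ^+ 2)); last by rewrite lerDr sqr_ge0.
by rewrite ler_pXn2r ?nnegrE ?powR_ge0// ler_powR// ltW.
Qed.

Definition planeweight (z : R * R) : R := lineweight e z.1 * lineweight e z.2.

Lemma planeweight_ge0 z : 0 <= planeweight z. Proof. by rewrite mulr_ge0// lineweight_ge0. Qed.

Lemma measurable_planeweight : measurable_fun setT (planeweight : mplane -> R).
Proof.
by apply: measurable_funM; apply: (measurableT_comp (measurable_lineweight e)).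
Qed.

Lemma pint_planeweight : (pint planeweight <= ((pi / e) ^+ 2)%:E)%E.
Proof.
rewrite /pint /planeweight ge0_integral_planeM; try exact: measurable_lineweight; try exact: lineweight_ge0.
rewrite expr2 EFinM; apply: lee_pmul; try exact: integral_lineweight_le;
  by apply: integral_ge0 => x _; rewrite lee_fin lineweight_ge0.
Qed.

(** Each coordinate is at most |z| in absolute value, so that the reciprocal of
    planeweight z is at most (|z|^(1-e) + |z|^(1+e))^2, and both terms of the sum
    have squares below the weight. *)
Lemma planeweight_wt (z : R * R) : z.1 != 0 -> z.2 != 0 -> 1 <= planeweight z * (4 * wt z).
Proof.
move=> z1 z2; pose A (x : R) := `|x| `^ (1 - e) + `|x| `^ (1 + e).
have Ap x : x != 0 -> 0 < A x by move=> x0; rewrite addr_gt0// powR_gt0// normr_gt0.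
rewrite /planeweight /lineweight -/(A z.1) -/(A z.2) -invfM mulrC ler_pdivlMr ?mulr_gt0 ?Ap// mul1r.
set p := enorm z `^ (1 - e); set q := enorm z `^ (1 + e).
have Ale (x : R) : `|x| <= enorm z -> A x <= p + q.
  by move=> H; apply: lerD; apply: ge0_ler_powR; rewrite ?nnegrE ?enorm_ge0//;
    rewrite ?subr_ge0 ?addr_ge0 ?ltW.
have A1 := Ale _ (fst_le_enorm z); have A2 := Ale _ (snd_le_enorm z).
have P : p ^+ 2 <= wt z.
  apply: powR_sqr_le_wt; first by rewrite subr_gt0.
  by rewrite halpha (le_trans _ hbeta)// lerD2l (le_trans _ (ltW e0))// oppr_le0 ltW.
have Q : q ^+ 2 <= wt z.
  apply: powR_sqr_le_wt; first by rewrite addr_gt0.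
  by rewrite hbeta (le_trans halpha)// lerD2l (le_trans _ (ltW e0))// oppr_le0 ltW.
apply: le_trans (ler_pM (ltW (Ap _ z1)) (ltW (Ap _ z2)) A1 A2) _.
by have := sqr_ge0 (p - q); nra.
Qed.

Definition ker (xi zeta : R * R) : R :=
  if enorm xi <= enorm zeta then enorm xi `^ (- s) * enorm zeta `^ s else 0.

Lemma ker_ge0 xi zeta : 0 <= ker xi zeta.
Proof. by rewrite /ker; case: ifP => // _; rewrite mulr_ge0// powR_ge0. Qed.

Lemma measurable_ker : measurable_fun setT (fun z : mplane * mplane => ker z.1 z.2).
Proof.
have m1 := measurableT_comp measurable_enorm (@measurable_fst _ _ mplane mplane).
have m2 := measurableT_comp measurable_enorm (@measurable_snd _ _ mplane mplane).
apply: measurable_fun_ifT => //.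
  exact: measurable_fun_ler.
apply: measurable_funM.
  exact: (measurableT_comp (measurable_enorm_powR (- s)) measurable_fst).
exact: (measurableT_comp (measurable_enorm_powR s) measurable_snd).
Qed.

(** On the square |x|, |y| <= |zeta| the function |xi|^(-2s) is at most
    |x|^-s |y|^-s, whose integral is a product of integrals on the line. *)
Lemma pint_ker zeta :
  (pint (fun xi => (ker xi zeta ^+ 2)%R) <= ((2 / (1 - s)) ^+ 2 * enorm zeta ^+ 2)%:E)%E.
Proof.
have [z0|z0] := eqVneq (enorm zeta) 0.
  rewrite (_ : (fun xi => _) = fun=> 0).
    by rewrite /pint integral0 lee_fin mulr_ge0// sqr_ge0.
  apply/funext => xi; rewrite /ker z0 powR0 ?gt_eqF// mulr0.
  by case: ifP; rewrite expr0n.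
set r := enorm zeta in z0 *.
have r0 : 0 < r by rewrite lt_neqAle eq_sym z0 enorm_ge0.
pose u (x : R) := `|x| `^ (- s) * (`|x| <= r)%R%:R.
have mu_ : measurable_fun setT u.
  apply: measurable_funM; first exact: measurable_powR_abs.
  rewrite (_ : (fun x => _) = \1_`[- r, r]); first exact: measurable_indic.
  by apply/funext => x; rewrite indicE mem_setE in_itv /= ler_norml.
have u0 x : 0 <= u x by rewrite mulr_ge0// powR_ge0.
have mk : measurable_fun setT (fun xi : mplane => ker xi zeta ^+ 2).
  apply: measurable_funX.
  have mp : measurable_fun setT (fun x : mplane => (x, zeta) : mplane * mplane).
    exact: measurable_fun_pair.
  exact: (measurableT_comp measurable_ker mp).
have muu : measurable_fun setT (fun z : mplane => u z.1 * u z.2).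
  by apply: measurable_funM; apply: (measurableT_comp mu_).
have muur : measurable_fun setT (fun z : mplane => (r `^ s) ^+ 2 * (u z.1 * u z.2)).
  exact: measurable_funM.
apply: (@le_trans _ _ (pint (fun z : mplane => (r `^ s) ^+ 2 * (u z.1 * u z.2)))).
  apply: ae_le_pint => //.
  - by move=> z; exact: sqr_ge0.
  - by move=> z; rewrite mulr_ge0 ?sqr_ge0// mulr_ge0.
  apply: filterS (ae_off_cross 0) => z [z1 z2]; rewrite /ker -/r.
  case: ifP => zr; last by rewrite expr0n /= mulr_ge0 ?sqr_ge0// mulr_ge0.
  rewrite exprMn mulrC ler_wpM2l ?sqr_ge0// /u.
  have F := fst_le_enorm z; have S := snd_le_enorm z.
  rewrite (le_trans F zr) (le_trans S zr) !mulr1 expr2.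
  have H (x : R) : x != 0 -> `|x| <= enorm z -> enorm z `^ (- s) <= `|x| `^ (- s).
    move=> x0 xz; rewrite !powRN lef_pV2 ?posrE ?powR_gt0 ?normr_gt0//.
      by apply: ge0_ler_powR; rewrite ?nnegrE ?enorm_ge0// ltW.
    by apply: (lt_le_trans _ xz); rewrite normr_gt0.
  by apply: ler_pM; rewrite ?powR_ge0// H.
rewrite pintZ ?sqr_ge0//; last by move=> z; rewrite mulr_ge0.
rewrite /pint ge0_integral_planeM//.
pose M := 2 * (r `^ (1 - s) / (1 - s)).
have I : (\int[leb]_x (u x)%:E <= M%:E)%E by exact: integral_sing_le.
have I0 : (0 <= \int[leb]_x (u x)%:E)%E by apply: integral_ge0 => x _; rewrite lee_fin.
apply: (@le_trans _ _ (((r `^ s) ^+ 2)%:E * (M%:E * M%:E))%E).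
  by rewrite lee_wpmul2l ?lee_fin ?sqr_ge0// lee_pmul.
rewrite -!EFinM lee_fin le_eqVlt; apply/orP; left; apply/eqP.
have E : r `^ s * r `^ (1 - s) = r.
  rewrite -powRD ?z0 ?implybT// (_ : s + (1 - s) = 1); last by ring.
  by rewrite powRr1// ltW.
rewrite -[in RHS]E /M; field.
by rewrite subr_eq0 gt_eqF.
Qed.

(** |eta| is at most twice the larger of |xi| and |xi - eta|; in the first case
    the summand 1 suffices, in the second the kernel. *)
Lemma ker_split (xi eta : R * R) : xi <> 0 -> eta <> 0 ->
  enorm xi `^ (- s) <= 2 * enorm eta `^ (- s) * (1 + ker xi (xi.1 - eta.1, xi.2 - eta.2)).
Proof.
move=> /enorm_gt0 x0 /enorm_gt0 y0; set z := (_, _).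
have T : enorm eta <= enorm xi + enorm z := enorm_triangle xi eta.
have P (t : R) : 0 < t -> enorm eta <= 2 * t -> enorm eta `^ s <= 2 * t `^ s.
  move=> t0 H; apply: (@le_trans _ _ ((2 * t) `^ s)).
    by apply: ge0_ler_powR; rewrite ?nnegrE ?enorm_ge0 ?mulr_ge0// ltW.
  rewrite powRM ?(ltW t0)//; apply: ler_wpM2r; first exact: powR_ge0.
  by rewrite ler1_powR// ?ler1n// ltW.
have y1 : enorm eta `^ s * enorm eta `^ (- s) = 1.
  by rewrite powRN mulfV// gt_eqF// powR_gt0.
have x1 : enorm xi `^ s * enorm xi `^ (- s) = 1.
  by rewrite powRN mulfV// gt_eqF// powR_gt0.
have xs := powR_ge0 (enorm xi) (- s); have ys := powR_ge0 (enorm eta) (- s).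
have key (X Y E Z : R) : 0 <= X -> 0 <= Y -> E <= 2 * Z -> X * (E * Y) <= 2 * Y * (X * Z).
  move=> X0 Y0 EZ; rewrite (_ : 2 * Y * _ = X * (2 * Z * Y)); last by ring.
  by rewrite ler_wpM2l// ler_wpM2r.
rewrite -[leLHS]mulr1 -[X in _ * X]y1 /ker; case: ifPn => [xz|].
  have z0 : 0 < enorm z := lt_le_trans x0 xz.
  apply: (@le_trans _ _ (2 * enorm eta `^ (- s) * (enorm xi `^ (- s) * enorm z `^ s))).
    by apply: key => //; apply: P => //; lra.
  by rewrite ler_wpM2l ?mulr_ge0// lerDr.
rewrite -ltNge => zx; rewrite addr0 -[X in _ <= _ * X]x1 (mulrC (enorm xi `^ s)).
by apply: key => //; apply: P => //; lra.
Qed.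

End Weights.

(** * The weighted convolution inequality *)

Section Core.
Context (R : realType).
Notation mR := (measurableTypeR R).
Notation mplane := (mR * mR)%type.
Notation mu2 := (@plane_mu R).

Lemma sqrD_le_ereal (x y : \bar R) : (0 <= x)%E -> (0 <= y)%E ->
  ((x + y) * (x + y) <= 2%:E * (x * x) + 2%:E * (y * y))%E.
Proof.
case: x => [x| |]; case: y => [y| |] //; rewrite ?lee_fin => x0 y0.
- by have := sqr_ge0 (x - y); nra.
- by rewrite /= mulyy gt0_muley ?addey ?leey// -EFinM ltNyr.
- by rewrite /= mulyy gt0_muley ?addye ?leey// -EFinM ltNyr.
- by rewrite /= mulyy gt0_muley ?leey.
Qed.

Lemma sqr_double_ereal (x : \bar R) : (2%:E * (2%:E * x * (2%:E * x)) = 8%:E * (x * x))%E.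
Proof.
by rewrite (muleACA 2%:E x 2%:E x) -(EFinM 2 2) (muleA 2%:E) -(EFinM 2); congr (_%:E * _)%E; ring.
Qed.

Variables (s alpha beta e : R).
Hypotheses (hs : 0 < s < 1) (he : 0 < e < 1).
Hypotheses (halpha : alpha <= 1 - e) (hbeta : 1 + e <= beta).

Notation weight := (wt alpha beta).
Notation kr := (ker s).
Notation pw := (planeweight e).

Section Fixed.
Variables a b : mplane -> R.
Hypotheses (ma : measurable_fun setT a) (mb : measurable_fun setT b).
Hypotheses (a0 : forall x, 0 <= a x) (b0 : forall x, 0 <= b x).

Let sub (xi eta : R * R) : R * R := (xi.1 - eta.1, xi.2 - eta.2).
Let B (eta : mplane) := enorm eta `^ (- s) * b eta.

Let mB : measurable_fun setT B.
Proof. by apply: measurable_funM => //; exact: measurable_enorm_powR. Qed.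

Let B0 eta : 0 <= B eta. Proof. by rewrite mulr_ge0 ?powR_ge0. Qed.

Let W (z : mplane) := weight z * a z ^+ 2.

Let mW : measurable_fun setT W.
Proof. by apply: measurable_funM; [exact: measurable_wt|exact: measurable_funX]. Qed.

Let W0 z : 0 <= W z. Proof. by rewrite mulr_ge0 ?wt_ge0 ?sqr_ge0. Qed.

Let plain_part (xi : mplane) := pint (fun eta => B eta * a (sub xi eta)).
Let kernel_part (xi : mplane) := pint (fun eta => B eta * (kr xi (sub xi eta) * a (sub xi eta))).

Let msub (f : mplane -> R) xi : measurable_fun setT f -> measurable_fun setT (fun eta => f (sub xi eta)).
Proof. by move=> mf; apply: (measurableT_comp mf); exact: measurable_refl. Qed.

Let msub2 (f : mplane -> R) : measurable_fun setT f ->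
  measurable_fun setT (fun z : mplane * mplane => f (sub z.1 z.2)).
Proof. by move=> mf; apply: (measurableT_comp mf); exact: measurable_diff2. Qed.

Let mker2 : measurable_fun setT (fun z : mplane * mplane => kr z.1 (sub z.1 z.2)).
Proof.
have mp : measurable_fun setT (fun z : mplane * mplane => (z.1, sub z.1 z.2) : mplane * mplane).
  by apply: measurable_fun_pair => //; exact: measurable_diff2.
exact: (measurableT_comp (@measurable_ker R s) mp).
Qed.

Let mker_sub xi : measurable_fun setT (fun eta : mplane => kr xi (sub xi eta)).
Proof. exact: (measurableT_comp mker2 (measurable_pair1 xi)). Qed.

Let mplain : measurable_fun setT plain_part.
Proof.
apply: (@measurable_pint R (fun z => B z.2 * a (sub z.1 z.2))).
by apply: measurable_funM; [exact: (measurableT_comp mB measurable_snd)|exact: msub2].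
Qed.

Let mkernel : measurable_fun setT kernel_part.
Proof.
apply: (@measurable_pint R (fun z => B z.2 * (kr z.1 (sub z.1 z.2) * a (sub z.1 z.2)))).
apply: measurable_funM; first exact: (measurableT_comp mB measurable_snd).
by apply: measurable_funM => //; exact: msub2.
Qed.

Let plain_part_ge0 xi : (0 <= plain_part xi)%E.
Proof. by apply: pint_ge0 => eta; rewrite mulr_ge0. Qed.

Let kernel_part_ge0 xi : (0 <= kernel_part xi)%E.
Proof. by apply: pint_ge0 => eta; rewrite mulr_ge0// mulr_ge0// ker_ge0. Qed.

Let Q : R := (pi / e) ^+ 2.
Let K2 : R := (2 / (1 - s)) ^+ 2.

(** The Cauchy-Schwarz inequality with the square root of [planeweight] as one
    factor: it leaves the integral of [planeweight] and, in the other factor, its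
    reciprocal, which is at most 4 times the weight. *)
Let plain_part_le xi : (plain_part xi * plain_part xi <= Q%:E * pint (fun eta => (B eta ^+ 2 * (4 * W (sub xi eta)))%R))%E.
Proof.
pose u eta := Num.sqrt (pw (sub xi eta)).
pose v eta := Num.sqrt (4 * W (sub xi eta)) * B eta.
have msqrt : measurable_fun setT (@Num.sqrt R).
  by apply: continuous_measurable_fun; exact: sqrt_continuous.
have mu_ : measurable_fun setT u.
  by apply: (measurableT_comp msqrt); apply: msub; exact: measurable_planeweight.
have mv : measurable_fun setT v.
  apply: measurable_funM => //; apply: (measurableT_comp msqrt).
  by apply: measurable_funM => //; exact: msub.
have u0 eta : 0 <= u eta by exact: sqrtr_ge0.
have v0 eta : 0 <= v eta by rewrite mulr_ge0 ?sqrtr_ge0.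
have H : (plain_part xi <= pint (fun eta => (u eta * v eta)%R))%E.
  apply: ae_le_pint.
  - by apply: measurable_funM => //; exact: msub.
  - exact: measurable_funM.
  - by move=> eta; rewrite mulr_ge0.
  - by move=> eta; rewrite mulr_ge0.
  have ax : {ae mu2, forall eta : mplane, (sub xi eta).1 != 0 /\ (sub xi eta).2 != 0}.
    apply: filterS (ae_off_cross xi) => z [h1 h2].
    by rewrite /sub /= !subr_eq0; split; rewrite eq_sym.
  apply: filterS ax => eta [ax1 ax2].
  rewrite /u /v mulrA (mulrC (B eta)) ler_wpM2r//.
  rewrite -sqrtrM ?planeweight_ge0//.
  rewrite -[leLHS]ger0_norm// -sqrtr_sqr ler_wsqrtr//.
  have := planeweight_wt he halpha hbeta ax1 ax2 => P.
  rewrite /W (_ : _ * (4 * _) = pw (sub xi eta) * (4 * weight (sub xi eta)) * a (sub xi eta) ^+ 2); last by ring.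
  by rewrite ler_peMl ?sqr_ge0.
have T0 := plain_part_ge0 xi.
apply: le_trans (lee_pmul T0 T0 H H) _; apply: le_trans (cs_pint mu_ mv u0 v0) _.
apply: lee_pmul.
- by apply: pint_ge0 => eta; exact: sqr_ge0.
- by apply: pint_ge0 => eta; exact: sqr_ge0.
- rewrite /u (_ : (fun x => _) = fun eta => pw (sub xi eta)); last first.
    by apply/funext => eta; rewrite sqr_sqrtr// planeweight_ge0.
  rewrite pint_reflect; [exact: pint_planeweight|exact: measurable_planeweight|].
  by move=> z; exact: planeweight_ge0.
- rewrite le_eqVlt; apply/orP; left; apply/eqP; congr pint; apply/funext => eta.
  by rewrite /v exprMn sqr_sqrtr 1?mulrC// mulr_ge0.
Qed.

Let kernel_part_le xi : (kernel_part xi * kernel_part xi <= pint (fun eta => (B eta ^+ 2)%R) *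
   pint (fun z => (kr xi z ^+ 2 * a z ^+ 2)%R))%E.
Proof.
have mka : measurable_fun setT (fun eta => kr xi (sub xi eta) * a (sub xi eta)).
  by apply: measurable_funM; [exact: mker_sub|exact: msub].
have ka0 eta : 0 <= kr xi (sub xi eta) * a (sub xi eta) by rewrite mulr_ge0 ?ker_ge0.
apply: le_trans (cs_pint mB mka B0 ka0) _.
rewrite le_eqVlt; apply/orP; left; apply/eqP; congr (_ * _)%E.
rewrite -[RHS](pint_reflect xi).
- by congr pint; apply/funext => eta; rewrite exprMn.
- apply: measurable_funM; apply: measurable_funX => //.
  have mp : measurable_fun setT (fun z : mplane => (xi, z) : mplane * mplane).
    exact: measurable_fun_pair.
  exact: (measurableT_comp (@measurable_ker R s) mp).
- by move=> z; rewrite mulr_ge0 ?sqr_ge0.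
Qed.

Let NB := pint (fun eta => (B eta ^+ 2)%R).
Let NW := pint W.

Let mB2 : measurable_fun setT (fun eta => B eta ^+ 2).
Proof. exact: measurable_funX. Qed.

Let int_plain_part : (\int[mu2]_xi (plain_part xi * plain_part xi) <= (4 * Q)%:E * (NW * NB))%E.
Proof.
have Q0 : 0 <= Q by exact: sqr_ge0.
have mW4 : measurable_fun setT (fun z => 4 * W z) by exact: measurable_funM.
have W40 z : 0 <= 4 * W z by rewrite mulr_ge0.
have mI : measurable_fun setT (fun xi : mplane => pint (fun eta => (B eta ^+ 2 * (4 * W (sub xi eta)))%R)).
  apply: (@measurable_pint R (fun z => B z.2 ^+ 2 * (4 * W (sub z.1 z.2)))).
  apply: measurable_funM; first exact: (measurableT_comp mB2 measurable_snd).
  exact: (msub2 mW4).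
have I0 (xi : mplane) : (0 <= pint (fun eta => (B eta ^+ 2 * (4 * W (sub xi eta)))%R))%E.
  by apply: pint_ge0 => eta; rewrite mulr_ge0 ?sqr_ge0.
apply: (@le_trans _ _ (\int[mu2]_xi (Q%:E * pint (fun eta => (B eta ^+ 2 * (4 * W (sub xi eta)))%R)))%E).
  apply: ge0_le_integral => //.
  - by move=> xi _; rewrite mule_ge0.
  - exact: emeasurable_funM.
  - exact: emeasurable_funM.
rewrite ge0_integralZl//.
have C := @pint_convolution R (fun eta => B eta ^+ 2) (fun z => 4 * W z) mB2 mW4 (fun x => sqr_ge0 _) W40.
rewrite [X in (_ * X)%E]C pintZ// -/NW -/NB.
by rewrite (muleC NB) -(muleA 4%:E) (muleA Q%:E) -EFinM (mulrC Q).
Qed.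

(** After Tonelli's theorem the square of the kernel is integrated first in xi,
    where [pint_ker] gives a multiple of |z|^2, which is below the weight. *)
Let int_kernel_part : (\int[mu2]_xi (kernel_part xi * kernel_part xi) <= K2%:E * (NW * NB))%E.
Proof.
have K0 : 0 <= K2 by exact: sqr_ge0.
have mk2 : measurable_fun setT (fun z : mplane * mplane => kr z.1 z.2 ^+ 2 * a z.2 ^+ 2).
  apply: measurable_funM; apply: measurable_funX; first exact: measurable_ker.
  exact: (measurableT_comp ma measurable_snd).
have ma2 : measurable_fun setT (fun z => a z ^+ 2) by exact: measurable_funX.
have mI : measurable_fun setT (fun xi : mplane => pint (fun z => (kr xi z ^+ 2 * a z ^+ 2)%R)).
  exact: (@measurable_pint R (fun z => kr z.1 z.2 ^+ 2 * a z.2 ^+ 2)).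
have I0 (xi : mplane) : (0 <= pint (fun z => (kr xi z ^+ 2 * a z ^+ 2)%R))%E.
  by apply: pint_ge0 => z; rewrite mulr_ge0 ?sqr_ge0.
have NB0 : (0 <= NB)%E by apply: pint_ge0 => z; rewrite sqr_ge0.
apply: (@le_trans _ _ (\int[mu2]_xi (NB * pint (fun z => (kr xi z ^+ 2 * a z ^+ 2)%R)))%E).
  apply: ge0_le_integral => //.
  - by move=> xi _; rewrite mule_ge0.
  - exact: emeasurable_funM.
  - exact: emeasurable_funM.
rewrite ge0_integralZl// [X in (_ <= X)%E]muleA [X in (_ <= X)%E]muleC lee_wpmul2l//.
have F := @pint_tonelli R (fun z => kr z.1 z.2 ^+ 2 * a z.2 ^+ 2) mk2.
rewrite F; last by move=> z; rewrite mulr_ge0 ?sqr_ge0.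
have mk1 z : measurable_fun setT (fun xi : mplane => kr xi z ^+ 2).
  apply: measurable_funX.
  have mp : measurable_fun setT (fun x : mplane => (x, z) : mplane * mplane).
    exact: measurable_fun_pair.
  exact: (measurableT_comp (@measurable_ker R s) mp).
rewrite /NW -(pintZ mW W0 K0); apply: ge0_le_integral; [exact: measurableT|..].
- by move=> z _; apply: pint_ge0 => xi; rewrite mulr_ge0 ?sqr_ge0.
- have msw : measurable_fun setT (fun z : mplane * mplane => kr z.2 z.1 ^+ 2 * a z.1 ^+ 2).
    have mp : measurable_fun setT (fun z : mplane * mplane => (z.2, z.1) : mplane * mplane).
      exact: measurable_fun_pair.
    exact: (measurableT_comp mk2 mp).
  exact: (@measurable_pint R (fun z => kr z.2 z.1 ^+ 2 * a z.1 ^+ 2)).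
- by apply/measurable_EFinP; apply: measurable_funM => //; exact: measurable_cst.
move=> z _ /=.
rewrite (_ : (fun x => _) = (fun xi : mplane => a z ^+ 2 * kr xi z ^+ 2)); last first.
  by apply/funext => xi; rewrite mulrC.
rewrite (pintZ (mk1 z) (fun xi => sqr_ge0 _) (sqr_ge0 _)).
apply: le_trans (lee_wpmul2l _ (pint_ker hs z)) _; first by rewrite lee_fin sqr_ge0.
rewrite -EFinM lee_fin -/K2 /W mulrC -mulrA ler_wpM2l// ler_wpM2r ?sqr_ge0//.
have [e0 e1] := andP he.
rewrite -[enorm z]powRr1 ?enorm_ge0//; apply: powR_sqr_le_wt; first by [].
rewrite (le_trans halpha) ?(le_trans _ hbeta)//; first by rewrite lerDl ltW.
by rewrite gerBl ltW.
Qed.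

Variable H : mplane -> R.
Hypotheses (mH : measurable_fun setT H) (H0 : forall x, 0 <= H x).
Hypothesis HH : forall xi, ((H xi)%:E <= pint (fun eta => (b eta * a (sub xi eta))%R))%E.

Let pointwise (xi : mplane) : xi <> 0 ->
  ((enorm xi `^ (- s) * H xi)%:E <= 2%:E * plain_part xi + 2%:E * kernel_part xi)%E.
Proof.
move=> xi0.
have mba : measurable_fun setT (fun eta => b eta * a (sub xi eta)).
  by apply: measurable_funM => //; exact: msub.
have m1 : measurable_fun setT (fun eta => B eta * a (sub xi eta)).
  by apply: measurable_funM => //; exact: msub.
have m2 : measurable_fun setT (fun eta => B eta * (kr xi (sub xi eta) * a (sub xi eta))).
  by apply: measurable_funM => //; apply: measurable_funM => //; exact: msub.
have p1 eta : 0 <= B eta * a (sub xi eta) by rewrite mulr_ge0.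
have p2 eta : 0 <= B eta * (kr xi (sub xi eta) * a (sub xi eta)).
  by rewrite mulr_ge0// mulr_ge0// ker_ge0.
rewrite EFinM; apply: le_trans (lee_wpmul2l _ (HH xi)) _; first by rewrite lee_fin powR_ge0.
rewrite -pintZ ?powR_ge0//; last by move=> eta; rewrite mulr_ge0.
rewrite -!pintZ// -pintD; last 4 first.
- exact: measurable_funM.
- exact: measurable_funM.
- by move=> eta; rewrite mulr_ge0.
- by move=> eta; rewrite mulr_ge0.
apply: ae_le_pint.
- exact: measurable_funM.
- by apply: measurable_funD; exact: measurable_funM.
- by move=> eta; rewrite mulr_ge0 ?powR_ge0// mulr_ge0.
- by move=> eta; rewrite addr_ge0// mulr_ge0.
have N0 : {ae mu2, forall z : mplane, z <> (0 : R * R)} := ae_plane_neq _.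
apply: filterS N0 => eta eta0.
have S := ker_split hs xi0 eta0.
have P0 : 0 <= b eta * a (sub xi eta) by rewrite mulr_ge0.
apply: le_trans (ler_wpM2r P0 S) _; rewrite le_eqVlt; apply/orP; left; apply/eqP.
by rewrite /B -/(sub xi eta); ring.
Qed.

(** The integrand is split by [ker_split] into two parts, whose squares have been
    integrated above. *)
Lemma weighted_convolution_le :
  (pint (fun xi => ((enorm xi `^ (- s) * H xi) ^+ 2)%R) <=
   (8 * (4 * Q + K2))%:E *
   (pint (fun z => ((enorm z `^ alpha * a z) ^+ 2)%R) + pint (fun z => ((enorm z `^ beta * a z) ^+ 2)%R)) *
   pint (fun eta => ((enorm eta `^ (- s) * b eta) ^+ 2)%R))%E.
Proof.
have Q0 : 0 <= Q by exact: sqr_ge0.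
have K0 : 0 <= K2 by exact: sqr_ge0.
have NB0 : (0 <= NB)%E by apply: pint_ge0 => z; rewrite sqr_ge0.
have NW0 : (0 <= NW)%E by exact: pint_ge0.
have mp p : measurable_fun setT (fun z : mplane => (enorm z `^ p * a z) ^+ 2).
  by apply: measurable_funX; apply: measurable_funM => //; exact: measurable_enorm_powR.
rewrite -pintD//; [|by move=> z; exact: sqr_ge0..].
rewrite -/NB; set S := pint (fun x => _ + _).
have -> : S = NW by congr pint; apply/funext => z; rewrite /W !exprMn -mulrDl.
have mL : measurable_fun setT (fun xi : mplane => enorm xi `^ (- s) * H xi).
  by apply: measurable_funM => //; exact: measurable_enorm_powR.
have mTT1 : measurable_fun setT (fun xi => plain_part xi * plain_part xi)%E by exact: emeasurable_funM.
have mTT2 : measurable_fun setT (fun xi => kernel_part xi * kernel_part xi)%E by exact: emeasurable_funM.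
have TT1 xi : (0 <= plain_part xi * plain_part xi)%E by rewrite mule_ge0.
have TT2 xi : (0 <= kernel_part xi * kernel_part xi)%E by rewrite mule_ge0.
(* 8 = 2 * 2^2: the factor 2 of the pointwise bound is squared, and
   (x + y)^2 <= 2 x^2 + 2 y^2 *)
apply: (@le_trans _ _ (\int[mu2]_xi (8%:E * (plain_part xi * plain_part xi) + 8%:E * (kernel_part xi * kernel_part xi)))%E).
  apply: ae_ge0_le_integral => //.
  - by move=> xi _; rewrite lee_fin sqr_ge0.
  - by apply/measurable_EFinP; exact: measurable_funX.
  - by move=> xi _; rewrite adde_ge0// mule_ge0.
  - by apply: emeasurable_funD; exact: emeasurable_funM.
  have N0 : {ae mu2, forall z : mplane, z <> (0 : R * R)} := ae_plane_neq _.
apply: filterS N0 => xi xi0 _.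
  have P := pointwise xi0.
  have L0 : (0 <= (enorm xi `^ (- s) * H xi)%:E)%E by rewrite lee_fin mulr_ge0 ?powR_ge0.
  rewrite expr2 EFinM; apply: le_trans (lee_pmul L0 L0 P P) _.
  apply: le_trans (sqrD_le_ereal _ _) _; [by rewrite mule_ge0|by rewrite mule_ge0|].
  by rewrite !sqr_double_ereal.
rewrite ge0_integralD//; last 4 first.
- by move=> xi _; rewrite mule_ge0.
- exact: emeasurable_funM.
- by move=> xi _; rewrite mule_ge0.
- exact: emeasurable_funM.
rewrite !ge0_integralZl//.
apply: (@le_trans _ _ (8%:E * ((4 * Q)%:E * (NW * NB)) + 8%:E * (K2%:E * (NW * NB)))%E).
  by apply: leeD; rewrite lee_wpmul2l.
have Q4 : 0 <= 4 * Q by rewrite mulr_ge0.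
rewrite -ge0_muleDr; [|by rewrite mule_ge0// mule_ge0..].
by rewrite -ge0_muleDl ?lee_fin// (EFinM 8) EFinD -!muleA lexx.
Qed.

End Fixed.

End Core.

(** * Fourier transforms as distributions *)

Section L2norms.
Context (R : realType).
Notation mR := (measurableTypeR R).
Notation mplane := (mR * mR)%type.
Notation mu2 := (@plane_mu R).
Implicit Types f g w u : R * R -> R[i].

Lemma L2norm_sqrte f : L2norm f = sqrte (N2 f).
Proof.
rewrite /L2norm unlock -poweR12_sqrt ?N2_ge0//; congr (_ `^ _)%E.
apply: eq_integral => x _ /=.
by rewrite powR_mulrn ?normr_ge0// normr_sqr.
Qed.

Lemma L2norm_ge0 f : (0 <= L2norm f)%E.
Proof. by rewrite L2norm_sqrte sqrte_ge0. Qed.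

Lemma L2norm_sqr f : (L2norm f * L2norm f = N2 f)%E.
Proof. by rewrite L2norm_sqrte -expe2 sqr_sqrte// N2_ge0. Qed.

Lemma L2norm_le_sqr f (z : \bar R) : (0 <= z)%E -> (N2 f <= z * z)%E -> (L2norm f <= z)%E.
Proof.
move=> z0 H; rewrite L2norm_sqrte.
have : (sqrte (N2 f) <= sqrte (z * z))%E by rewrite lee_sqrt// mule_ge0.
by move=> /le_trans; apply; rewrite -expe2 sqrte_sqr gee0_abs.
Qed.

Lemma L2norm_le f g (c : R) : 0 <= c -> (N2 f <= (c ^+ 2)%:E * N2 g)%E ->
  (L2norm f <= c%:E * L2norm g)%E.
Proof.
move=> c0 H; apply: L2norm_le_sqr; first by rewrite mule_ge0 ?L2norm_ge0.
by rewrite muleACA -EFinM -expr2 L2norm_sqr.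
Qed.

Lemma L2funE f : L2fun f -> inL2 f.
Proof.
move=> [mf nf]; split => //; rewrite -L2norm_sqr.
have n0 := L2norm_ge0 f; move: nf n0; case: (L2norm f) => // r _ _.
by rewrite -EFinM ltry.
Qed.

Lemma inL2_lty f : cmeas (f : mplane -> _) -> (L2norm f < +oo)%E -> inL2 f.
Proof. by move=> mf nf; apply: L2funE. Qed.

End L2norms.

Section Tempered.
Context (R : realType).
Notation mR := (measurableTypeR R).
Notation mplane := (mR * mR)%type.
Notation mu2 := (@plane_mu R).
Implicit Types f g w u v phi : mplane -> R[i].

Lemma gchar0 (a : R) b : gchar a b 0 = fun x => real_complex R (gau2 a b x).
Proof.
apply/funext => x; rewrite /gchar (_ : dotp x 0 = 0) ?expi0 ?mulr1//.
by rewrite /dotp /= !mulr0 addr0.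
Qed.

Lemma schwartz_gau2 (a : R) b : 0 < a -> schwartz (fun x => real_complex R (gau2 a b x)).
Proof. by move=> a0; rewrite -gchar0; exact: schwartz_gchar. Qed.

Lemma tempered_gauss w : tempered_fun w ->
  forall a b, 0 < a -> cintable mu2 (fun x => w x * real_complex R (gau2 a b x)).
Proof. by move=> tw a b a0; exact: (tw _ (schwartz_gau2 b a0)). Qed.

Lemma tempered_cmeas w : tempered_fun w -> cmeas w.
Proof. by move=> tw; apply: gauss_cmeas; apply: tempered_gauss. Qed.

Lemma schwartz_inL12 phi : schwartz phi -> inL12 phi.
Proof.
move=> sp; have Ip := schwartz_cintable sp; have [M [M0 HM]] := schwartz_bounded sp.
split=> //; apply: (@le_lt_trans _ _ (\int[mu2]_x (M%:E * (nrm (phi x))%:E))%E).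
  apply: ge0_le_integral => //.
  - by move=> x _; rewrite lee_fin sqr_ge0.
  - by apply: measurable_N2; exact: schwartz_cmeas.
  - apply: emeasurable_funM => //; apply/measurable_EFinP; apply: measurable_nrm.
    exact: schwartz_cmeas.
  - by move=> x _; rewrite -EFinM lee_fin expr2 ler_wpM2r ?nrm_ge0.
rewrite ge0_integralZl ?lee_fin ?(ltW M0)//.
- by rewrite lte_mul_pinfty ?lee_fin ?(ltW M0)//; exact: cintable_lty.
- by apply/measurable_EFinP; apply: measurable_nrm; exact: schwartz_cmeas.
- by move=> x _; rewrite lee_fin nrm_ge0.
Qed.

Lemma inL2_tempered w : inL2 w -> tempered_fun w.
Proof.
by move=> Lw phi sp; rewrite cintegrableE; apply: cintableM_L2 => //; exact: inL12_L2 (schwartz_inL12 sp).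
Qed.

Lemma tempered_unique v w : tempered_fun v ->
  (forall a b, 0 < a -> cintable mu2 (fun x => w x * real_complex R (gau2 a b x))) ->
  (forall a b, 0 < a -> cintg mu2 (fun x => v x * real_complex R (gau2 a b x)) =
                        cintg mu2 (fun x => w x * real_complex R (gau2 a b x))) ->
  {ae mu2, forall x, v x = w x}.
Proof. by move=> tv Iw E; apply: gauss_unique => // a b a0; exact: tempered_gauss. Qed.

(** Only real Gaussians are used as test functions; on them the distributional
    transform is given by [L2_fourier_duality]. *)
Lemma fourierD_L2 g G v : L2_fourier g G -> represents v (fourierD (distr_of g)) ->
  {ae mu2, forall x, v x = G x}.
Proof.
move=> gG [tv E]; have [_ LG _] := gG.
apply: tempered_unique => // [a b a0|a b a0]; first exact: inL2_gauss.
have /esym := E _ (schwartz_gau2 b a0); rewrite /fourierD /distr_of !cintE => ->.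
by rewrite (L2_fourier_duality gG (inL12_gau2 b a0)).
Qed.

Lemma ifourier_gchar (a : R) (b x : mplane) : 0 < a ->
  ifourier (gchar (4 * a)^-1 0 (- b.1, - b.2)) x = real_complex R (a / pi * gau2 a b x).
Proof.
move=> a0; have a4 : 0 < (4 * a)^-1 by rewrite invr_gt0 mulr_gt0.
rewrite /Defs.ifourier cintE.
transitivity (real_complex R ((2 * pi) ^- 2) *
    cintg mu2 (gchar (4 * a)^-1 0 (x.1 - b.1, x.2 - b.2))).
  congr (_ * _); apply: eq_cintg => y; rewrite /gchar -mulrA -expiD; congr (_ * expi _).
  by rewrite /dotp /=; ring.
rewrite cintg_gchar// (_ : dotp 0 _ = 0) ?expi0 ?mulr1; last by rewrite /dotp /= !mul0r addr0.
rewrite -rcM; congr (real_complex R _).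
have p0 : pi != 0 :> R by rewrite gt_eqF// pi_gt0.
have an : a != 0 by rewrite gt_eqF.
rewrite (_ : gau2 a b x = expR (- (dotp (x.1 - b.1, x.2 - b.2) (x.1 - b.1, x.2 - b.2) / (4 / (4 * a))))).
  by move: p0; generalize (@pi R) => q p0; field; rewrite ?an ?p0.
by congr expR; rewrite /dotp /=; field.
Qed.

Lemma ifourier_conj phi x : cintable mu2 phi -> ifourier phi x =
  real_complex R ((2 * pi) ^- 2) * conjc (fourier (fun y => conjc (phi y)) x).
Proof.
move=> Ip; rewrite /Defs.ifourier /Defs.fourier !cintE; congr (_ * _).
rewrite -cintgJ; last by apply: cintable_char; exact: cintableJ.
apply: eq_cintg => y; rewrite conjM conjcK expiN conjcK; congr (_ * expi _).
exact: dotpC.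
Qed.

Lemma ifourier_gau2_fourier (a : R) (b x : mplane) : 0 < a ->
  ifourier (fourier (fun x => real_complex R (gau2 a b x))) x = real_complex R (gau2 a b x).
Proof.
move=> a0; have a4 : 0 < (4 * a)^-1 by rewrite invr_gt0 mulr_gt0.
have p0 : pi != 0 :> R by rewrite gt_eqF// pi_gt0.
have an : a != 0 by rewrite gt_eqF.
transitivity (real_complex R (pi / a) * ifourier (gchar (4 * a)^-1 0 (- b.1, - b.2)) x).
  rewrite /Defs.ifourier !cintE [RHS]mulrCA; congr (_ * _); rewrite -cintgZ.
    apply: eq_cintg => y; rewrite fourier_gau2// mulrA; congr (_ * _ * _).
    rewrite /gchar conjM conj_real -expiN; congr (_ * expi _).
    by rewrite /dotp /=; ring.
  apply: (cintable_le _ _ (integrable_gau2 0 a4)).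
    apply: cmeasM; first exact: cmeas_gchar.
    apply: cmeas_expi; rewrite (_ : dotp x = fun y => dotp y x); first exact: measurable_dotp.
    by apply/funext => y; exact: dotpC.
  by move=> y; rewrite nrmM nrm_expi mulr1 nrm_gchar.
rewrite ifourier_gchar// -rcM; congr (real_complex R _).
by move: p0; generalize (@pi R) => q p0; field; rewrite ?an ?p0.
Qed.

(** On Gaussians the inverse transform of the transform is explicit. *)
Lemma ifourier_fourierD w v : tempered_fun w ->
  represents v (fourierD (ifourierD (distr_of w))) -> {ae mu2, forall x, v x = w x}.
Proof.
move=> tw [tv E]; apply: tempered_unique => // [a b a0|a b a0]; first exact: tempered_gauss.
have /esym := E _ (schwartz_gau2 b a0); rewrite /fourierD /ifourierD /distr_of !cintE => ->.
by apply: eq_cintg => x; rewrite ifourier_gau2_fourier.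
Qed.

(** If u is square integrable, w agrees with the transform W of u almost
    everywhere: they have the same integrals against Gaussians, each of which is
    an inverse transform of a modulated Gaussian. *)
Lemma ifourierD_bound w u : tempered_fun w -> represents u (ifourierD (distr_of w)) ->
  (L2norm w <= (4 * pi)%:E * L2norm u)%E.
Proof.
move=> tw [tu E]; have pp : 0 < 4 * pi :> R by rewrite mulr_gt0// pi_gt0.
have [uoo|] := eqVneq (L2norm u) +oo%E; first by rewrite uoo gt0_muley ?lte_fin// leey.
rewrite -ltey => /(inL2_lty (tempered_cmeas tu)) Lu.
have [W uW] := L2_fourier_exists Lu; have [_ LW _] := uW.
have wW : {ae mu2, forall x, w x = W x}.
  apply: tempered_unique => // [a b a0|a b a0]; first exact: inL2_gauss.
  have a4 : 0 < (4 * a)^-1 by rewrite invr_gt0 mulr_gt0.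
  have p0 : pi != 0 :> R by rewrite gt_eqF// pi_gt0.
  have an : a != 0 by rewrite gt_eqF.
  rewrite (L2_fourier_duality uW (inL12_gau2 b a0)).
  have := E _ (schwartz_gchar 0 (- b.1, - b.2) a4).
  rewrite /ifourierD /distr_of !cintE => H.
  have E1 : cintg mu2 (fun x => w x * ifourier (gchar (4 * a)^-1 0 (- b.1, - b.2)) x) =
      real_complex R (a / pi) * cintg mu2 (fun x => w x * real_complex R (gau2 a b x)).
    rewrite -cintgZ; last exact: tempered_gauss.
    by apply: eq_cintg => x; rewrite ifourier_gchar// rcM; ring.
  have E2 : cintg mu2 (fun x => u x * fourier (fun x => real_complex R (gau2 a b x)) x) =
      real_complex R (pi / a) * cintg mu2 (fun x => u x * gchar (4 * a)^-1 0 (- b.1, - b.2) x).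
    rewrite -cintgZ; last by exact: (tu _ (schwartz_gchar _ _ a4)).
    apply: eq_cintg => x; rewrite fourier_gau2// mulrCA; congr (_ * (_ * _)).
    rewrite /gchar conjM conj_real -expiN; congr (_ * expi _).
    by rewrite /dotp /=; ring.
  rewrite E2 -H E1 mulrA -rcM (_ : pi / a * (a / pi) = 1) ?mul1r//.
  by move: p0; generalize (@pi R) => q p0; field; rewrite ?an ?p0.
apply: L2norm_le; first exact: ltW.
rewrite (ae_eq_N2 (tempered_cmeas tw) _ wW); last by case: LW.
by rewrite exprMn (_ : 4 ^+ 2 = 16); [exact: L2_fourier_bound uW|ring].
Qed.

(** The inverse transform is (2 pi)^-2 times the conjugate of the transform of the
    conjugate. *)
Lemma ifourierD_exists w : inL2 w ->
  exists2 u, represents u (ifourierD (distr_of w)) & (L2norm u <= (pi^-1)%:E * L2norm w)%E.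
Proof.
move=> Lw; have [W wW] := L2_fourier_exists (inL2J Lw); have [_ LW _] := wW.
have p0 : pi != 0 :> R by rewrite gt_eqF// pi_gt0.
set c : R := (2 * pi) ^- 2.
exists (fun x => real_complex R c * conjc (W x)).
  split.
    apply: inL2_tempered; have [mJ NJ] := inL2J LW.
    split; first by apply: cmeasM => //; exact: cmeas_cst.
    by rewrite N2Z// lte_mul_pinfty// lee_fin sqr_ge0.
  move=> phi sp; rewrite /ifourierD /distr_of !cintE.
  have Lp := schwartz_inL12 sp; have LpJ := inL12J Lp.
  have LF := inL2_fourier LpJ; have [Ip _] := Lp.
  transitivity (real_complex R c * cintg mu2 (fun x => w x * conjc (fourier (fun y => conjc (phi y)) x))).
    rewrite -cintgZ; last by apply: cintableM_L2 => //; exact: inL2J.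
    by apply: eq_cintg => x; rewrite (ifourier_conj x Ip) mulrCA.
  transitivity (real_complex R c * cintg mu2 (fun x => conjc (W x) * phi x)); last first.
    rewrite -cintgZ; last by apply: cintableM_L2; [exact: inL2J|exact: inL12_L2].
    by apply: eq_cintg => x; rewrite mulrA.
  congr (_ * _); have D := L2_fourier_duality wW LpJ.
  transitivity (conjc (cintg mu2 (fun x => W x * conjc (phi x)))).
    rewrite D -cintgJ; last by apply: cintableM_L2 => //; exact: inL2J.
    by apply: eq_cintg => x; rewrite conjM conjcK.
  rewrite -cintgJ; last by apply: cintableM_L2 => //; exact: inL12_L2.
  by apply: eq_cintg => x; rewrite conjM conjcK.
apply: L2norm_le; first by rewrite invr_ge0 pi_ge0.
rewrite N2Z; last by have [] := inL2J LW.
rewrite N2J; apply: (@le_trans _ _ ((nrm (real_complex R c) ^+ 2)%:E * ((16 * pi ^+ 2)%:E * N2 w))%E).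
  rewrite lee_wpmul2l ?lee_fin ?sqr_ge0//; have := L2_fourier_bound wW; rewrite N2J//.
rewrite muleA -EFinM nrm_real normr_sqr /c (_ : _ * _ = pi^-1 ^+ 2)//.
by move: p0; generalize (@pi R) => q p0; field.
Qed.

End Tempered.

(** * Homogeneous Sobolev norms *)

Section Sobolev.
Context (R : realType).
Notation mR := (measurableTypeR R).
Notation mplane := (mR * mR)%type.
Notation mu2 := (@plane_mu R).
Implicit Types f g w u v phi : mplane -> R[i].

Lemma nrm_riesz (s : R) w x : nrm (riesz_mul s w x) = enorm x `^ s * nrm (w x).
Proof. by rewrite /riesz_mul nrmM nrm_real ger0_norm ?powR_ge0. Qed.

Lemma N2_riesz (s : R) w : N2 (riesz_mul s w) = pint (fun x => (enorm x `^ s * nrm (w x)) ^+ 2).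
Proof. by apply: eq_integral => x _; rewrite nrm_riesz. Qed.

Lemma cmeas_riesz (s : R) w : cmeas w -> cmeas (riesz_mul s w : mplane -> _).
Proof. by move=> mw; apply: cmeasM => //; apply: cmeas_real; exact: measurable_enorm_powR. Qed.

Lemma ae_riesz (s : R) v w : {ae mu2, forall x, v x = w x} ->
  {ae mu2, forall x, riesz_mul s v x = riesz_mul s w x}.
Proof. by move=> vw; apply: filterS vw => x E; rewrite /riesz_mul E. Qed.

Lemma ae_rieszM (s t : R) w :
  {ae mu2, forall x, riesz_mul t (riesz_mul s w) x = riesz_mul (s + t) w x}.
Proof.
have N0 : {ae mu2, forall z : mplane, z <> (0 : R * R)} := ae_plane_neq _.
apply: filterS N0 => x /enorm_gt0 x0.
rewrite /riesz_mul mulrA -rcM mulrC [in RHS]mulrC; congr (_ * real_complex R _).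
by rewrite powRD; [exact: mulrC|rewrite (gt_eqF x0) implybT].
Qed.

Lemma L2norm_ae v w : cmeas v -> cmeas w -> {ae mu2, forall x, v x = w x} ->
  L2norm v = L2norm w.
Proof. by move=> mv mw vw; rewrite !L2norm_sqrte (ae_eq_N2 mv mw vw). Qed.

Lemma le_mul_inf (c : R) (L : \bar R) (S : set (\bar R)) : 0 < c ->
  (forall y, S y -> (L <= c%:E * y)%E) -> (L <= c%:E * ereal_inf S)%E.
Proof.
move=> c0 H; rewrite -lee_pdivrMl//; apply: le_ereal_inf_tmp => y Sy.
by rewrite lee_pdivrMl//; exact: H.
Qed.

Lemma Hnorm_ge0 (t : R) (T : distr R) : (0 <= Hnorm t T)%E.
Proof.
apply: le_ereal_inf_tmp => _ [U _ <-]; apply: le_ereal_inf_tmp => _ [u _ <-].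
exact: L2norm_ge0.
Qed.

(** Every function from which the norm can be computed agrees with |xi|^t w almost
    everywhere, and [ifourierD_bound] bounds its inverse transform below. *)
Lemma Hnorm_ge (t : R) (T : distr R) w : cmeas w ->
  (forall v, represents v (fourierD T) -> {ae mu2, forall x, v x = w x}) ->
  (L2norm (riesz_mul t w) <= (4 * pi)%:E * Hnorm t T)%E.
Proof.
move=> mw Hv; have pp : 0 < 4 * pi :> R by rewrite mulr_gt0// pi_gt0.
apply: le_mul_inf => // _ [_ [v [rv tv ->]] <-].
apply: le_mul_inf => // _ [u ru <-].
have := ifourierD_bound tv ru; apply: le_trans.
rewrite le_eqVlt; apply/orP; left; apply/eqP; apply: L2norm_ae.
- exact: cmeas_riesz.
- exact: tempered_cmeas.
- by apply: ae_riesz; apply: filterS (Hv _ rv) => x ->.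
Qed.

(** |nabla|^s f has the transform |xi|^s F, to which [Hnorm_ge] applies for both
    exponents of the intersection. *)
Lemma norm_capH_ge (s t1 t2 : R) f F : L2_fourier f F ->
  (L2norm (riesz_mul (s + t1) F) + L2norm (riesz_mul (s + t2) F) <=
   (4 * pi)%:E * norm_fracD (capnorm (Hnorm t1) (Hnorm t2)) s (distr_of f))%E.
Proof.
move=> fF; have [_ [mF _] _] := fF.
have pp : 0 < 4 * pi :> R by rewrite mulr_gt0// pi_gt0.
apply: le_mul_inf => // _ [_ [v [rv tv ->]] <-].
have vF := fourierD_L2 fF rv; have mw := tempered_cmeas tv.
rewrite /capnorm ge0_muleDr ?Hnorm_ge0//.
have H t : (L2norm (riesz_mul (s + t) F) <=
    (4 * pi)%:E * Hnorm t (ifourierD (distr_of (riesz_mul s v))))%E.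
  apply: (le_trans _ (Hnorm_ge t mw (fun v' rv' => ifourier_fourierD tv rv'))).
  rewrite le_eqVlt; apply/orP; left; apply/eqP; apply: L2norm_ae.
  - exact: cmeas_riesz.
  - exact: cmeas_riesz.
  - have h1 : {ae mu2, forall x : mplane,
        riesz_mul t (riesz_mul s F) x = riesz_mul (s + t) F x} := ae_rieszM s t F.
    have h2 : {ae mu2, forall x : mplane,
        riesz_mul t (riesz_mul s v) x = riesz_mul t (riesz_mul s F) x} :=
      ae_riesz t (ae_riesz s vF).
    have h3 : {ae mu2, forall x : mplane,
        riesz_mul (s + t) F x = riesz_mul t (riesz_mul s v) x}.
      by apply: filterS2 h1 h2 => x -> ->.
    exact: h3.
by apply: leeD; exact: H.
Qed.

(** The transform of an integrable function is bounded, hence tempered; if its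
    weighted norm is finite, [ifourierD_exists] provides a representing
    function. *)
Lemma norm_fracD_le (t : R) h : cintable mu2 h ->
  (norm_fracD (@L2normD R) t (distr_of h) <=
   (pi^-1)%:E * L2norm (riesz_mul t (fourier h)))%E.
Proof.
move=> Ih; have mF := cmeas_fourier (cintable_meas Ih).
have mw := cmeas_riesz t mF.
have pp : 0 < pi^-1 :> R by rewrite invr_gt0 pi_gt0.
have [woo|] := eqVneq (L2norm (riesz_mul t (fourier h))) +oo%E.
  by rewrite woo gt0_muley ?lte_fin// leey.
rewrite -ltey => /(inL2_lty mw) Lw.
have [u ru Hu] := ifourierD_exists Lw; apply: le_trans Hu.
apply: (@le_trans _ _ (L2normD (ifourierD (distr_of (riesz_mul t (fourier h)))))).
  apply: ereal_inf_lbound; exists (ifourierD (distr_of (riesz_mul t (fourier h)))) => //.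
  exists (fourier h); split => //; last exact: inL2_tempered.
  split.
    move=> phi sp; rewrite cintegrableE; have Ip := schwartz_cintable sp.
    have IN : mu2.-integrable setT (fun x => (N1 h * nrm (phi x))%:E).
      by under eq_fun do rewrite EFinM; apply: integrableZl => //; exact: cintable_nrm.
    apply: (cintable_le _ _ IN); first by apply: cmeasM => //; exact: cintable_meas Ip.
    by move=> x; rewrite nrmM ler_wpM2r ?nrm_ge0// nrm_fourier_le.
  move=> phi sp; rewrite /fourierD /distr_of !cintE.
  by rewrite fourier_duality//; exact: schwartz_cintable.
by apply: ereal_inf_lbound; exists u.
Qed.

(** The transform of f g is pointwise at most (4 pi^2)^-1 <= 1 times the
    convolution of |F| and |G|. *)
Lemma riesz_product_le (s alpha beta e : R) f g F G :
  0 < s < 1 -> 0 < e < 1 -> alpha <= 1 - e -> 1 + e <= beta -> L2_fourier f F -> L2_fourier g G ->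
  (N2 (riesz_mul (- s) (fourier (fun x => (f x * g x)%R))) <=
   (8 * (4 * (pi / e) ^+ 2 + (2 / (1 - s)) ^+ 2))%:E *
   (N2 (riesz_mul alpha F) + N2 (riesz_mul beta F)) * N2 (riesz_mul (- s) G))%E.
Proof.
move=> hs he ha hb fF gG; have [_ [mF _] _] := fF; have [_ [mG _] _] := gG.
have [Lf _ _] := fF; have [Lg _ _] := gG.
have Ifg := cintableM_L2 Lf Lg.
have mfg := cmeas_fourier (cintable_meas Ifg).
rewrite !N2_riesz; apply: (weighted_convolution_le hs he ha hb).
- exact: measurable_nrm.
- exact: measurable_nrm.
- by move=> x; exact: nrm_ge0.
- by move=> x; exact: nrm_ge0.
- exact: measurable_nrm.
- by move=> x; exact: nrm_ge0.
move=> xi; apply: le_trans (nrm_fourier_mul_le xi fF gG).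
rewrite lee_fin ler_peMl ?nrm_ge0//.
by have := pi_ge2 R => p2; nra.
Qed.

(** In the second case 1 < sigma + r1 follows from 2 / 3 < sigma if 1 / 3 <= r1 and
    from 2 - 4 r1 < sigma otherwise. *)
Lemma exponents (r0 r1 sigma : R) :
  (sigma = 1 /\ 0 < r1) \/
  (Num.max (2 / 3) (Num.max (2 - 4 * r1) (- r0 + r1)) < sigma < 1 /\ 1 / 4 < r1 < - r0) ->
  exists e : R, [/\ 0 < e < 1, sigma + - r1 <= 1 - e & 1 + e <= sigma + r1].
Proof.
move=> H.
have [a1 b1] : sigma - r1 < 1 /\ 1 < sigma + r1.
  case: H => [[-> r10]|]; first by split; lra.
  rewrite !gt_max => -[/andP[/andP[g1 /andP[g2 g3]] g4] /andP[g5 g6]].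
  by split; lra.
(* the bound 1 / 2 keeps the exponent 1 - e of the line weight positive *)
exists (Num.min (1 - (sigma - r1)) (Num.min (sigma + r1 - 1) (1 / 2))).
set m := Num.min _ _.
have m1 : m <= 1 - (sigma - r1) by rewrite ge_min lexx.
have m2 : m <= sigma + r1 - 1 by rewrite !ge_min lexx orbT.
have m3 : m <= 1 / 2 by rewrite !ge_min lexx !orbT.
have m0 : 0 < m by rewrite !lt_min; apply/and3P; split; lra.
by split; [apply/andP; split; lra|lra|lra].
Qed.

End Sobolev.

Unset Implicit Arguments.
Local Close Scope classical_set_scope.

Theorem lemmaA5 (R : realType) (r0 r1 sigma : R)
  (hr0 : -1 < r0 < 0)
  (hsr : (sigma = 1 /\ 0 < r1) \/
         (Num.max (2 / 3) (Num.max (2 - 4 * r1) (- r0 + r1)) < sigma < 1 /\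
          1 / 4 < r1 < - r0)) :
  exists C : R, 0 < C /\
    forall f g : R * R -> R[i], L2fun f -> L2fun g ->
      (norm_fracD (@L2normD R) r0 (distr_of (fun x => (f x * g x)%R)) <=
       C%:E *
       norm_fracD (capnorm (Hnorm (- r1)) (Hnorm r1)) sigma (distr_of f) *
       Hnorm r0 (distr_of g))%E.
Proof.
have [e [he ha hb]] := exponents hsr.
have hs : 0 < - r0 < 1 by move/andP: hr0 => [? ?]; apply/andP; split; lra.
set K : R := 8 * (4 * (pi / e) ^+ 2 + (2 / (1 - - r0)) ^+ 2).
have pp : 0 < pi :> R := pi_gt0 R.
have K0 : 0 < K.
  have [e0 _] := andP he; have Q0 : 0 < (pi / e) ^+ 2 by rewrite exprn_gt0// divr_gt0.
  by have := sqr_ge0 (2 / (1 - - r0)); rewrite /K; set q := _ ^+ 2; set q' := _ ^+ 2 in Q0 *; lra.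
have S0 : 0 < Num.sqrt K by rewrite sqrtr_gt0.
(* pi^-1 bounds the inverse transform that represents the left-hand side; each
   4 * pi is the price of recovering a weighted norm of F or of G from a norm on
   the right-hand side *)
exists (pi^-1 * Num.sqrt K * (4 * pi) * (4 * pi)); split.
  by rewrite !mulr_gt0// invr_gt0.
move=> f g /L2funE Lf /L2funE Lg.
have [F fF] := L2_fourier_exists Lf; have [G gG] := L2_fourier_exists Lg.
have [_ [mG _] _] := gG.
have P1 := norm_fracD_le r0 (cintableM_L2 Lf Lg).
have P2 := riesz_product_le hs he ha hb fF gG; rewrite -/K opprK in P2.
have P3 := norm_capH_ge sigma (- r1) r1 fF.
have P4 := Hnorm_ge r0 mG (fun v rv => fourierD_L2 gG rv).
set A := norm_fracD (capnorm _ _) _ _ in P3 *; set B := Hnorm _ _ in P4 *.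
set L1 := L2norm _ in P3; set L2 := L2norm (riesz_mul (sigma + r1) F) in P3.
set L3 := L2norm _ in P4.
have L10 : (0 <= L1)%E by exact: L2norm_ge0.
have L20 : (0 <= L2)%E by exact: L2norm_ge0.
have L30 : (0 <= L3)%E by exact: L2norm_ge0.
have P5 : (L2norm (riesz_mul r0 (fourier (fun x => (f x * g x)%R))) <=
    (Num.sqrt K)%:E * ((L1 + L2) * L3))%E.
  apply: L2norm_le_sqr; first by rewrite mule_ge0 ?lee_fin ?(ltW S0)// mule_ge0// adde_ge0.
  apply: (le_trans P2); rewrite muleACA -EFinM -expr2 sqr_sqrtr ?(ltW K0)//.
  rewrite -muleA lee_wpmul2l ?lee_fin ?(ltW K0)// muleACA -(L2norm_sqr (riesz_mul r0 G)).
  rewrite lee_wpmul2r ?mule_ge0 ?L2norm_ge0// -!L2norm_sqr -/L1 -/L2.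
  rewrite ge0_muleDl// !ge0_muleDr//; apply: leeD.
    by rewrite leeDl// mule_ge0.
  by rewrite leeDr// mule_ge0.
apply: (le_trans P1); apply: (@le_trans _ _ ((pi^-1)%:E * ((Num.sqrt K)%:E *
   (((4 * pi)%:E * A) * ((4 * pi)%:E * B))))%E).
  rewrite lee_wpmul2l ?lee_fin ?invr_ge0 ?(ltW pp)//; apply: (le_trans P5).
  rewrite lee_wpmul2l ?lee_fin ?(ltW S0)//; apply: lee_pmul => //.
  by rewrite adde_ge0.
rewrite muleACA !muleA -!EFinM.
done.
Qed.
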